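(* Let $0<r\leq 1$, $1\leq p_1<\infty$, $1\leq p_2<\infty$, and let $\mathfrak{f}_{a,\phi}$ be the Fourier integral operator on $\mathbb{Z}^n$ associated to the phase function $\phi$ and to the symbol $a$. Then $\mathfrak{f}_{a,\phi}:\ell^{p_1}(\mathbb{Z}^n)\rightarrow \ell^{p_2}(\mathbb{Z}^n)$ is $r$-nuclear if and only if the symbol $a$ admits a decomposition of the form $$a(n',\xi)=e^{-i\phi(n',\xi)}\sum_{k=1}^{\infty}h_{k}(n')(\mathscr{F}_{\mathbb{Z}^n}g_k)(-\xi)\quad\text{for a.e. }(n',\xi),$$ where $\{g_k\}_{k\in\mathbb{N}}$ and $\{h_k\}_{k\in\mathbb{N}}$ are sequences of functions in $\ell^{p_1'}(\mathbb{Z}^n)$ and $\ell^{p_2}(\mathbb{Z}^n)$ respectively satisfying $$\sum_{k=1}^{\infty}\Vert g_k\Vert^r_{\ell^{p_1'}}\Vert h_{k}\Vert^r_{\ell^{p_2}}<\infty.$$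
   Context: The discrete Fourier transform of $f\in\ell^1(\mathbb{Z}^n)$ is $(\mathscr{F}_{\mathbb{Z}^n}f)(\xi)=\sum_{m\in\mathbb{Z}^n}e^{-i2\pi m\cdot\xi}f(m)$, $\xi\in[0,1]^n$ (extended periodically), and it is extended to larger sequence spaces in the usual way (Hausdorff-Young for $\ell^p$, $p\le 2$; periodic distributions in general). The phase $\phi$ and the symbol $a$ are functions on $\mathbb{Z}^n\times[0,1]^n$, measurable in $\xi$. The Fourier integral operator is $$\mathfrak{f}_{a,\phi}f(n')=\int_{[0,1]^n}e^{i\phi(n',\xi)}a(n',\xi)(\mathscr{F}_{\mathbb{Z}^n}f)(\xi)\,d\xi,\qquad f\in\ell^1(\mathbb{Z}^n),\ n'\in\mathbb{Z}^n,$$ regarded as a densely defined operator on $\ell^{p_1}(\mathbb{Z}^n)$. For $1\le p<\infty$, $p'$ is the conjugate exponent: $\frac1p+\frac1{p'}=1$. ''For a.e. $(n',\xi)$'' refers to counting measure on $\mathbb{Z}^n$ times Lebesgue measure. For Banach spaces $E_1,E_2$ and $0<r\le1$, a densely defined linear operator $T:D(T)\subset E_1\to E_2$ is said to be (to extend to) an $r$-nuclear operator from $E_1$ into $E_2$ if there exist sequences $(e_j')$ in the dual $E_1'$ and $(y_j)$ in $E_2$ such that $Tf=\sum_{j} e_j'(f)y_j$ for all $f\in D(T)$ and $\sum_{j}\Vert e_j'\Vert^r_{E_1'}\Vert y_j\Vert^r_{E_2}<\infty$. *)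

(* Defs.v *)
From HB Require Import structures.
From mathcomp Require Import all_boot all_order all_algebra finmap complex.
From mathcomp Require Import all_classical all_reals all_analysis.
From mathcomp Require summability.

Set Implicit Arguments.
Unset Strict Implicit.
Unset Printing Implicit Defensive.

Import Order.TTheory GRing.Theory Num.Theory.
Import numFieldNormedType.Exports Normc.

Local Open Scope classical_set_scope.
Local Open Scope ring_scope.
Local Open Scope complex_scope.

Section complex_numbers.
Context {R : realType}.

(* e^{iz}; for z = x + iy this is e^{-y} (cos x + i sin x). *)
Definition expi (z : R[i]) : R[i] :=
  (expR (- complex.Im z))%:C * (cos (complex.Re z) +i* sin (complex.Re z)).

Definition ccvg (u : nat -> R[i]) (l : R[i]) : Prop :=
  (u : nat -> R[i]^o) @ \oo --> (l : R[i]^o).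

(* Unordered sum: limit of the finite partial sums along inclusion of finite
   sets. *)
Definition csum (I : choiceType) (u : I -> R[i]) : R[i] :=
  summability.sum (u : I -> R[i]^o).

End complex_numbers.

Section nuclear_operators.
Context {R : realType}.

(* A normed space is given by an extended norm N on an ambient vector space V:
   its elements are the v : V with N v < +oo.  Functionals are functions on V of
   which only the values on the normed space matter. *)

Definition dual_norm (V : lmodType R[i]) (N : V -> \bar R) (e : V -> R[i]) :
    \bar R :=
  ereal_sup [set (normc (e v))%:E | v in [set v | (N v <= 1)%E]].

Definition in_dual (V : lmodType R[i]) (N : V -> \bar R) (e : V -> R[i]) :
    Prop :=
  (forall (c : R[i]) (u v : V), (N u < +oo)%E -> (N v < +oo)%E ->
     e (c *: u + v) = c * e u + e v) /\
  (dual_norm N e < +oo)%E.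

(* D is the domain of the operator T. *)
Definition r_nuclear (V1 V2 : lmodType R[i]) (N1 : V1 -> \bar R)
    (N2 : V2 -> \bar R) (r : R) (D : set V1) (T : V1 -> V2) : Prop :=
  exists (e : nat -> V1 -> R[i]) (y : nat -> V2),
    [/\ forall j, in_dual N1 (e j),
        forall j, (N2 (y j) < +oo)%E,
        forall f, D f -> (N2 (T f) < +oo)%E /\
          N2 (T f - \sum_(j < k) e j f *: y j) @[k --> \oo] --> 0%E &
        (\sum_(j <oo) (dual_norm N1 (e j) `^ r * N2 (y j) `^ r) < +oo)%E].

End nuclear_operators.

Section cube.
Context {R : realType}.

Local Notation mR := (measurableTypeR R).

Definition tuple_cons n (x : mR * n.-tuple mR) : n.+1.-tuple mR :=
  [tuple of x.1 :: x.2].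

Lemma measurable_tuple_cons n : measurable_fun setT (@tuple_cons n).
Proof. exact: measurable_cons. Qed.

HB.instance Definition _ n :=
  isMeasurableFun.Build _ _ _ _ (@tuple_cons n) (@measurable_tuple_cons n).

(* Lebesgue measure on [0,1]^n, as the n-fold product of Lebesgue measure on
   [0,1]; points of R^n are tuples here because these carry the product
   sigma-algebra. *)
Fixpoint cube_measure n : probability (n.-tuple mR) R :=
  match n with
  | 0 => dirac [tuple]
  | n'.+1 => distribution (uniform_prob (@ltr01 R) \x cube_measure n')%E
               [the {mfun _ >-> n'.+1.-tuple mR} of @tuple_cons n']
  end.

Definition cube n : set (n.-tuple mR) :=
  [set t | forall i, (tnth t i : R) \in `[0, 1]].

Definition point n (t : n.-tuple mR) : 'rV[R]_n := \row_i (tnth t i : R).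

Lemma uniform_prob01E (A : set mR) : measurable A ->
  uniform_prob (@ltr01 R) A = lebesgue_measure (A `&` `[0%R, 1%R]%classic).
Proof.
move=> mA; rewrite /uniform_prob integral_uniform_pdf.
rewrite (eq_integral (cst 1%E)).
  by rewrite integral_cst ?mul1e//; exact: measurableI.
move=> x; rewrite inE/= => -[_]; rewrite in_itv/= /uniform_pdf => ->.
by rewrite subr0 invr1.
Qed.

Lemma measurable_box n (A : 'I_n -> set mR) : (forall i, measurable (A i)) ->
  measurable [set t : n.-tuple mR | forall i, A i (tnth t i)].
Proof.
move=> mA; rewrite (_ : mkset _ =
    \bigcap_(i in [set: 'I_n]) ((@tnth n mR)^~ i @^-1` A i)).
  apply: fin_bigcap_measurable => [|i _]; first exact: finite_finset.
  by rewrite -[X in measurable X]setTI; exact: measurable_tnth.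
by apply/seteqP; split => [t tA i _|t tA i]; exact: tA.
Qed.

Lemma cube_measure_box n (A : 'I_n -> set mR) : (forall i, measurable (A i)) ->
  cube_measure n [set t | forall i, A i (tnth t i)] =
  (\prod_(i < n) lebesgue_measure (A i `&` `[0%R, 1%R]%classic))%E.
Proof.
elim: n A => [|n IH] A mA /=.
  by rewrite big_ord0 diracE mem_set// => -[].
rewrite /distribution /pushforward.
rewrite (_ : _ @^-1` _ = A ord0 `*`
    [set t : n.-tuple mR | forall i, A (lift ord0 i) (tnth t i)]).
  rewrite product_measure1E//; last first.
    exact: (measurable_box (fun i => mA (lift ord0 i))).
  rewrite big_ord_recl -uniform_prob01E// -IH// => i; exact: mA.
apply/seteqP; split => [[x t] /= xtA|[x t] [/= xA tA] i].
  split; first exact: (xtA ord0).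
  by move=> i; have := xtA (lift ord0 i); rewrite tnthS.
case: (unliftP ord0 i) => [j ->|->]; last exact: xA.
by rewrite /= tnthS.
Qed.

Definition cmeasurable n (F : 'rV[R]_n -> R[i]) : Prop :=
  measurable_fun (@cube n) (fun t => complex.Re (F (point t))) /\
  measurable_fun (@cube n) (fun t => complex.Im (F (point t))).

Definition cintegrable n (F : 'rV[R]_n -> R[i]) : Prop :=
  (cube_measure n).-integrable (@cube n)
    (EFin \o (fun t => complex.Re (F (point t)))) /\
  (cube_measure n).-integrable (@cube n)
    (EFin \o (fun t => complex.Im (F (point t)))).

Definition cint n (F : 'rV[R]_n -> R[i]) : R[i] :=
  (\int[cube_measure n]_(t in @cube n) complex.Re (F (point t))) +i*
  (\int[cube_measure n]_(t in @cube n) complex.Im (F (point t))).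

Definition ae_cube n (P : 'rV[R]_n -> Prop) : Prop :=
  {ae cube_measure n, forall t, @cube n t -> P (point t)}.

End cube.

Section fourier.
Context {R : realType} {n : nat}.
Notation Zn := 'rV[int]_n.
Notation Rn := 'rV[R]_n.

Definition lp_norm (p : \bar R) (f : Zn -> R[i]) : \bar R :=
  match p with
  | s%:E => ((\esum_(m in [set: Zn]) (normc (f m) `^ s)%:E) `^ s^-1)%E
  | +oo%E => ereal_sup [set (normc (f m))%:E | m in [set: Zn]]
  | -oo%E => 0%E
  end.

Definition in_lp (p : \bar R) : set (Zn -> R[i]) :=
  [set f | (lp_norm p f < +oo)%E].

Definition dotp (m : Zn) (xi : Rn) : R := \sum_(i < n) (m 0 i)%:~R * xi 0 i.

Definition character (m : Zn) (xi : Rn) : R[i] :=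
  expi (- (2 * pi * dotp m xi))%:C.

Definition dft (f : Zn -> R[i]) (xi : Rn) : R[i] :=
  csum (fun m => character m xi * f m).

Definition fio (a phi : Zn -> Rn -> R[i]) (f : Zn -> R[i]) (n' : Zn) : R[i] :=
  cint (fun xi => expi (phi n' xi) * a n' xi * dft f xi).

Definition periodic (F : Rn -> R[i]) : Prop :=
  forall (xi : Rn) (m : Zn), F (xi + map_mx intr m) = F xi.

(* G is a periodic representative of the Fourier transform of g in l^p, p <= 2:
   since l^p is contained in l^2, this is the L^2 limit of the transforms of the
   restrictions of g to finite sets. *)
Definition is_dft_L2 (g : Zn -> R[i]) (G : Rn -> R[i]) : Prop :=
  [/\ cmeasurable G, periodic G &
   (\int[cube_measure n]_(t in @cube R n)
      ((normc (G (point t) - \sum_(m <- A) character m (point t) * g m))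
         ^+ 2)%:E)%E
     @[A --> @summability.totally Zn] --> 0%E].

Definition smooth (f : Rn -> R) : Prop :=
  forall vs : seq Rn, let F := foldr (fun v h => 'D_v h) f vs in
    continuous F /\ forall x v, derivable F x v.

Definition test_function (psi : Rn -> R[i]) : Prop :=
  [/\ smooth (fun xi => complex.Re (psi xi)), smooth (fun xi => complex.Im (psi xi)) & periodic psi].

(* The Fourier transform of g as a periodic distribution. *)
Definition dft_dist (g : Zn -> R[i]) (psi : Rn -> R[i]) : R[i] :=
  csum (fun m => g m * cint (fun xi => character m xi * psi xi)).

(* For every n', S n' is the function sum_k h_k(n') (F g_k)(-xi), where the g_k
   are in l^q.  If q <= 2 the F g_k are functions and the series converges
   almost everywhere.  Otherwise it converges in the sense of periodic
   distributions to the regular distribution defined by S n'; the reflected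
   distribution (F g_k)(-.) maps psi to <F g_k, psi(-.)>. *)
Definition is_fourier_series (q : \bar R) (g h : nat -> Zn -> R[i])
    (S : Zn -> Rn -> R[i]) : Prop :=
  if (q <= 2%:E)%E then
    exists2 G : nat -> Rn -> R[i], forall k, is_dft_L2 (g k) (G k) &
      forall n', ae_cube (fun xi =>
        ccvg (fun K => \sum_(k < K) h k n' * G k (- xi)) (S n' xi))
  else
    forall n', cintegrable (S n') /\
      forall psi, test_function psi ->
        ccvg (fun K => \sum_(k < K) h k n' * dft_dist (g k) (psi \o -%R))
          (cint (fun xi => S n' xi * psi xi)).

(* Null sets for the product of the counting measure on Z^n with Lebesgue
   measure are the sets all of whose sections are null. *)
Definition symbol_decomposition (r p1 p2 : R) (a phi : Zn -> Rn -> R[i]) :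
    Prop :=
  let q := hoelder_conjugate p1%:E in
  exists g h : nat -> Zn -> R[i],
    [/\ forall k, in_lp q (g k),
        forall k, in_lp p2%:E (h k),
        (\sum_(k <oo) (lp_norm q (g k) `^ r * lp_norm p2%:E (h k) `^ r)
           < +oo)%E &
        exists2 S : Zn -> Rn -> R[i], is_fourier_series q g h S &
          forall n', ae_cube (fun xi =>
            a n' xi = expi (- phi n' xi) * S n' xi)].

End fourier.

(* Main.v *)
Require Import Defs.
From mathcomp Require Import all_boot all_order all_algebra finmap complex.
From mathcomp Require Import all_classical all_reals all_analysis.
From mathcomp Require Import measurable_realfun ring lra.
From mathcomp Require summability.

(** Put sigma_n' = e^{i phi(n', .)} a(n', .), an integrable function on the cube,
    and let K(n', m) be its integral against the character of frequency m. This
    is the value at n' of the operator applied to the unit sequence at m. Each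
    side of the equivalence says that
      K(n', m) = sum_k h_k(n') g_k(m)   for all n' and m,
    for some g_k and h_k whose norms satisfy the summability condition.

    For the operator this is [r_nuclear_iff_expansion]. A nuclear expansion
    evaluated at the unit sequences gives such g_k, since the values of a
    functional on l^p1 at the unit sequences form an element of l^q, for the
    exponent q dual to p1 ([dual_coefficients_le]). Conversely, an f in l^1 is
    approximated by its restrictions to finite sets. As r is at most 1, the
    products of the norms are summable, so this approximation is uniform in the
    number of terms of the expansion; the two limits can be exchanged, and the
    expansion of K passes to the operator ([coefficient_expansion_l1]).

    For the symbol this is [decomposition_iff_expansion]. The decomposition
    expresses sigma_n' as the sum of the functions h_k(n') (F g_k)(-xi), and the
    coefficients of (F g_k)(-xi) are the g_k(m). So the expansion of K follows by
    taking Fourier coefficients, and implies the decomposition because an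
    integrable function is determined by its Fourier coefficients
    ([fourier_uniqueness]). If the dual exponent is at most 2, the F g_k are
    functions, by the Riesz-Fischer theorem ([riesz_fischer]), whose norms in L^1
    are at most the norms of the g_k; the series converges in L^1 and almost
    everywhere ([L1_series]). Otherwise it converges as a periodic distribution.
    Characters are test functions, which gives one direction. For the other one,
    a test function is the sum of its absolutely convergent Fourier series
    ([test_function_dft]), so that [coefficient_expansion_l1] applies again, now
    to the sequence of its coefficients.

    Uniqueness of the coefficients rests on products of waves being means of two
    waves. The bounded functions b that can be multiplied into the orthogonality
    relations form an algebra closed under bounded limits. With c it contains
    exp(-exp(-j(c - s))), hence in the limit the indicators of the superlevel
    sets of waves, and these sets generate the Borel sets of the cube. The decay
    of the coefficients of a smooth function comes from translations by half a
    period of the wave, which replace the function by half of its difference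
    ([wave_coefficient_decay]). *)

Set Implicit Arguments.
Unset Strict Implicit.
Unset Printing Implicit Defensive.

Import Order.TTheory GRing.Theory Num.Theory.
Import numFieldNormedType.Exports Normc.

Local Open Scope classical_set_scope.
Local Open Scope ring_scope.
Local Open Scope complex_scope.

Local Notation point := Defs.point.

(** * Complex numbers *)

Section complex_numbers.
Context {R : realType}.
Implicit Types z w : R[i].

Lemma normrcE z : `|z| = (normc z)%:C.
Proof. by []. Qed.

Lemma normc_ge0 z : 0 <= normc z.
Proof. by case: z => x y /=; exact: sqrtr_ge0. Qed.

Lemma normcB z w : normc (z - w) = normc (w - z).
Proof. by rewrite -opprB normcN. Qed.

Lemma normc_real (x : R) : normc x%:C = `|x|.
Proof. by rewrite /= expr0n addr0 sqrtr_sqr. Qed.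

Lemma ler_Re_normc z : `|complex.Re z| <= normc z.
Proof.
case: z => x y /=; rewrite -sqrtr_sqr; apply: ler_wsqrtr.
by rewrite lerDl sqr_ge0.
Qed.

Lemma ler_Im_normc z : `|complex.Im z| <= normc z.
Proof.
case: z => x y /=; rewrite -sqrtr_sqr; apply: ler_wsqrtr.
by rewrite lerDr sqr_ge0.
Qed.

Lemma ler_normc_ReIm z : normc z <= `|complex.Re z| + `|complex.Im z|.
Proof.
case: z => x y /=.
rewrite -[leRHS]ger0_norm ?addr_ge0// -sqrtr_sqr; apply: ler_wsqrtr.
rewrite sqrrD !real_normK ?num_real// lerD2r lerDl.
by rewrite mulrn_wge0// mulr_ge0.
Qed.

Lemma ler_normc_sum (I : Type) (s : seq I) (P : pred I) (F : I -> R[i]) :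
  normc (\sum_(i <- s | P i) F i) <= \sum_(i <- s | P i) normc (F i).
Proof.
elim/big_rec2: _ => [|i y x _ IH]; first by rewrite normc0.
by apply: le_trans (le_normcD _ _) _; rewrite lerD2l.
Qed.

Lemma normcX2 z : normc z ^+ 2 = complex.Re z ^+ 2 + complex.Im z ^+ 2.
Proof. by case: z => x y /=; rewrite sqr_sqrtr// addr_ge0 ?sqr_ge0. Qed.

Lemma Re_sum (I : Type) (s : seq I) (P : pred I) (F : I -> R[i]) :
  complex.Re (\sum_(i <- s | P i) F i) = \sum_(i <- s | P i) complex.Re (F i).
Proof. by elim/big_rec2: _ => // i x y _ <-; case: (F i); case: y. Qed.

Lemma Im_sum (I : Type) (s : seq I) (P : pred I) (F : I -> R[i]) :
  complex.Im (\sum_(i <- s | P i) F i) = \sum_(i <- s | P i) complex.Im (F i).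
Proof. by elim/big_rec2: _ => // i x y _ <-; case: (F i); case: y. Qed.

Lemma cReD z w : complex.Re (z + w) = complex.Re z + complex.Re w.
Proof. by case: z; case: w. Qed.
Lemma cImD z w : complex.Im (z + w) = complex.Im z + complex.Im w.
Proof. by case: z; case: w. Qed.
Lemma cReB z w : complex.Re (z - w) = complex.Re z - complex.Re w.
Proof. by case: z; case: w. Qed.
Lemma cImB z w : complex.Im (z - w) = complex.Im z - complex.Im w.
Proof. by case: z; case: w. Qed.
Lemma cReM z w : complex.Re (z * w) =
  complex.Re z * complex.Re w - complex.Im z * complex.Im w.
Proof. by case: z; case: w. Qed.
Lemma cImM z w : complex.Im (z * w) =
  complex.Re z * complex.Im w + complex.Im z * complex.Re w.
Proof. by case: z => a b; case: w => c d /=; rewrite [b * c]mulrC. Qed.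

Lemma expiD z w : expi (z + w) = expi z * expi w.
Proof.
case: z => a b; case: w => c d; apply/eqP; rewrite eq_complex /=.
by rewrite opprD expRD cosD sinD; apply/andP; split; apply/eqP; ring.
Qed.

Lemma expi0 : expi (0 : R[i]) = 1.
Proof.
by apply/eqP; rewrite eq_complex /= oppr0 expR0 cos0 sin0 !mul0r mul1r subr0
  addr0 mulr0 !eqxx.
Qed.

Lemma expiNK z w : expi (- z) * (expi z * w) = w.
Proof. by rewrite mulrA -expiD addNr expi0 mul1r. Qed.

Lemma expiKN z w : expi z * (expi (- z) * w) = w.
Proof. by rewrite mulrA -expiD subrr expi0 mul1r. Qed.

Lemma expi_real (x : R) : expi x%:C = cos x +i* sin x.
Proof.
by apply/eqP; rewrite eq_complex /= oppr0 expR0 !mul0r !mul1r subr0 addr0 !eqxx.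
Qed.

Lemma normc_expi_real (x : R) : normc (expi x%:C) = 1.
Proof. by rewrite expi_real /= cos2Dsin2 sqrtr1. Qed.

Lemma cvg_normcP (T : Type) (F : set_system T) (FF : Filter F)
    (u : T -> R[i]) (l : R[i]) :
  (u : T -> R[i]^o) @ F --> (l : R[i]^o) <->
  normc (u t - l) @[t --> F] --> (0 : R).
Proof.
split=> [/cvgrPdist_lt ul|/cvgr0Pnorm_lt ul].
- apply/cvgr0Pnorm_lt => e e0.
  have := ul e%:C; rewrite ltcR => /(_ e0); apply: filterS => t.
  by rewrite normrcE ltcR ger0_norm ?normc_ge0// normcB.
- apply/cvgrPdist_lt => -[e e']; rewrite ltcE/= => /andP[/eqP-> e0].
  have := ul e e0; apply: filterS => t.
  by rewrite normrcE ltcR ger0_norm ?normc_ge0// normcB.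
Qed.

Lemma cvg_ReImP (T : Type) (F : set_system T) (FF : Filter F)
    (u : T -> R[i]) (l : R[i]) :
  (u : T -> R[i]^o) @ F --> (l : R[i]^o) <->
  complex.Re (u t) @[t --> F] --> complex.Re l /\
  complex.Im (u t) @[t --> F] --> complex.Im l.
Proof.
split=> [/cvg_normcP ul|[rl il]].
- split; apply/cvgrPdist_lt => e e0;
    move/cvgr0Pnorm_lt : ul => /(_ _ e0); apply: filterS => t;
    rewrite ger0_norm ?normc_ge0// normcB; apply: le_lt_trans.
  + by rewrite -cReB ler_Re_normc.
  + by rewrite -cImB ler_Im_normc.
- apply/cvg_normcP.
  apply: (@squeeze_cvgr _ _ _ _ (fun=> 0)
    (fun t => `|complex.Re (u t) - complex.Re l| +
              `|complex.Im (u t) - complex.Im l|)).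
  + apply: nearW => t; rewrite normc_ge0/= -cReB -cImB; exact: ler_normc_ReIm.
  + exact: cvg_cst.
  + rewrite -[X in _ --> X]addr0; apply: cvgD;
      by apply/norm_cvg0P; apply/subr_cvg0.
Qed.

End complex_numbers.

Lemma cvg_sumr {R : realType} (T : Type) (F : set_system T) (FF : Filter F)
    (I : Type) (s : seq I) (f : I -> T -> R) (l : I -> R) :
  (forall i, f i x @[x --> F] --> l i) ->
  \sum_(i <- s) f i x @[x --> F] --> \sum_(i <- s) l i.
Proof.
move=> fl; elim: s => [|i s IH].
  by rewrite big_nil; under eq_cvg do rewrite big_nil; exact: cvg_cst.
by rewrite big_cons; under eq_cvg do rewrite big_cons; apply: cvgD.
Qed.

(** * Absolutely summable families *)

Section families.
Context {R : realType} {I : choiceType}.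
Implicit Types (u v : I -> R[i]) (w : I -> R) (A B : {fset I}).

(** Nonnegative families are summed through a common bound of their finite
    partial sums, which keeps the estimates in the real numbers. *)
Definition sums_le w C := forall A, \sum_(i <- A) w i <= C.

Lemma sums_leS w A B : (forall i, 0 <= w i) -> {subset A <= B} ->
  \sum_(i <- A) w i <= \sum_(i <- B) w i.
Proof.
move=> w0 AB.
rewrite [leRHS](big_fsetID _ (mem A))/=.
have -> : [fset x in B | x \in A]%fset = A.
  by apply/fsetP => x; rewrite !inE andb_idl//; exact: AB.
by rewrite lerDl sumr_ge0.
Qed.

Lemma sums_le_term w C i : (forall i, 0 <= w i) -> sums_le w C -> w i <= C.
Proof. by move=> w0 /(_ [fset i]%fset); rewrite big_seq_fset1. Qed.

Lemma sums_le_ge0 w C : sums_le w C -> 0 <= C.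
Proof. by move=> /(_ fset0); rewrite big_seq_fset0. Qed.

Lemma le_sums_le w w' C : (forall i, w i <= w' i) -> sums_le w' C ->
  sums_le w C.
Proof. by move=> ww' w'C A; apply: le_trans (w'C A); exact: ler_sum. Qed.

Lemma sums_leZ w C k : 0 <= k -> sums_le w C ->
  sums_le (fun i => k * w i) (k * C).
Proof. by move=> k0 wC A; rewrite -mulr_sumr ler_wpM2l. Qed.

Lemma sums_leD w w' C C' : sums_le w C -> sums_le w' C' ->
  sums_le (fun i => w i + w' i) (C + C').
Proof. by move=> wC wC' A; rewrite big_split lerD. Qed.

Lemma esum_leP w C : (forall i, 0 <= w i) ->
  (\esum_(i in [set: I]) (w i)%:E <= C%:E)%E <-> sums_le w C.
Proof.
move=> w0; split=> [wC A|wC].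
- rewrite -lee_fin; apply: le_trans wC; apply: esum_ge; exists [set` A].
    by split => //; exact: finite_fset.
  by rewrite fsbig_finite ?finite_fset//= set_fsetK sumEFin.
- apply: ge_ereal_sup => _ [A [fA _] <-].
  by rewrite fsbig_finite//= sumEFin lee_fin.
Qed.

(** A bounded family of nonnegative numbers has finite sums close to their
    supremum; every finite set avoiding such a sum contributes little. *)
Lemma sums_le_tail w C e : (forall i, 0 <= w i) -> sums_le w C -> 0 < e ->
  exists A, sums_le (fun i => if i \in A then 0 else w i) e.
Proof.
move=> w0 wC e0.
pose E := [set x | exists A, x = \sum_(i <- A) w i].
have supE : has_sup E.
  split; first by exists (\sum_(i <- fset0) w i), fset0.
  by exists C => _ [A ->].
have [_ [A ->] Ae] := sup_adherent e0 supE.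
exists A => B.
rewrite (big_fsetID _ (mem A))/= big_seq big1 ?add0r; last first.
  by move=> i; rewrite !inE/= => /andP[_ ->].
rewrite big_seq (eq_bigr w) -?big_seq; last first.
  by move=> i; rewrite !inE/= => /andP[_ /negbTE->].
set D := [fset x in B | x \notin A]%fset.
have : \sum_(i <- (A `|` D)%fset) w i <= sup E.
  by apply: (ub_le_sup (proj2 supE)); exists (A `|` D)%fset.
rewrite (big_fsetID _ (mem A))/=.
have -> : [fset x in (A `|` D)%fset | x \in A]%fset = A.
  by apply/fsetP => x; rewrite !inE; case: (x \in A); rewrite ?andbF.
have -> : [fset x in (A `|` D)%fset | x \notin A]%fset = D.
  by apply/fsetP => x; rewrite !inE; case: (x \in A); rewrite ?andbF ?andbT.
move=> h; rewrite -(lerD2l (\sum_(i <- A) w i)); apply: le_trans h _.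
by rewrite -lerBlDr ltW.
Qed.

Instance totally_proper : ProperFilter (@summability.totally I).
Proof. exact: summability.totally_filter. Qed.

Lemma totally_superset A :
  summability.totally (fun B : {fset I} => {subset A <= B}).
Proof. by exists A => // B /= /fsubsetP. Qed.

Lemma nneg_totally_cvg w C : (forall i, 0 <= w i) -> sums_le w C ->
  exists l : R, \sum_(i <- A) w i @[A --> summability.totally] --> l.
Proof.
move=> w0 wC.
pose E := [set x | exists A, x = \sum_(i <- A) w i].
have supE : has_sup E.
  split; first by exists (\sum_(i <- fset0) w i), fset0.
  by exists C => _ [A ->].
exists (sup E); apply/cvgrPdist_le => e e0.
have [_ [A ->] Ae] := sup_adherent e0 supE.
apply: filterS (totally_superset A) => B AB.
rewrite ger0_norm ?subr_ge0; last first.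
  by apply: (ub_le_sup (proj2 supE)); exists B.
rewrite lerBlDr -lerBlDl; apply/ltW/(lt_le_trans Ae); exact: sums_leS.
Qed.

Lemma real_totally_cvg w C : sums_le (fun i => `|w i|) C ->
  exists l : R, \sum_(i <- A) w i @[A --> summability.totally] --> l.
Proof.
move=> wC.
have [l ll] := nneg_totally_cvg (fun i => normr_ge0 (w i)) wC.
have w0 i : 0 <= `|w i| + w i by rewrite addrC -lerBlDr sub0r lerNnormlW.
have [|l' ll'] := @nneg_totally_cvg _ (C + C) w0.
  by move=> A; rewrite big_split lerD//; apply: le_trans (wC A); exact: ler_sum (fun i _ => ler_norm _).
exists (l' - l); under eq_cvg.
  move=> A; rewrite (_ : \sum_(i <- A) w i =
    \sum_(i <- A) (`|w i| + w i) - \sum_(i <- A) `|w i|); last first.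
    by rewrite big_split/= [X in X - _]addrC addrK.
  over.
exact: cvgB.
Qed.

Definition abs_sums_le u C := sums_le (fun i => normc (u i)) C.

Lemma csum_unique u (l : R[i]) :
  ((fun A => \sum_(i <- A) u i) : {fset I} -> R[i]^o) @ summability.totally
    --> (l : R[i]^o) -> csum u = l.
Proof.
move=> ul.
have e : @summability.partial_sum I R[i]^o u =
    (fun A => \sum_(i <- A) u i) :> ({fset I} -> R[i]^o).
  by apply/funext => A; rewrite /summability.partial_sum big_seq_fsetE.
rewrite -e in ul.
have h := @cvg_lim R[i]^o (@norm_hausdorff _ R[i]^o) _ _ totally_proper _ _ ul.
by rewrite -[RHS]h.
Qed.

Lemma csum_cvg u C : abs_sums_le u C ->
  ((fun A => \sum_(i <- A) u i) : {fset I} -> R[i]^o) @ summability.totally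
    --> (csum u : R[i]^o).
Proof.
move=> uC.
have [|a ra] := @real_totally_cvg (fun i => complex.Re (u i)) C.
  by apply: le_sums_le uC => i; exact: ler_Re_normc.
have [|b ib] := @real_totally_cvg (fun i => complex.Im (u i)) C.
  by apply: le_sums_le uC => i; exact: ler_Im_normc.
have ul : ((fun A => \sum_(i <- A) u i) : {fset I} -> R[i]^o)
    @ summability.totally --> (a +i* b : R[i]^o).
  apply/cvg_ReImP; split => /=; under eq_cvg do rewrite ?Re_sum ?Im_sum;
    by [exact: ra|exact: ib].
by rewrite (csum_unique ul).
Qed.

Lemma csum_linear (c : R[i]) u v C D : abs_sums_le u C -> abs_sums_le v D ->
  csum (fun i => c * u i + v i) = c * csum u + csum v.
Proof.
move=> /csum_cvg uC /csum_cvg vD; apply: csum_unique.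
under eq_cvg do rewrite big_split/= -mulr_sumr.
exact: (@cvgD _ R[i]^o _ _ _ (fun A => c * \sum_(i <- A) u i : R[i]^o) (fun A => \sum_(i <- A) v i : R[i]^o) _ _ (@cvgMr _ _ _ _ (fun A => \sum_(i <- A) u i : R[i]^o) c _ uC) vD).
Qed.

Lemma csum_finite_support u A : (forall i, i \notin A -> u i = 0) ->
  csum u = \sum_(i <- A) u i.
Proof.
move=> uA; apply: csum_unique; apply: cvg_near_cst.
apply: filterS (totally_superset A) => B AB.
by apply/esym; apply: big_fset_incl => [|i _ /uA//]; exact/fsubsetP.
Qed.

Lemma normc_csum_le u C : abs_sums_le u C -> normc (csum u) <= C.
Proof.
move=> uC; apply/ler_addgt0Pr => e e0.
have /cvg_normcP/cvgr0Pnorm_le/(_ _ e0)/filter_ex[A] := csum_cvg uC.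
rewrite ger0_norm ?normc_ge0// normcB => Ae.
rewrite -(subrK (\sum_(i <- A) u i) (csum u)) addrC.
apply: le_trans (le_normcD _ _) _; apply: lerD => //.
by apply: le_trans (ler_normc_sum _ _ _) (uC A).
Qed.

Lemma csum_tail_le u C A e : abs_sums_le u C ->
  sums_le (fun i => if i \in A then 0 else normc (u i)) e ->
  normc (csum u - \sum_(i <- A) u i) <= e.
Proof.
move=> uC ue.
pose v i := if i \in A then u i else 0.
pose t i := if i \in A then 0 else u i.
have vC : abs_sums_le v C.
  by apply: le_sums_le uC => i; rewrite /v; case: ifP => //; rewrite normc0 normc_ge0.
have te : abs_sums_le t e.
  by apply: le_sums_le ue => i; rewrite /t; case: ifP => //; rewrite normc0.
have -> : csum u = 1 * csum v + csum t.
  rewrite -(csum_linear _ vC te); congr csum; apply/funext => i.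
  by rewrite mul1r /v /t; case: ifP => _; rewrite ?addr0 ?add0r.
rewrite (@csum_finite_support v A); last by move=> i /negbTE iA; rewrite /v iA.
have -> : \sum_(i <- A) v i = \sum_(i <- A) u i.
  by rewrite big_seq [RHS]big_seq; apply: eq_bigr => i; rewrite /v => ->.
by rewrite mul1r addrC addrA addNr add0r; exact: normc_csum_le.
Qed.

End families.

(** * Sequence spaces and their duals *)

Section lp_spaces.
Context {R : realType} {n : nat}.
Notation Zn := 'rV[int]_n.
Implicit Types (f g : Zn -> R[i]) (p q : \bar R) (s : R).

Lemma lp_norm_leP s f (M : R) : 0 < s -> 0 <= M ->
  (lp_norm s%:E f <= M%:E)%E <-> sums_le (fun m => normc (f m) `^ s) (M `^ s).
Proof.
move=> s0 M0; rewrite /lp_norm -esum_leP; last by move=> ?; exact: powR_ge0.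
set E := esum _ _.
have E0 : (0 <= E)%E by apply: esum_ge0 => m _; rewrite lee_fin powR_ge0.
have hE (x : \bar R) : (0 <= x)%E -> x \in `[0, +oo]%E.
  by move=> x0; rewrite in_itv/= x0/= leey.
split=> h.
- have := @gt0_ler_poweR R s (ltW s0) _ _ (hE _ (poweR_ge0 E s^-1)) (hE M%:E M0) h.
  by rewrite -poweRrM mulVf ?gt_eqF// poweRe1.
- have si : 0 <= s^-1 by rewrite invr_ge0 ltW.
  have := @gt0_ler_poweR R s^-1 si _ _ (hE _ E0) (hE (M `^ s)%:E (powR_ge0 _ _)) h.
  by rewrite poweR_EFin -powRrM mulfV ?gt_eqF// powRr1.
Qed.

Lemma linfty_norm_leP f (M : R) :
  (lp_norm +oo%E f <= M%:E)%E <-> forall m, normc (f m) <= M.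
Proof.
split=> h.
- move=> m; rewrite -lee_fin; apply: le_trans h.
  by apply: ereal_sup_ubound; exists m.
- by apply: ge_ereal_sup => _ [m _ <-]; rewrite lee_fin.
Qed.

Lemma lp_norm_ge0 q f : (0 <= lp_norm q f)%E.
Proof.
case: q => [s||] //=; first exact: poweR_ge0.
apply: (@le_trans _ _ (normc (f 0))%:E); first by rewrite lee_fin normc_ge0.
by apply: ereal_sup_ubound; exists 0.
Qed.

Lemma lp_norm_fin_num q f : (lp_norm q f < +oo)%E ->
  exists2 M : R, 0 <= M & lp_norm q f = M%:E.
Proof.
move=> fq; exists (fine (lp_norm q f)); first by rewrite fine_ge0 ?lp_norm_ge0.
by rewrite fineK// ge0_fin_numE// lp_norm_ge0.
Qed.

Lemma lp_norm_coord q f (M : R) m : (0 < q)%E ->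
  (lp_norm q f <= M%:E)%E -> normc (f m) <= M.
Proof.
case: q => [s s0 fM|_ /linfty_norm_leP//|//].
have M0 : 0 <= M by rewrite -lee_fin (le_trans (lp_norm_ge0 _ _) fM).
rewrite lte_fin in s0.
move/(lp_norm_leP _ s0 M0) : fM => fM.
have := sums_le_term m (fun m => powR_ge0 _ _) fM => h.
have si : 0 <= s^-1 by rewrite invr_ge0 ltW.
have := ge0_ler_powR si (powR_ge0 _ _) (powR_ge0 _ _) h.
by rewrite -!powRrM mulfV ?gt_eqF// !powRr1// normc_ge0.
Qed.

Lemma l1_norm_leP f (M : R) : (lp_norm 1%:E f <= M%:E)%E <-> abs_sums_le f M.
Proof.
have [M0|M0] := leP 0 M.
  rewrite lp_norm_leP//; rewrite powRr1//.
  split; apply: le_sums_le => m; by rewrite powRr1// normc_ge0.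
split=> [h|/sums_le_ge0]; last by rewrite leNgt M0.
by have := le_trans (lp_norm_ge0 _ _) h; rewrite lee_fin leNgt M0.
Qed.

(** Convexity of the power function at the point where the two terms have the
    weights of their own norms: the triangle inequality for one coordinate. *)
Lemma powRD_weighted (p a b A B : R) : 1 <= p -> 0 <= a -> 0 <= b -> 0 < A ->
  0 < B -> (a + b) `^ p <=
  (A + B) `^ p * (A / (A + B) * (a `^ p / A `^ p) +
                  B / (A + B) * (b `^ p / B `^ p)).
Proof.
move=> p1 a0 b0 A0 B0.
have AB0 : 0 < A + B by rewrite addr_gt0.
have t01 : (0 : R) <= A / (A + B) <= 1.
  apply/andP; split; first by rewrite divr_ge0 ?ltW.
  by rewrite ler_pdivrMr// mul1r lerDl ltW.
have hx (x X : R) : 0 <= x -> 0 < X -> x / X \in (`[0, +oo[%classic : set R).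
  by move=> x0 X0; rewrite inE/= in_itv/= andbT divr_ge0// ltW.
pose t := Itv01 (proj1 (andP t01)) (proj2 (andP t01)).
have : (A / (A + B) * (a / A) + (1 - A / (A + B)) * (b / B)) `^ p <=
    A / (A + B) * (a / A) `^ p + (1 - A / (A + B)) * (b / B) `^ p.
  exact: (convex_powR p1 t (hx a A a0 A0) (hx b B b0 B0)).
have powV x X : 0 <= x -> 0 < X -> (x / X) `^ p = x `^ p / X `^ p.
  move=> x0 X0; rewrite powRM// ?invr_ge0 ?ltW//; congr (_ * _).
  by rewrite -[X^-1]powR_inv1 ?(ltW X0)// powRAC powR_inv1// powR_ge0.
have -> : 1 - A / (A + B) = B / (A + B) by field; rewrite gt_eqF.
rewrite !powV//.
have -> : A / (A + B) * (a / A) + B / (A + B) * (b / B) = (a + b) / (A + B).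
  by field; rewrite !gt_eqF.
rewrite powV ?addr_ge0// ler_pdivrMr ?powR_gt0// => h.
by rewrite mulrC.
Qed.

Lemma lp_norm0P s f : 0 < s -> (lp_norm s%:E f <= 0%:E)%E -> f = fun=> 0.
Proof.
move=> s0 f0; apply/funext => m; apply: eq0_normc; apply/eqP.
by rewrite eq_le normc_ge0 (@lp_norm_coord s%:E _ 0 m).
Qed.

(** For positive A and B, the inequality of [powRD_weighted] is summed over
    the entries; its weights are those for which the bounds add up to the
    power of A + B. *)
Lemma lp_norm_triangle s f g (A B : R) : 1 <= s ->
  (lp_norm s%:E f <= A%:E)%E -> (lp_norm s%:E g <= B%:E)%E ->
  (lp_norm s%:E (f + g)%R <= (A + B)%:E)%E.
Proof.
move=> s1 fA gB; have s0 : 0 < s by rewrite (lt_le_trans ltr01).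
have A0 : 0 <= A by rewrite -lee_fin (le_trans (lp_norm_ge0 _ _) fA).
have B0 : 0 <= B by rewrite -lee_fin (le_trans (lp_norm_ge0 _ _) gB).
move: A0; rewrite le_eqVlt => /predU1P[A0|A0].
  rewrite -{}A0 in fA *; rewrite (lp_norm0P s0 fA) [(0 + B)%R]add0r.
  rewrite (_ : (fun=> 0) + g = g)//; apply/funext => m; exact: add0r.
move: B0; rewrite le_eqVlt => /predU1P[B0|B0].
  rewrite -{}B0 in gB *; rewrite (lp_norm0P s0 gB) [(A + 0)%R]addr0.
  rewrite (_ : f + (fun=> 0) = f)//; apply/funext => m; exact: addr0.
apply/lp_norm_leP; rewrite ?addr_ge0 ?ltW//.
move/(lp_norm_leP _ s0 (ltW A0)): fA => fA.
move/(lp_norm_leP _ s0 (ltW B0)): gB => gB.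
have AB0 : 0 < A + B by rewrite addr_gt0.
pose cA := (A + B) `^ s * (A / (A + B) / A `^ s).
pose cB := (A + B) `^ s * (B / (A + B) / B `^ s).
have cA0 : 0 <= cA by rewrite !mulr_ge0 ?invr_ge0 ?powR_ge0 ?ltW.
have cB0 : 0 <= cB by rewrite !mulr_ge0 ?invr_ge0 ?powR_ge0 ?ltW.
have -> : (A + B) `^ s = cA * A `^ s + cB * B `^ s.
  rewrite /cA /cB; have As : A `^ s != 0 by rewrite gt_eqF// powR_gt0.
  have Bs : B `^ s != 0 by rewrite gt_eqF// powR_gt0.
  by field; rewrite As Bs gt_eqF.
apply: le_sums_le (sums_leD (sums_leZ cA0 fA) (sums_leZ cB0 gB)) => m.
apply: (@le_trans _ _ ((normc (f m) + normc (g m)) `^ s)).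
  apply: ge0_ler_powR; rewrite ?nnegrE ?addr_ge0 ?normc_ge0 ?(ltW s0)//.
  exact: le_normcD.
apply: le_trans (powRD_weighted s1 (normc_ge0 _) (normc_ge0 _) A0 B0) _.
by rewrite le_eqVlt; apply/orP; left; apply/eqP; rewrite /cA /cB; ring.
Qed.

Lemma lp_normZ_le s (c : R[i]) f (M : R) : 0 < s -> 0 <= M ->
  (lp_norm s%:E f <= M%:E)%E ->
  (lp_norm s%:E (c *: f) <= (normc c * M)%:E)%E.
Proof.
move=> s0 M0 /(lp_norm_leP _ s0 M0) fM.
apply/lp_norm_leP; rewrite ?mulr_ge0 ?normc_ge0//.
rewrite powRM ?normc_ge0//.
apply: le_sums_le (sums_leZ (powR_ge0 _ _) fM) => m.
by rewrite normcM powRM ?normc_ge0.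
Qed.

Lemma lp_norm_sum_le s (k : nat) (c : nat -> R[i]) (y : nat -> Zn -> R[i])
    (M : nat -> R) (P : pred nat) : 1 <= s ->
  (forall j, lp_norm s%:E (y j) <= (M j)%:E)%E ->
  (lp_norm s%:E (\sum_(j < k | P j) c j *: y j)%R
    <= (\sum_(j < k | P j) normc (c j) * M j)%R%:E)%E.
Proof.
move=> s1 yM; have s0 : 0 < s by rewrite (lt_le_trans ltr01).
elim: k => [|k IH].
  rewrite !big_ord0; apply/lp_norm_leP => // A.
  by rewrite powR0 ?gt_eqF// big1// => m _; rewrite normc0 powR0// gt_eqF.
rewrite big_mkcond [in leRHS]big_mkcond !big_ord_recr/= -!big_mkcond/=.
apply: lp_norm_triangle => //; case: ifP => _.
  apply: lp_normZ_le => //.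
  by rewrite -lee_fin (le_trans (lp_norm_ge0 _ _) (yM k)).
apply/lp_norm_leP => // A.
by rewrite powR0 ?gt_eqF// big1// => m _; rewrite normc0 powR0// gt_eqF.
Qed.

(** A bound of the norm concerns finitely many entries at a time, and on
    finitely many entries pointwise convergence is convergence in norm. *)
Lemma lp_norm_lim_le s (F : nat -> Zn -> R[i]) f (M : R) : 1 <= s -> 0 <= M ->
  (forall m, ccvg (F ^~ m) (f m)) ->
  (\forall k \near \oo, (lp_norm s%:E (F k) <= M%:E)%E) ->
  (lp_norm s%:E f <= M%:E)%E.
Proof.
move=> s1 M0 Ff FM; have s0 : 0 < s by rewrite (lt_le_trans ltr01).
apply/lp_norm_leP => // A.
pose res h : Zn -> R[i] := fun m => if m \in A then h m else 0.
have resM k : (lp_norm s%:E (F k) <= M%:E)%E ->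
    (lp_norm s%:E (res (F k)) <= M%:E)%E.
  move=> /(lp_norm_leP _ s0 M0) h; apply/lp_norm_leP => //.
  apply: le_sums_le h => m; rewrite /res; case: ifP => // _.
  by rewrite normc0 powR0 ?gt_eqF// powR_ge0.
have resfM : (lp_norm s%:E (res f) <= M%:E)%E.
  apply/lee_addgt0Pr => e e0.
  have dist k : (lp_norm s%:E (res (f - F k)%R) <=
      (\sum_(m <- A) normc (F k m - f m)%R)%R%:E)%E.
    have S0 : 0 <= \sum_(m <- A) normc (F k m - f m).
      by apply: sumr_ge0 => m _; exact: normc_ge0.
    have : forall B : {fset Zn}, \sum_(m <- B) normc (res (f - F k) m) <=
        \sum_(m <- A) normc (F k m - f m).
      move=> B; rewrite (big_fsetID _ (mem A))/= [X in _ + X]big1_seq ?addr0.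
        rewrite big_seq (eq_bigr (fun m => normc (F k m - f m))).
          rewrite -big_seq; apply: sums_leS => [m|m]; first exact: normc_ge0.
          by rewrite !inE => /andP[].
        by move=> m; rewrite !inE => /andP[_ mA]; rewrite /res mA normcB.
      move=> m /=; rewrite !inE => /andP[_ /negbTE mA].
      by rewrite /res mA normc0.
    set S := \sum_(m <- A) _ => SB.
    apply/lp_norm_leP => // B.
    (* the l^s norm is at most the l^1 norm *)
    have [S00|S00] := eqVneq S 0.
      rewrite S00 powR0 ?gt_eqF// big1// => m _.
      suff -> : normc (res (f - F k) m) = 0 by rewrite powR0 ?gt_eqF.
      apply/eqP; rewrite eq_le normc_ge0 andbT -S00.
      by apply: (@sums_le_term R _ (fun m => normc (res (f - F k) m))) => // i; exact: normc_ge0.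
    have Spos : 0 < S by rewrite lt_neqAle eq_sym S00.
    apply: (@le_trans _ _ (\sum_(m <- B) normc (res (f - F k) m) / S * S `^ s)).
      apply: ler_sum => m _.
      set x := normc _.
      have xS : x <= S.
        by apply: (@sums_le_term R _ (fun m => normc (res (f - F k) m))) => // i; exact: normc_ge0.
      have x0 : 0 <= x by exact: normc_ge0.
      have -> : x = x / S * S by rewrite divfK.
      rewrite powRM ?divr_ge0 ?(ltW Spos)//; rewrite (divfK S00).
      apply: ler_wpM2r; first exact: powR_ge0.
      move: x0; rewrite le_eqVlt => /predU1P[<-|x0].
        by rewrite mul0r powR0 ?gt_eqF.
      apply: ge1r_powR => //; rewrite divr_gt0//= ler_pdivrMr// mul1r//.
    rewrite -!mulr_suml -[leRHS]mul1r; apply: ler_wpM2r; first exact: powR_ge0.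
    by rewrite ler_pdivrMr// mul1r SB.
  have d0 : \sum_(m <- A) normc (F k m - f m) @[k --> \oo] --> (0 : R).
    rewrite -[X in _ --> X](@big1_eq _ 0 +%R _ A xpredT).
    by apply: cvg_sumr => m; exact/cvg_normcP/Ff.
  move/cvgr0Pnorm_le : d0 => /(_ _ e0) d0.
  have [k [/resM kM ke]] := filter_ex (filterI FM d0).
  have -> : res f = res (F k) + res (f - F k).
    apply/funext => m; rewrite /res/= !fctE; case: ifP => _; last by rewrite addr0.
    by rewrite addrCA subrr addr0.
  rewrite -EFinD; apply: lp_norm_triangle => //; apply: le_trans (dist k) _.
  by rewrite lee_fin (le_trans (ler_norm _)).
move/(lp_norm_leP _ s0 M0) : resfM => /(_ A).
rewrite big_seq (eq_bigr (fun m => normc (f m) `^ s)) -?big_seq// => m.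
by rewrite /res => ->.
Qed.

Lemma hoelder_conjugate_cases (p : R) : 1 <= p ->
  (p = 1 /\ hoelder_conjugate p%:E = +oo%E) \/
  [/\ 1 < p, hoelder_conjugate p%:E = (p / (p - 1))%:E, 1 < p / (p - 1) &
     p^-1 + (p / (p - 1))^-1 = 1].
Proof.
rewrite le_eqVlt => /predU1P[<-|p1]; [left|right].
  by split=> //; exact: hoelder_conjugate1.
have p0 : 0 < p by rewrite (lt_trans ltr01).
have p10 : 0 < p - 1 by rewrite subr_gt0.
split=> //.
- rewrite /hoelder_conjugate/= eqe gt_eqF//= -EFinB inver gt_eqF//.
- by rewrite ltr_pdivlMr// mul1r gtrBl.
- by field; rewrite !gt_eqF.
Qed.

Lemma hoelder_conjugate_gt0 (p : R) : 1 <= p -> (0 < hoelder_conjugate p%:E)%E.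
Proof.
move=> p1; apply: (@lt_le_trans _ _ 1%E); first exact: lte01.
by apply: hoelder_conj_ge1; rewrite lee_fin.
Qed.

(** Young's inequality for the entries divided by the two norms. *)
Lemma abs_sums_le_hoelder (p : R) f g (A B : R) : 1 <= p ->
  (lp_norm p%:E f <= A%:E)%E -> (lp_norm (hoelder_conjugate p%:E) g <= B%:E)%E ->
  abs_sums_le (fun m => g m * f m) (B * A).
Proof.
move=> p1 fA gB.
have A0 : 0 <= A by rewrite -lee_fin (le_trans (lp_norm_ge0 _ _) fA).
have B0 : 0 <= B by rewrite -lee_fin (le_trans (lp_norm_ge0 _ _) gB).
have p0 : 0 < p by rewrite (lt_le_trans ltr01).
have [[p1E qE]|[p1' qE q1 pq]] := hoelder_conjugate_cases p1.
  rewrite qE in gB; rewrite p1E in fA; move/linfty_norm_leP : gB => gB.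
  move/l1_norm_leP : fA => fA.
  by apply: le_sums_le (sums_leZ B0 fA) => m; rewrite normcM ler_wpM2r ?normc_ge0.
rewrite {}qE in gB; move: (p / (p - 1)) gB q1 pq => q gB q1 pq.
have q0 : 0 < q by rewrite (lt_trans ltr01).
move: A0; rewrite le_eqVlt => /predU1P[A0|A0].
  rewrite -A0 in fA *; rewrite (lp_norm0P p0 fA) mulr0 => F.
  by rewrite big1// => m _; rewrite mulr0 normc0.
move: B0; rewrite le_eqVlt => /predU1P[B0|B0].
  rewrite -B0 in gB *; rewrite (lp_norm0P q0 gB) mul0r => F.
  by rewrite big1// => m _; rewrite mul0r normc0.
move/(lp_norm_leP _ p0 (ltW A0)): fA => fA.
move/(lp_norm_leP _ q0 (ltW B0)): gB => gB.
pose cA := B * A / (A `^ p * p); pose cB := B * A / (B `^ q * q).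
have cA0 : 0 <= cA by rewrite !mulr_ge0 ?invr_ge0 ?mulr_ge0 ?powR_ge0 ?ltW.
have cB0 : 0 <= cB by rewrite !mulr_ge0 ?invr_ge0 ?mulr_ge0 ?powR_ge0 ?ltW.
have Ap : A `^ p != 0 by rewrite gt_eqF// powR_gt0.
have Bq : B `^ q != 0 by rewrite gt_eqF// powR_gt0.
have -> : B * A = cA * A `^ p + cB * B `^ q.
  transitivity (B * A * (p^-1 + q^-1)); first by rewrite pq mulr1.
  by rewrite /cA /cB; field; rewrite Ap Bq !gt_eqF.
apply: le_sums_le (sums_leD (sums_leZ cA0 fA) (sums_leZ cB0 gB)) => m.
rewrite normcM; set x := normc (g m); set y := normc (f m).
have x0 : 0 <= x by exact: normc_ge0.
have y0 : 0 <= y by exact: normc_ge0.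
have powV u U s : 0 <= u -> 0 < U -> (u / U) `^ s = u `^ s / U `^ s.
  move=> u0 U0; rewrite powRM// ?invr_ge0 ?ltW//; congr (_ * _).
  by rewrite -[U^-1]powR_inv1 ?(ltW U0)// powRAC powR_inv1// powR_ge0.
have := @conjugate_powR R (y / A) (x / B) p q (divr_ge0 y0 (ltW A0)) (divr_ge0 x0 (ltW B0)) p0 q0 pq.
rewrite !powV// => h.
have -> : x * y = B * A * (y / A * (x / B)) by field; rewrite !gt_eqF.
apply: le_trans (ler_wpM2l _ h) _; first by rewrite mulr_ge0 ?ltW.
rewrite le_eqVlt; apply/orP; left; apply/eqP; rewrite /cA /cB.
by field; rewrite Ap Bq !gt_eqF.
Qed.

End lp_spaces.

Section duality.
Context {R : realType} {n : nat}.
Notation Zn := 'rV[int]_n.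
Implicit Types (f g : Zn -> R[i]) (p q : \bar R) (s : R).

Definition unit_seq (m : Zn) : Zn -> R[i] := fun k => (k == m)%:R.

Lemma scale_unit_seqE (c : R[i]) m k :
  (c *: unit_seq m) k = if k == m then c else 0.
Proof.
rewrite /GRing.scale/= /unit_seq; case: ifP => _; first exact: mulr1.
exact: mulr0.
Qed.

Lemma lp_norm_unit_seq s m : 0 < s -> (lp_norm s%:E (unit_seq m) <= 1%:E)%E.
Proof.
move=> s0; apply/lp_norm_leP => // A; rewrite powR1.
apply: (@le_trans _ _ (\sum_(k <- [fset m]%fset) normc (unit_seq m k) `^ s)).
  rewrite (big_fsetID _ (mem [fset m]%fset))/= [X in _ + X]big1_seq ?addr0.
    by apply: sums_leS => [k|k]; rewrite ?powR_ge0// !inE => /andP[].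
  move=> k /=; rewrite !inE => /andP[_ /negbTE km].
  by rewrite /unit_seq km normc0 powR0 ?gt_eqF.
by rewrite big_seq_fset1 /unit_seq eqxx normc1 powR1.
Qed.

Lemma dual_norm_ge0 s (e : (Zn -> R[i]) -> R[i]) : 0 < s ->
  (0 <= dual_norm (lp_norm s%:E) e)%E.
Proof.
move=> s0; apply: (@le_trans _ _ (normc (e (unit_seq 0)))%:E).
  by rewrite lee_fin normc_ge0.
by apply: ereal_sup_ubound; exists (unit_seq 0) => //; exact: lp_norm_unit_seq.
Qed.

Lemma lp_norm_finite_support s f (A : {fset Zn}) : 0 < s ->
  (forall m, m \notin A -> f m = 0) ->
  lp_norm s%:E f = ((\sum_(m <- A) normc (f m) `^ s) `^ s^-1)%:E.
Proof.
move=> s0 fA; rewrite /lp_norm -poweR_EFin; congr (_ `^ _)%E.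
rewrite esum_mkcond; apply/eqP; rewrite eq_le; apply/andP; split.
  under eq_esum do rewrite mem_set//.
  apply/esum_leP => [m|B]; first exact: powR_ge0.
  rewrite (big_fsetID _ (mem A))/= [X in _ + X]big1_seq ?addr0.
    by apply: sums_leS => [k|k]; rewrite ?powR_ge0// !inE => /andP[].
  by move=> k /=; rewrite !inE => /andP[_ /fA ->]; rewrite normc0 powR0 ?gt_eqF.
under eq_esum do rewrite mem_set//.
apply: esum_ge; exists [set` A]; first by split => //; exact: finite_fset.
by rewrite fsbig_finite ?finite_fset//= set_fsetK sumEFin.
Qed.

Section functional.
Variables (p : R) (e : (Zn -> R[i]) -> R[i]) (D : R).
Hypothesis p1 : 1 <= p.
Hypothesis e_dual : in_dual (lp_norm p%:E) e.
Hypothesis eD : dual_norm (lp_norm p%:E) e = D%:E.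

Let p0 : 0 < p. Proof. by rewrite (lt_le_trans ltr01). Qed.

Lemma functional_bound f (M : R) : 0 < M -> (lp_norm p%:E f <= M%:E)%E ->
  normc (e f) <= D * M.
Proof.
move=> M0 fM; have [elin _] := e_dual.
have f1 : (lp_norm p%:E ((M^-1)%:C *: f)%R <= 1%:E)%E.
  rewrite -(@mulVf _ M) ?gt_eqF//; have := lp_normZ_le (M^-1)%:C p0 (ltW M0) fM.
  by rewrite normc_real ger0_norm// invr_ge0 ltW.
have e0 : e 0 = 0.
  have N0 : (lp_norm p%:E (0%R : Zn -> R[i]) < +oo)%E.
    rewrite (@lp_norm_finite_support _ _ fset0)// ltry//.
  have := elin 1 0 0 N0 N0; rewrite scaler0 addr0 mul1r.
  by move/eqP; rewrite -subr_eq subrr eq_sym => /eqP.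
have N0 : (lp_norm p%:E (0%R : Zn -> R[i]) < +oo)%E.
  rewrite (@lp_norm_finite_support _ _ fset0)// ltry//.
have fy : (lp_norm p%:E f < +oo)%E by rewrite (le_lt_trans fM) ?ltry.
have eM : e ((M^-1)%:C *: f) = (M^-1)%:C * e f.
  by have := elin (M^-1)%:C f 0 fy N0; rewrite addr0 e0 addr0.
have : ((normc (e ((M^-1)%:C *: f)))%:E <= D%:E)%E.
  by rewrite -eD; apply: ereal_sup_ubound; exists ((M^-1)%:C *: f)%R.
rewrite lee_fin eM normcM normc_real ger0_norm ?invr_ge0 ?(ltW M0)//.
by rewrite mulrC ler_pdivrMr.
Qed.

Lemma functional_finite_support (A : {fset Zn}) (c : Zn -> R[i]) :
  e (\sum_(m <- A) c m *: unit_seq m) = \sum_(m <- A) c m * e (unit_seq m).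
Proof.
have [elin _] := e_dual.
have N0 : (lp_norm p%:E (0%R : Zn -> R[i]) < +oo)%E.
  rewrite (@lp_norm_finite_support _ _ fset0)// ltry//.
have fin (s : seq Zn) : (lp_norm p%:E (\sum_(m <- s) c m *: unit_seq m)%R < +oo)%E.
  rewrite (@lp_norm_finite_support _ _ [fset m in s]%fset)// ?ltry//.
  move=> k; rewrite inE/= => ks; rewrite fct_sumE big1_seq// => m /= ms.
  by rewrite scale_unit_seqE; case: eqP => // km; rewrite km ms in ks.
have uy m : (lp_norm p%:E (unit_seq m) < +oo)%E.
  by rewrite (le_lt_trans (lp_norm_unit_seq m p0)) ?ltry.
elim: (enum_fset A) => [|m s IH].
  rewrite !big_nil; have := elin 1 0 0 N0 N0; rewrite scaler0 addr0 mul1r.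
  by move/eqP; rewrite -subr_eq subrr eq_sym => /eqP.
by rewrite !big_cons elin// IH.
Qed.

(** For p > 1 the functional is tested on |g|^q / g restricted to finite
    sets, where g is the sequence of its coefficients and q is conjugate to
    p. *)
Lemma dual_coefficients_le :
  (lp_norm (hoelder_conjugate p%:E) (fun m => e (unit_seq m)) <= D%:E)%E.
Proof.
pose g m := e (unit_seq m).
have D0 : 0 <= D by rewrite -lee_fin -eD dual_norm_ge0.
have [[p1E ->]|[p1' -> q1 pq]] := hoelder_conjugate_cases p1.
  apply/linfty_norm_leP => m; rewrite -[leRHS]mulr1.
  by apply: functional_bound => //; exact: lp_norm_unit_seq.
set q := p / (p - 1) in q1 pq *.
have q0 : 0 < q by rewrite (lt_trans ltr01).
apply/lp_norm_leP => // A.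
set S := \sum_(m <- A) _.
have S0 : 0 <= S by apply: sumr_ge0 => m _; exact: powR_ge0.
move: S0; rewrite le_eqVlt => /predU1P[<-|S0]; first exact: powR_ge0.
pose c m : R[i] := if m \in A then (normc (g m) `^ q)%:C / g m else 0.
have cE m : m \in A -> c m * g m = (normc (g m) `^ q)%:C.
  move=> mA; rewrite /c mA; have [->|gm] := eqVneq (g m) 0; last by rewrite divfK.
  by rewrite mulr0 normc0 powR0 ?gt_eqF.
have cN m : m \in A -> normc (c m) `^ p = normc (g m) `^ q.
  move=> mA; rewrite /c mA; have [->|gm] := eqVneq (g m) 0.
    by rewrite invr0 mulr0 normc0 !powR0 ?gt_eqF.
  have gm0 : 0 < normc (g m).
    by rewrite lt_neqAle eq_sym normc_ge0 andbT; apply: contra gm => /eqP/eq0_normc ->.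
  rewrite normcM normcV normc_real ger0_norm ?powR_ge0//.
  rewrite -[(normc (g m))^-1]powR_inv1 ?normc_ge0// -powRD; last first.
    by apply/implyP => _; rewrite gt_eqF.
  rewrite -powRrM; congr (_ `^ _).
  by rewrite /q; field; rewrite gt_eqF// subr_gt0.
pose f : Zn -> R[i] := \sum_(m <- A) c m *: unit_seq m.
have fE k : f k = c k.
  rewrite /f fct_sumE; have [kA|kA] := boolP (k \in A).
    rewrite (big_fsetD1 k)//= big1_seq ?addr0.
      by rewrite scale_unit_seqE eqxx.
    move=> m /=; rewrite !inE => /andP[mk _].
    by rewrite scale_unit_seqE eq_sym (negbTE mk).
  rewrite big1_seq; first by rewrite /c (negbTE kA).
  move=> m /= mA; rewrite scale_unit_seqE.
  by case: eqP => // km; rewrite km mA in kA.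
have ef : e f = S%:C.
  rewrite functional_finite_support /S rmorph_sum/= big_seq [RHS]big_seq.
  by apply: eq_bigr => m mA; rewrite cE.
have Sp0 : 0 < S `^ p^-1 by exact: powR_gt0.
have fN : (lp_norm p%:E f <= (S `^ p^-1)%:E)%E.
  have fA m : m \notin A -> f m = 0 by move=> mA; rewrite fE /c (negbTE mA).
  rewrite (lp_norm_finite_support p0 fA) (_ : \sum_(m <- A) _ = S)// /S big_seq [RHS]big_seq.
  by apply: eq_bigr => m mA; rewrite fE cN.
have := functional_bound Sp0 fN; rewrite ef normc_real gtr0_norm// => SD.
have Sq : S `^ q^-1 <= D.
  have -> : q^-1 = 1 - p^-1 by rewrite -pq [p^-1 + _]addrC addrK.
  rewrite powRB; last by rewrite (gt_eqF S0) implybT.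
  by rewrite powRr1 ?(ltW S0)// ler_pdivrMr.
have := ge0_ler_powR (ltW q0) (powR_ge0 _ _) D0 Sq.
by rewrite -powRrM mulVf ?gt_eqF// powRr1// ltW.
Qed.

End functional.
End duality.

(** * Nuclear operators as kernel expansions *)

Section summability_exponents.
Context {R : realType}.

Lemma nneseries_partial_sums_le (t : nat -> R) : (forall k, 0 <= t k) ->
  (\sum_(k <oo) (t k)%:E < +oo)%E -> exists C, forall K, \sum_(k < K) t k <= C.
Proof.
move=> t0 ty; set S := (\sum_(k <oo) _)%E in ty.
have S0 : (0 <= S)%E by apply: nneseries_ge0 => k _ _; rewrite lee_fin.
exists (fine S) => K; rewrite -lee_fin fineK ?ge0_fin_numE//.
rewrite -sumEFin -(big_mkord xpredT (fun k => (t k)%:E)).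
by apply: nneseries_lim_ge => k _; rewrite lee_fin.
Qed.

(** Since r is at most 1, a term is at most its r-th power times a power of the
    bound of the r-th powers. *)
Lemma partial_sums_le_of_powR (r : R) (t : nat -> R) : 0 < r -> r <= 1 ->
  (forall k, 0 <= t k) -> (\sum_(k <oo) (t k `^ r)%:E < +oo)%E ->
  exists C, forall K, \sum_(k < K) t k <= C.
Proof.
move=> r0 r1 t0 /nneseries_partial_sums_le[k|C tC]; first exact: powR_ge0.
have tkC k : t k `^ r <= C.
  by apply: le_trans (tC k.+1); rewrite big_ord_recr/= lerDr sumr_ge0// => i _; exact: powR_ge0.
have C0 : 0 <= C by apply: le_trans (tkC 0%N); exact: powR_ge0.
exists ((C `^ r^-1) `^ (1 - r) * C) => K.
apply: (@le_trans _ _ (\sum_(k < K) (C `^ r^-1) `^ (1 - r) * t k `^ r)).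
  apply: ler_sum => k _.
  have tk : t k <= C `^ r^-1.
    have ri : 0 <= r^-1 by rewrite invr_ge0 ltW.
    have := ge0_ler_powR ri (powR_ge0 _ _) C0 (tkC k).
    by rewrite -powRrM mulfV ?gt_eqF// powRr1.
  have {1}-> : t k = t k `^ (1 - r) * t k `^ r.
    by rewrite -powRD ?subrK ?powRr1// oner_eq0.
  rewrite ler_wpM2r ?powR_ge0// ge0_ler_powR// ?nnegrE ?subr_ge0 ?powR_ge0//.
by rewrite -mulr_sumr ler_wpM2l ?powR_ge0.
Qed.

End summability_exponents.

Section expansions.
Context {R : realType} {n : nat}.
Notation Zn := 'rV[int]_n.
Implicit Types (f : Zn -> R[i]) (g h : nat -> Zn -> R[i]).

Definition summable_norms (r : R) (p1 p2 : R) g h : Prop :=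
  let q := hoelder_conjugate p1%:E in
  [/\ forall k, in_lp q (g k), forall k, in_lp p2%:E (h k) &
    (\sum_(k <oo) (lp_norm q (g k) `^ r * lp_norm p2%:E (h k) `^ r) < +oo)%E].

Lemma summable_norms_bounds (r p1 p2 : R) g h : 0 < r -> r <= 1 ->
  summable_norms r p1 p2 g h ->
  exists (A B : nat -> R) (C : R),
    [/\ forall k, 0 <= A k /\ lp_norm (hoelder_conjugate p1%:E) (g k) = (A k)%:E,
        forall k, 0 <= B k /\ lp_norm p2%:E (h k) = (B k)%:E &
        forall K, \sum_(k < K) A k * B k <= C].
Proof.
move=> r0 r1 [gq hp gh].
have /choice[A AE] : forall k, exists a : R, 0 <= a /\
    lp_norm (hoelder_conjugate p1%:E) (g k) = a%:E.
  by move=> k; have [a a0 ga] := lp_norm_fin_num (gq k); exists a.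
have /choice[B BE] : forall k, exists b : R, 0 <= b /\
    lp_norm p2%:E (h k) = b%:E.
  by move=> k; have [b b0 hb] := lp_norm_fin_num (hp k); exists b.
have [||C ABC] := @partial_sums_le_of_powR _ r (fun k => A k * B k) r0 r1.
- by move=> k; apply: mulr_ge0; [case: (AE k)|case: (BE k)].
- apply: le_lt_trans gh; apply: lee_nneseries => k _ //.
    by move=> _; rewrite lee_fin powR_ge0.
  have [A0 ->] := AE k; have [B0 ->] := BE k.
  by rewrite !poweR_EFin -EFinM lee_fin powRM.
by exists A, B, C.
Qed.

(** The expansion is tested on the unit sequences: convergence in l^p2 gives
    convergence of each entry. *)
Lemma r_nuclear_kernel (r p1 p2 : R) (D : set (Zn -> R[i]))
    (T : (Zn -> R[i]) -> Zn -> R[i]) : 0 < r -> 1 <= p1 -> 1 <= p2 ->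
  (forall m, D (unit_seq m)) ->
  r_nuclear (lp_norm p1%:E) (lp_norm p2%:E) r D T ->
  exists g h, summable_norms r p1 p2 g h /\
    forall n' m, ccvg (fun K => \sum_(k < K) h k n' * g k m)
      (T (unit_seq m) n').
Proof.
move=> r0 p11 p21 Dunit [e [y [edual yp2 Te ey]]].
have p20 : 0 < p2 by rewrite (lt_le_trans ltr01).
have p10 : 0 < p1 by rewrite (lt_le_trans ltr01).
pose g k m := e k (unit_seq m).
have ge k : (lp_norm (hoelder_conjugate p1%:E) (g k) <=
    dual_norm (lp_norm p1%:E) (e k))%E.
  have e0 := dual_norm_ge0 (e k) p10.
  have eD : dual_norm (lp_norm p1%:E) (e k) =
      (fine (dual_norm (lp_norm p1%:E) (e k)))%:E.
    by rewrite fineK// ge0_fin_numE//; case: (edual k).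
  by rewrite eD; apply: dual_coefficients_le.
exists g, y; split; first split => // [k|].
- by apply: le_lt_trans (ge k) _; case: (edual k).
- apply: le_lt_trans ey; apply: lee_nneseries => k _ //.
    by move=> _; rewrite mule_ge0 ?poweR_ge0.
  apply: lee_wpmul2r; first exact: poweR_ge0.
  have hE (x : \bar R) : (0 <= x)%E -> x \in `[0, +oo]%E.
    by move=> x0; rewrite in_itv/= x0/= leey.
  apply: (gt0_ler_poweR (ltW r0)) => //; apply: hE; first exact: lp_norm_ge0.
  exact: dual_norm_ge0.
- move=> n' m; have [_ Tm] := Te _ (Dunit m).
  apply/cvg_normcP; apply/cvgr0Pnorm_lt => eps eps0.
  move/fine_cvgP : Tm => [Tfin /cvgr0Pnorm_lt/(_ _ eps0)Teps].
  apply: filterS2 Tfin Teps => K Kfin.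
  rewrite ger0_norm; last by rewrite fine_ge0// lp_norm_ge0.
  apply: le_lt_trans; rewrite ger0_norm ?normc_ge0// normcB.
  set F := T _ - _ in Kfin *.
  have -> : T (unit_seq m) n' - \sum_(k < K) y k n' * g k m = F n'.
    rewrite /F !fctE fct_sumE; congr (_ - _); apply: eq_bigr => k _.
    by rewrite mulrC.
  by apply: (@lp_norm_coord _ _ p2%:E) => //; rewrite fineK.
Qed.

(** The convergence of each entry improves to convergence in l^p2, because
    the norms of the terms are summable: the remainder is a limit of finite
    sums whose norms are bounded by the tail of the sum of the norms. *)
Lemma expansion_r_nuclear (r p1 p2 : R) (T : (Zn -> R[i]) -> Zn -> R[i]) g h :
  0 < r -> r <= 1 -> 1 <= p1 -> 1 <= p2 -> summable_norms r p1 p2 g h ->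
  (forall f n', in_lp 1%:E f ->
     ccvg (fun K => \sum_(k < K) h k n' * csum (fun m => g k m * f m)) (T f n')) ->
  r_nuclear (lp_norm p1%:E) (lp_norm p2%:E) r (in_lp 1%:E) T.
Proof.
move=> r0 r1 p11 p21 gh Tgh.
have p10 : 0 < p1 by rewrite (lt_le_trans ltr01).
have p20 : 0 < p2 by rewrite (lt_le_trans ltr01).
have [A [B [C [AE BE ABC]]]] := summable_norms_bounds r0 r1 gh.
case: gh => gq hp gh.
have q0 := hoelder_conjugate_gt0 p11.
pose e k f := csum (fun m => g k m * f m).
have eA k : (dual_norm (lp_norm p1%:E) (e k) <= (A k)%:E)%E.
  apply: ge_ereal_sup => _ [f f1 <-]; rewrite lee_fin -[leRHS]mulr1.
  by apply: normc_csum_le; apply: (abs_sums_le_hoelder p11 f1); rewrite (AE k).2.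
exists e, h; split => //.
- move=> k; split; last by apply: le_lt_trans (eA k) _; rewrite ltry.
  move=> c u v /lp_norm_fin_num[U U0 uU] /lp_norm_fin_num[V V0 vV].
  have gA : (lp_norm (hoelder_conjugate p1%:E) (g k) <= (A k)%:E)%E.
    by rewrite (AE k).2.
  have uU' : (lp_norm p1%:E u <= U%:E)%E by rewrite uU.
  have vV' : (lp_norm p1%:E v <= V%:E)%E by rewrite vV.
  rewrite /e -(csum_linear c (abs_sums_le_hoelder p11 uU' gA)
    (abs_sums_le_hoelder p11 vV' gA)).
  congr csum; apply/funext => m.
  by rewrite -[(c *: u + v) m]/(c * u m + v m); ring.
- move=> f f1; have [F F0 fF] := lp_norm_fin_num f1.
  have fF1 : abs_sums_le f F by apply/l1_norm_leP; rewrite fF.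
  have eF k : normc (e k f) <= A k * F.
    apply: normc_csum_le.
    apply: le_sums_le (sums_leZ (AE k).1 fF1) => m.
    rewrite normcM ler_wpM2r ?normc_ge0//.
    by apply: (lp_norm_coord _ q0); rewrite (AE k).2.
  pose w k := normc (e k f) * B k.
  have w0 k : 0 <= w k by rewrite mulr_ge0 ?normc_ge0 ?(BE k).1.
  have wC K : \sum_(k < K) w k <= F * C.
    apply: le_trans (ler_wpM2l F0 (ABC K)); rewrite mulr_sumr.
    apply: ler_sum => k _; rewrite /w mulrA [F * _]mulrC ler_wpM2r ?(BE k).1//.
  pose W := limn (fun K => \sum_(k < K) w k).
  have wnd : nondecreasing_seq (fun K => \sum_(k < K) w k).
    by apply/nondecreasing_seqP => K; rewrite big_ord_recr/= lerDl.
  have wcvg : cvgn (fun K => \sum_(k < K) w k).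
    by apply: nondecreasing_is_cvgn => //; exists (F * C) => _ [K _ <-].
  have wW K : \sum_(k < K) w k <= W by exact: nondecreasing_cvgn_le.
  have tail K : (lp_norm p2%:E (T f - \sum_(j < K) e j f *: h j)%R <=
      (W - \sum_(k < K) w k)%R%:E)%E.
    pose S L : Zn -> R[i] := \sum_(j < L | (K <= j)%N) e j f *: h j.
    apply: (@lp_norm_lim_le _ _ _ S) => //; first by rewrite subr_ge0.
    + move=> m; apply/cvg_normcP.
      have /cvg_normcP := Tgh f m f1; apply: cvg_trans; apply: near_eq_cvg.
      near=> L; congr normc.
      have KL : (K <= L)%N by near: L; exact: nbhs_infty_ge.
      rewrite !fctE !fct_sumE.
      have -> : \sum_(k < L) h k m * csum (fun k' => g k k' * f k') =
          \sum_(i < L) (e i f *: h i) m.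
        by apply: eq_bigr => k _; rewrite [RHS]mulrC.
      rewrite (bigID (fun i : 'I_L => (K <= i)%N))/=.
      have -> : \sum_(i < L | ~~ (K <= i)%N) (e i f *: h i) m =
          \sum_(i < K) (e i f *: h i) m.
        under eq_bigl do rewrite -ltnNge.
        by rewrite (big_ord_narrow KL).
      by rewrite /S fct_sumE opprB addrA.
    + near=> L.
      have KL : (K <= L)%N by near: L; exact: nbhs_infty_ge.
      apply: (@le_trans _ _ (\sum_(j < L | (K <= j)%N) w j)%R%:E).
        have := @lp_norm_sum_le R n p2 L (fun j => e j f) h B (fun j => (K <= j)%N) p21.
        by apply => j; rewrite (BE j).2.
      rewrite lee_fin lerBrDl; apply: le_trans (wW L).
      rewrite [leRHS](bigID (fun i : 'I_L => (K <= i)%N))/= [leLHS]addrC lerD2l.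
      under [leRHS]eq_bigl do rewrite -ltnNge.
      by rewrite (big_ord_narrow KL).
  split.
    have := tail 0%N; rewrite !big_ord0 subr0.
    by move/le_lt_trans; apply; rewrite ltry.
  apply: (@squeeze_cvge _ _ _ _ (fun=> 0%E) _ (fun K => (W - \sum_(k < K) w k)%R%:E)).
  + by apply: nearW => K; rewrite lp_norm_ge0 tail.
  + exact: cvg_cst.
  + apply: cvg_EFin; first exact: nearW.
    have : W - \sum_(k < K) w k @[K --> \oo] --> W - W.
      by apply: cvgB; [exact: cvg_cst|exact: wcvg].
    by rewrite (subrr W).
- apply: le_lt_trans gh; apply: lee_nneseries => k _ //.
    by move=> _; rewrite mule_ge0 ?poweR_ge0.
  apply: lee_wpmul2r; first exact: poweR_ge0.
  have hE (x : \bar R) : (0 <= x)%E -> x \in `[0, +oo]%E.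
    by move=> x0; rewrite in_itv/= x0/= leey.
  apply: (gt0_ler_poweR (ltW r0)); rewrite ?hE ?lp_norm_ge0 ?dual_norm_ge0//.
  by rewrite (AE k).2.
Unshelve. all: by end_near. Qed.

End expansions.

(** * Measure-preserving maps of the cube *)

Section lebesgue_invariance.
Context {R : realType}.
Notation mR := (measurableTypeR R).
Local Notation leb := (@lebesgue_measure R).

Lemma lebesgue_measure_shift (s : R) (A : set mR) : measurable A ->
  leb [set x | A (x + s)] = leb A.
Proof.
move=> mA; pose f (x : mR) : mR := x + s.
have mf : measurable_fun setT f by exact: measurable_funD.
pose m0 : {measure set mR -> \bar R} := pushforward leb f.
pose m := m0 mf.
rewrite [RHS](@lebesgue_measure_unique _ m)// => X /ocitvP[->|[[a b] /= ab ->]].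
  by rewrite !measure0.
rewrite /m/= /pushforward (_ : f @^-1` _ = `]a - s, b - s]%classic).
  rewrite !lebesgue_measure_itv/= !lte_fin ltrD2r; case: ifP => // _.
  by rewrite -!EFinB; congr _%:E; rewrite opprB addrA subrK.
by apply/seteqP; split => x /=; rewrite !in_itv/= /f ltrBlDr lerBrDr.
Qed.

Lemma lebesgue_measure_reflect (s : R) (A : set mR) : measurable A ->
  leb [set x | A (s - x)] = leb A.
Proof.
move=> mA; pose f (x : mR) : mR := s - x.
have mf : measurable_fun setT f by exact: measurable_funB.
pose m0 : {measure set mR -> \bar R} := pushforward leb f.
pose m := m0 mf.
rewrite [RHS](@lebesgue_measure_unique _ m)// => X /ocitvP[->|[[a b] /= ab ->]].
  by rewrite !measure0.
rewrite /m/= /pushforward (_ : f @^-1` _ = `[s - b, s - a[%classic).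
  rewrite !lebesgue_measure_itv/= !lte_fin ltrD2l ltrN2; case: ifP => // _.
  by rewrite -!EFinB; congr _%:E; ring.
apply/seteqP; split => x /=; rewrite !in_itv/= /f => /andP[h1 h2];
  apply/andP; split; lra.
Qed.

Lemma lebesgue_measure_co01 (A : set mR) : measurable A ->
  leb (A `&` `[0, 1]%classic) = leb (A `&` `[0, 1[%classic).
Proof.
move=> mA.
have m1 : measurable (A `&` [set 1] : set mR) by apply: measurableI.
have mco : measurable (A `&` `[0, 1[%classic : set mR) by apply: measurableI.
rewrite -[RHS](measureU0 mco m1); last first.
  apply/eqP; rewrite eq_le measure_ge0 andbT.
  rewrite -[leRHS](lebesgue_measure_set1 1).
  by apply: le_measure; rewrite ?inE//; exact: subIsetr.
by rewrite -setIUr setUitv1 ?bnd_simp.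
Qed.

(** The identity outside [0, 1], so that a map acting by it on each
    coordinate preserves the cube. *)
Definition wrap (s x : mR) : mR :=
  if x \in `[0, 1] then if x < 1 - s then x + s else x + s - 1 else x.

Lemma wrap01 (s x : R) : 0 <= s <= 1 -> (wrap s x \in `[0, 1]) = (x \in `[0, 1]).
Proof.
move=> /andP[s0 s1]; rewrite /wrap; case: ifPn => [|/negbTE//].
rewrite in_itv/= => /andP[x0 x1]; case: ifPn => [xs|]; rewrite ?in_itv/=.
  by apply/andP; split; lra.
by rewrite -leNgt => xs; apply/andP; split; lra.
Qed.

Lemma measurable_wrap s : measurable_fun setT (wrap s).
Proof.
rewrite /wrap; apply: measurable_fun_ifT => //.
- apply: (@measurable_fun_bool _ _ _ _ true).
  rewrite setTI (_ : _ @^-1` _ = `[0, 1]%classic); first exact: measurable_itv.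
  by apply/seteqP; split => x /=; rewrite inE.
- apply: measurable_fun_ifT => //.
  + by apply: measurable_fun_ltr.
  + exact: measurable_funD.
  + by apply: measurable_funB => //; exact: measurable_funD.
Qed.

(** Translation modulo 1 exchanges [0, 1 - s[ and [1 - s, 1[ with [s, 1[ and
    [0, s[. *)
Lemma wrap_preserves s (A : set mR) : 0 <= s <= 1 -> measurable A ->
  leb (wrap s @^-1` A `&` `[0, 1]%classic) = leb (A `&` `[0, 1]%classic).
Proof.
move=> /andP[s0 s1] mA.
have mW : measurable (wrap s @^-1` A).
  by rewrite -[X in measurable X]setTI; apply: measurable_wrap.
rewrite !lebesgue_measure_co01//.
have mA1 : measurable (A `&` `[s, 1[%classic : set mR) by apply: measurableI.
have mA2 : measurable (A `&` `[0, s[%classic : set mR) by apply: measurableI.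
have -> : A `&` `[0, 1[%classic = (A `&` `[0, s[%classic) `|` (A `&` `[s, 1[%classic).
  rewrite -setIUr; congr (_ `&` _); apply/seteqP; split => x /=; rewrite !in_itv/=.
    by case: (ltP x s) => xs /andP[x0 x1]; [left|right]; apply/andP; split.
  by move=> [] /andP[h1 h2]; apply/andP; split; lra.
have mB1 : measurable ([set x | (A `&` `[s, 1[%classic) (x + s)] : set mR).
  have mf : measurable_fun setT (fun x : mR => x + s : mR) by exact: measurable_funD.
  by rewrite -[X in measurable X]setTI; exact: mf.
have mB2 : measurable ([set x | (A `&` `[0, s[%classic) (x + (s - 1))] : set mR).
  have mf : measurable_fun setT (fun x : mR => x + (s - 1) : mR) by exact: measurable_funD.
  by rewrite -[X in measurable X]setTI; exact: mf.
rewrite [RHS]measureU//; last first.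
  apply/seteqP; split => x //= [[_ +] [_ +]]; rewrite !in_itv/= => /andP[_ h1] /andP[h2 _].
  by have := lt_le_trans h1 h2; rewrite ltxx.
pose B1 : set mR := [set x : mR | (A `&` `[s, 1[%classic) (x + s)].
pose B2 : set mR := [set x : mR | (A `&` `[0, s[%classic) (x + (s - 1))].
transitivity (leb B2 + leb B1)%E; last first.
  by congr (_ + _)%E; exact: lebesgue_measure_shift.
rewrite addeC -measureU//; last first.
  apply/seteqP; split => x //=; rewrite /B1 /B2/= !in_itv/=.
  move=> [[_ /andP[_ h1]] [_ /andP[h2 _]]]; suff : false by []; lra.
congr (leb _); apply/seteqP; split => x /=; rewrite /wrap /B1 /B2/= !in_itv/=.
  move=> [+ /andP[x0 x1]]; rewrite x0 (ltW x1)/=; case: ifPn => xs Ax.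
    by left; split => //; apply/andP; split; lra.
  rewrite -leNgt in xs; right; split; first by rewrite addrA.
  by apply/andP; split; lra.
move=> [[Ax /andP[h1 h2]]|[Ax /andP[h1 h2]]].
  have -> : (0 <= x <= 1) by apply/andP; split; lra.
  have -> : x < 1 - s by lra.
  by split => //; apply/andP; split; lra.
have -> : (0 <= x <= 1) by apply/andP; split; lra.
have -> : (x < 1 - s) = false by apply/negbTE; rewrite -leNgt; lra.
by split; [rewrite -addrA|apply/andP; split; lra].
Qed.

Definition flip (x : mR) : mR := if x \in `[0, 1] then 1 - x else x.

Lemma flip01 (x : R) : (flip x \in `[0, 1]) = (x \in `[0, 1]).
Proof.
rewrite /flip; case: ifPn => [|/negbTE//].
by rewrite !in_itv/= => /andP[x0 x1]; apply/andP; split; lra.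
Qed.

Lemma measurable_flip : measurable_fun setT flip.
Proof.
rewrite /flip; apply: measurable_fun_ifT => //; last exact: measurable_funB.
apply: (@measurable_fun_bool _ _ _ _ true).
rewrite setTI (_ : _ @^-1` _ = `[0, 1]%classic); first exact: measurable_itv.
by apply/seteqP; split => x /=; rewrite inE.
Qed.

Lemma flip_preserves (A : set mR) : measurable A ->
  leb (flip @^-1` A `&` `[0, 1]%classic) = leb (A `&` `[0, 1]%classic).
Proof.
move=> mA.
have mA1 : measurable (A `&` `[0, 1]%classic : set mR) by apply: measurableI.
rewrite -(lebesgue_measure_reflect 1 mA1); congr (leb _).
apply/seteqP; split => x /=; rewrite /flip !in_itv/=.
  by move=> [+ /andP[x0 x1]]; rewrite x0 x1/= => Ax; split => //; apply/andP; split; lra.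
move=> [Ax /andP[h1 h2]]; have -> : (0 <= x <= 1) by apply/andP; split; lra.
by split.
Qed.

End lebesgue_invariance.

Section cube_maps.
Context {R : realType} {n : nat}.
Notation mR := (measurableTypeR R).
Notation mu := (@cube_measure R n).
Notation Q := (@cube R n).

Lemma measurable_cube : measurable Q.
Proof.
rewrite /cube; have := @measurable_box R n (fun=> `[0, 1]%classic) _.
by apply => i; exact: measurable_itv.
Qed.

Lemma cube_measure_cube : mu Q = 1%E.
Proof.
have := @cube_measure_box R n (fun=> `[0, 1]%classic) (fun=> @measurable_itv _ _).
rewrite (_ : [set t | _] = Q)// => ->.
by rewrite big1// => i _; rewrite setIid lebesgue_measure_itv/= lte_fin ltr01 sube0.
Qed.

Lemma measurable_tuple_boxes :
  (@measurable _ (n.-tuple mR)) = <<s [set B | exists A : 'I_n -> set mR,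
     (forall i, measurable (A i)) /\ B = [set t | forall i, A i (tnth t i)]] >>.
Proof.
apply/seteqP; split; last first.
  apply: smallest_sub; first exact: sigma_algebra_measurable.
  by move=> _ [A [mA ->]]; exact: measurable_box.
apply: smallest_sub; first exact: smallest_sigma_algebra.
move=> B; rewrite -bigcup_seq => -[i _ [A mA <-]].
apply: sub_sigma_algebra; exists (fun j => if j == i then A else setT); split.
  by move=> j; case: ifP.
rewrite setTI; apply/seteqP; split => t /=; first by move=> At j; case: eqP => // ->.
by move=> /(_ i); rewrite eqxx.
Qed.

Variable tau : 'I_n -> mR -> mR.
Hypothesis mtau : forall i, measurable_fun setT (tau i).
Hypothesis tau_preserves : forall i (A : set mR), measurable A ->
  lebesgue_measure (tau i @^-1` A `&` `[0, 1]%classic) =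
  lebesgue_measure (A `&` `[0, 1]%classic).
Hypothesis tau01 : forall i (x : R), (tau i x \in `[0, 1]) = (x \in `[0, 1]).

Definition cube_map (t : n.-tuple mR) : n.-tuple mR :=
  [tuple tau i (tnth t i) | i < n].

Lemma measurable_cube_map : measurable_fun setT cube_map.
Proof.
apply/measurable_fun_tnthP => i.
rewrite (_ : _ \o _ = tau i \o ((@tnth n mR)^~ i)).
  by apply: measurableT_comp => //; exact: measurable_tnth.
by apply/funext => t /=; rewrite tnth_mktuple.
Qed.

(** The two measures agree on boxes, and boxes generate the sigma-algebra. *)
Lemma cube_map_preserves (E : set (n.-tuple mR)) : measurable E ->
  mu (cube_map @^-1` E) = mu E.
Proof.
pose m0 : {measure set _ -> \bar R} := pushforward mu cube_map.
pose m := m0 measurable_cube_map.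
move=> mE; apply: (measure_unique _ (fun=> setT) measurable_tuple_boxes
  _ _ _ m mu) => //.
- move=> _ _ [A [mA ->]] [B [mB ->]]; exists (fun i => A i `&` B i); split.
    by move=> i; exact: measurableI.
  by apply/seteqP; split => t /=; [move=> [At Bt] i|move=> AB; split => i; case: (AB i)].
- by move=> k; exists (fun=> setT); split => //; apply/seteqP; split.
- by rewrite bigcup_const.
- move=> _ [A [mA ->]].
  have mtA i : measurable (tau i @^-1` A i).
    by rewrite -[X in measurable X]setTI; exact: mtau.
  rewrite /m/= /pushforward (_ : cube_map @^-1` _ =
      [set t | forall i, (tau i @^-1` A i) (tnth t i)]).
    rewrite (cube_measure_box mtA) [RHS](cube_measure_box mA).
    by apply: eq_bigr => i _; exact: tau_preserves.
  by apply/seteqP; split => t /= At i; have := At i; rewrite tnth_mktuple.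
- by move=> k; rewrite /m/= /pushforward preimage_setT probability_setT ltry.
Qed.

Lemma cube_map_cube t : Q (cube_map t) = Q t.
Proof.
by apply/propext; split => Qt i; have := Qt i; rewrite tnth_mktuple tau01.
Qed.

Lemma ge0_integral_cube_map (F : n.-tuple mR -> \bar R) :
  measurable_fun Q F -> (forall t, Q t -> (0 <= F t)%E) ->
  (\int[mu]_(t in Q) F (cube_map t) = \int[mu]_(t in Q) F t)%E.
Proof.
move=> mF F0; have mQ := measurable_cube.
pose m0 : {measure set _ -> \bar R} := pushforward mu cube_map.
pose m := m0 measurable_cube_map.
transitivity (\int[m]_(t in Q) F t)%E.
  rewrite ge0_integral_pushforward//.
  - by rewrite (_ : cube_map @^-1` Q = Q)//; apply/seteqP; split => t /=; rewrite cube_map_cube.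
  - exact: measurable_cube_map.
  - by move=> t; rewrite inE; exact: F0.
by apply: eq_measure_integral => A mA _; exact: cube_map_preserves.
Qed.

Lemma integral_cube_map (F : n.-tuple mR -> \bar R) : measurable_fun Q F ->
  (\int[mu]_(t in Q) F (cube_map t) = \int[mu]_(t in Q) F t)%E.
Proof.
move=> mF; rewrite integralE [RHS]integralE.
congr (_ - _)%E.
  rewrite -(ge0_integral_cube_map (measurable_funepos mF))//.
  by apply: eq_integral => t _; rewrite !funeposE.
rewrite -(ge0_integral_cube_map (measurable_funeneg mF))//.
by apply: eq_integral => t _; rewrite !funenegE.
Qed.

Lemma measurable_comp_cube_map d (T : measurableType d) (F : n.-tuple mR -> T) :
  measurable_fun Q F -> measurable_fun Q (F \o cube_map).
Proof.
move=> mF; apply: (measurable_comp _ _ mF).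
- exact: measurable_cube.
- by move=> _ [t Qt <-]; rewrite cube_map_cube.
- apply: measurable_funS measurable_cube_map => //.
Qed.

End cube_maps.

(** * Complex integrals over the cube *)

Lemma Rintegral_dominated d (T : measurableType d) (R : realType)
    (mu : {measure set T -> \bar R}) (D : set T) (ff : nat -> T -> R)
    (f g : T -> R) : measurable D -> (forall k, measurable_fun D (ff k)) ->
  measurable_fun D f ->
  {ae mu, forall t, D t -> ff k t @[k --> \oo] --> f t} ->
  mu.-integrable D (EFin \o g) ->
  {ae mu, forall t k, D t -> `|ff k t| <= g t} ->
  mu.-integrable D (EFin \o f) /\
  \int[mu]_(t in D) ff k t @[k --> \oo] --> \int[mu]_(t in D) f t.
Proof.
move=> mD mff mf fff ig ffg.
have [||||| fi _ fc] := @dominated_convergence _ _ _ mu D mD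
  (fun k => EFin \o ff k) (EFin \o f) (EFin \o g) => //.
- by move=> k; exact/measurable_EFinP.
- exact/measurable_EFinP.
- apply: filterS fff => t ft /ft ?; apply: cvg_EFin => //; exact: nearW.
split => //; rewrite /Rintegral.
apply: fine_cvg; rewrite fineK//; exact: integrable_fin_num.
Qed.

Section complex_integrals.
Context {R : realType} {n : nat}.
Notation mR := (measurableTypeR R).
Notation mu := (@cube_measure R n).
Notation Q := (@cube R n).
Notation Rn := 'rV[R]_n.
Implicit Types (F G : Rn -> R[i]) (f g : n.-tuple mR -> R).

Let mQ : measurable Q. Proof. exact: measurable_cube. Qed.

Lemma cube_integrable_bounded f (C : R) : measurable_fun Q f ->
  (forall t, Q t -> `|f t| <= C) -> mu.-integrable Q (EFin \o f).
Proof.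
move=> mf fC; apply: (@le_integrable _ _ _ mu Q mQ _ (cst C%:E)) => //.
- exact/measurable_EFinP.
- move=> t Qt; rewrite /= lee_fin; apply: le_trans (fC t Qt) _; exact: ler_norm.
- by apply: finite_measure_integrable_cst.
Qed.

Lemma measurable_normc F : cmeasurable F ->
  measurable_fun Q (fun t => normc (F (point t))).
Proof.
move=> [mr mi].
rewrite (_ : (fun t => _) = (fun t => Num.sqrt (complex.Re (F (point t)) ^+ 2 +
    complex.Im (F (point t)) ^+ 2))); last first.
  by apply/funext => t; rewrite -normcX2 sqrtr_sqr ger0_norm ?normc_ge0.
apply: (@measurableT_comp _ _ _ _ _ _ (@Num.sqrt R)).
  by apply: continuous_measurable_fun; exact: sqrt_continuous.
by apply: measurable_funD; apply: measurable_funX; [exact: mr|exact: mi].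
Qed.

Lemma cintegrable_dom F g : cmeasurable F -> mu.-integrable Q (EFin \o g) ->
  {ae mu, forall t, Q t -> normc (F (point t)) <= g t} -> cintegrable F.
Proof.
move=> [mr mi] ig Fg.
suff H f : measurable_fun Q f -> {ae mu, forall t, Q t -> `|f t| <= g t} ->
    mu.-integrable Q (EFin \o f).
  split; apply: H => //; apply: filterS Fg => t Ft /Ft.
  - exact/le_trans/ler_Re_normc.
  - exact/le_trans/ler_Im_normc.
move=> mf fg; apply/integrableP; split; first exact/measurable_EFinP.
have [mg gy] := integrableP _ _ _ ig.
apply: le_lt_trans gy; apply: ae_ge0_le_integral => //.
- by apply: measurableT_comp => //; exact/measurable_EFinP.
- exact: measurableT_comp.
- apply: filterS fg => t ft /ft ?; rewrite /= lee_fin; apply: le_trans (ler_norm _); exact: le_trans.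
Qed.

Lemma cintegrable_normc F : cintegrable F ->
  mu.-integrable Q (EFin \o (fun t => normc (F (point t)))).
Proof.
move=> [iR iI].
have mF : cmeasurable F.
  by split; apply/measurable_EFinP; apply: measurable_int; [exact: iR|exact: iI].
apply: (@le_integrable _ _ _ mu Q mQ _
    ((fun t => `|(EFin \o (fun t => complex.Re (F (point t)))) t|) \+
     (fun t => `|(EFin \o (fun t => complex.Im (F (point t)))) t|))%E).
- apply/measurable_EFinP; exact: measurable_normc.
- move=> t Qt; rewrite /= lee_fin ger0_norm ?normc_ge0//.
  by rewrite [leRHS]ger0_norm ?addr_ge0// ler_normc_ReIm.
- by apply: integrableD => //; apply: integrable_abse; [exact: iR|exact: iI].
Qed.

Lemma cintegrable_cmeasurable F : cintegrable F -> cmeasurable F.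
Proof.
move=> [iR iI].
by split; apply/measurable_EFinP; apply: measurable_int; [exact: iR|exact: iI].
Qed.

Lemma cmeasurableD F G : cmeasurable F -> cmeasurable G ->
  cmeasurable (fun xi => F xi + G xi).
Proof.
move=> [Fr Fi] [Gr Gi]; split.
- by under eq_fun do rewrite cReD; exact: measurable_funD.
- by under eq_fun do rewrite cImD; exact: measurable_funD.
Qed.

Lemma cmeasurableB F G : cmeasurable F -> cmeasurable G ->
  cmeasurable (fun xi => F xi - G xi).
Proof.
move=> [Fr Fi] [Gr Gi]; split.
- by under eq_fun do rewrite cReB; exact: measurable_funB.
- by under eq_fun do rewrite cImB; exact: measurable_funB.
Qed.

Lemma cmeasurableM F G : cmeasurable F -> cmeasurable G ->
  cmeasurable (fun xi => F xi * G xi).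
Proof.
move=> [Fr Fi] [Gr Gi]; split.
- by under eq_fun do rewrite cReM; apply: measurable_funB; exact: measurable_funM.
- by under eq_fun do rewrite cImM; apply: measurable_funD; exact: measurable_funM.
Qed.

Lemma cmeasurable_cst (c : R[i]) : cmeasurable (fun _ : Rn => c).
Proof. by split; exact: measurable_cst. Qed.

Lemma cmeasurable_sum (I : Type) (s : seq I) (FF : I -> Rn -> R[i]) :
  (forall i, cmeasurable (FF i)) ->
  cmeasurable (fun xi => \sum_(i <- s) FF i xi).
Proof.
move=> mF; elim: s => [|i s IH].
  by under eq_fun do rewrite big_nil; exact: cmeasurable_cst.
by under eq_fun do rewrite big_cons; exact: cmeasurableD.
Qed.

Lemma cintegrableD F G : cintegrable F -> cintegrable G ->
  cintegrable (fun xi => F xi + G xi).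
Proof.
move=> iF iG; have [nF nG] := (cintegrable_normc iF, cintegrable_normc iG).
apply: (@cintegrable_dom _ (fun t => normc (F (point t)) + normc (G (point t)))).
- by apply: cmeasurableD; exact: cintegrable_cmeasurable.
- exact: (integrableD mQ nF nG).
- by apply: nearW => t _; exact: le_normcD.
Qed.

Lemma cintegrableM_bounded F G (C : R) : cintegrable F -> cmeasurable G ->
  (forall t, Q t -> normc (G (point t)) <= C) ->
  cintegrable (fun xi => F xi * G xi).
Proof.
move=> iF mG GC.
apply: (@cintegrable_dom _ (fun t => C * normc (F (point t)))).
- by apply: cmeasurableM => //; exact: cintegrable_cmeasurable.
- exact: (integrableZl mQ _ (cintegrable_normc iF)).
- apply: nearW => t Qt; rewrite normcM mulrC ler_wpM2r ?normc_ge0//; exact: GC.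
Qed.

Lemma cintegrableZ (c : R[i]) F : cintegrable F ->
  cintegrable (fun xi => c * F xi).
Proof.
move=> iF; under eq_fun do rewrite mulrC.
by apply: (cintegrableM_bounded (C := normc c)) => //; exact: cmeasurable_cst.
Qed.

Lemma cintegrableB (F G : Rn -> R[i]) : cintegrable F -> cintegrable G ->
  cintegrable (fun xi => F xi - G xi).
Proof.
move=> iF iG; have := cintegrableD iF (cintegrableZ (-1) iG).
by congr cintegrable; apply/funext => xi; rewrite mulN1r.
Qed.

Lemma cintegrable_bounded F (C : R) : cmeasurable F ->
  (forall t, Q t -> normc (F (point t)) <= C) -> cintegrable F.
Proof.
move=> [mr mi] FC; split; apply: (@cube_integrable_bounded _ C) => // t Qt.
- exact: le_trans (ler_Re_normc _) (FC t Qt).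
- exact: le_trans (ler_Im_normc _) (FC t Qt).
Qed.

Lemma cintegrable_sum (I : Type) (s : seq I) (FF : I -> Rn -> R[i]) :
  (forall i, cintegrable (FF i)) ->
  cintegrable (fun xi => \sum_(i <- s) FF i xi).
Proof.
move=> mF; elim: s => [|i s IH].
  under eq_fun do rewrite big_nil; apply: (@cintegrable_bounded _ 0) => [|t _].
    exact: cmeasurable_cst.
  by rewrite normc0.
by under eq_fun do rewrite big_cons; exact: cintegrableD.
Qed.

Lemma cintD F G : cintegrable F -> cintegrable G ->
  cint (fun xi => F xi + G xi) = cint F + cint G.
Proof.
move=> [Fr Fi] [Gr Gi]; apply/eqP; rewrite eq_complex /=; apply/andP; split.
- by under eq_Rintegral do rewrite cReD; rewrite RintegralD.
- by under eq_Rintegral do rewrite cImD; rewrite RintegralD.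
Qed.

Lemma cintZ (c : R[i]) F : cintegrable F ->
  cint (fun xi => c * F xi) = c * cint F.
Proof.
move=> [Fr Fi]; case: c => a b; apply/eqP; rewrite eq_complex /=.
have Z k f : mu.-integrable Q (EFin \o f) -> mu.-integrable Q (EFin \o (fun t => k * f t)).
  by move=> fi; exact: (integrableZl mQ _ fi).
apply/andP; split.
- under eq_Rintegral do rewrite cReM/=.
  by rewrite RintegralB ?RintegralZl//; exact: Z.
- under eq_Rintegral do rewrite cImM/=.
  by rewrite RintegralD ?RintegralZl//; exact: Z.
Qed.

Lemma cint0 : cint (fun _ : Rn => 0) = 0 :> R[i].
Proof.
by apply/eqP; rewrite eq_complex /= Rintegral_cst// mul0r eqxx.
Qed.

Lemma cint_sum (I : Type) (s : seq I) (FF : I -> Rn -> R[i]) :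
  (forall i, cintegrable (FF i)) ->
  cint (fun xi => \sum_(i <- s) FF i xi) = \sum_(i <- s) cint (FF i).
Proof.
move=> mF; elim: s => [|i s IH].
  by rewrite big_nil; under eq_fun do rewrite big_nil; exact: cint0.
rewrite big_cons -IH; under eq_fun do rewrite big_cons.
by apply: cintD => //; exact: cintegrable_sum.
Qed.

Lemma cintB F G : cintegrable F -> cintegrable G ->
  cint (fun xi => F xi - G xi) = cint F - cint G.
Proof.
move=> iF iG.
transitivity (cint (fun xi => F xi + (-1) * G xi)).
  by congr cint; apply/funext => xi; rewrite mulN1r.
by rewrite cintD ?cintZ ?mulN1r//; exact: cintegrableZ.
Qed.

(** The factor 2 comes from bounding the real and the imaginary part
    separately. *)
Lemma normc_cint_le F : cintegrable F ->
  normc (cint F) <= 2 * \int[mu]_(t in Q) normc (F (point t)).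
Proof.
move=> iF; have [iR iI] := iF; have iN := cintegrable_normc iF.
have H f : mu.-integrable Q (EFin \o f) ->
    (forall t, `|f t| <= normc (F (point t))) ->
    `|\int[mu]_(t in Q) f t| <= \int[mu]_(t in Q) normc (F (point t)).
  move=> fi fF; apply: le_trans (le_normr_Rintegral mQ fi) _.
  by apply: le_Rintegral => //; exact: integrable_norm.
apply: le_trans (ler_normc_ReIm _) _; rewrite mulr2n mulrDl mul1r.
apply: lerD; apply: H => // t; [exact: ler_Re_normc|exact: ler_Im_normc].
Qed.

Lemma cint_ae_eq F G : cmeasurable F -> cmeasurable G ->
  ae_cube (fun xi => F xi = G xi) -> cint F = cint G.
Proof.
rewrite /ae_cube => -[Fr Fi] [Gr Gi] FG; apply/eqP; rewrite eq_complex /=.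
have H f g : measurable_fun Q f -> measurable_fun Q g ->
    {ae mu, forall t, Q t -> f t = g t} ->
    \int[mu]_(t in Q) f t = \int[mu]_(t in Q) g t.
  move=> mf mg fg; rewrite /Rintegral; congr fine; apply: ae_eq_integral => //.
  - exact/measurable_EFinP.
  - exact/measurable_EFinP.
  - by apply: filterS fg => t ft /ft ->.
by apply/andP; split; apply/eqP; apply: H => //;
  apply: filterS FG => t Ft /Ft ->.
Qed.

Lemma cint_dominated (FF : nat -> Rn -> R[i]) F g :
  (forall k, cmeasurable (FF k)) -> cmeasurable F ->
  ae_cube (fun xi => ccvg (FF ^~ xi) (F xi)) ->
  mu.-integrable Q (EFin \o g) ->
  {ae mu, forall t, forall k, Q t -> normc (FF k (point t)) <= g t} ->
  cintegrable F /\ ccvg (fun k => cint (FF k)) (cint F).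
Proof.
rewrite /ae_cube => mFF [mFr mFi] FFF ig FFg.
suff H (ff : nat -> n.-tuple mR -> R) f : (forall k, measurable_fun Q (ff k)) ->
    measurable_fun Q f ->
    {ae mu, forall t, Q t -> ff k t @[k --> \oo] --> f t} ->
    {ae mu, forall t k, Q t -> `|ff k t| <= g t} ->
    mu.-integrable Q (EFin \o f) /\
    \int[mu]_(t in Q) ff k t @[k --> \oo] --> \int[mu]_(t in Q) f t.
  have [||||iR cR] := @H (fun k t => complex.Re (FF k (point t)))
    (fun t => complex.Re (F (point t))).
  - by move=> k; have [] := mFF k.
  - exact: mFr.
  - by apply: filterS FFF => t Ft /Ft /cvg_ReImP[].
  - apply: filterS FFg => t Ft k /(Ft k); exact/le_trans/ler_Re_normc.
  have [||||iI cI] := @H (fun k t => complex.Im (FF k (point t)))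
    (fun t => complex.Im (F (point t))).
  - by move=> k; have [] := mFF k.
  - exact: mFi.
  - by apply: filterS FFF => t Ft /Ft /cvg_ReImP[].
  - apply: filterS FFg => t Ft k /(Ft k); exact/le_trans/ler_Im_normc.
  by split => //; apply/cvg_ReImP.
by move=> mff mf fff ffg; exact: Rintegral_dominated ig ffg.
Qed.

End complex_integrals.

(** * Translations and characters *)

Section translation_invariance.
Context {R : realType} {n : nat}.
Notation mR := (measurableTypeR R).
Notation mu := (@cube_measure R n).
Notation Q := (@cube R n).
Notation Zn := 'rV[int]_n.
Notation Rn := 'rV[R]_n.

Definition rperiodic (f : Rn -> R) := forall xi (m : Zn), f (xi + map_mx intr m) = f xi.

(** On the values of a periodic function, translation has the same effect as
    translation modulo 1 in each coordinate, which preserves the measure of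
    the cube. *)
Lemma integral_cube_shift (f : Rn -> R) (v : Rn) : rperiodic f ->
  measurable_fun Q (fun t => f (point t)) ->
  (forall i, 0 <= v 0 i <= 1) ->
  \int[mu]_(t in Q) f (point t + v) = \int[mu]_(t in Q) f (point t).
Proof.
move=> fper mf v01; rewrite /Rintegral; congr fine.
pose tau i := wrap (v 0 i).
transitivity (\int[mu]_(t in Q) (f (point (cube_map tau t)))%:E)%E.
  apply: eq_integral => t; rewrite inE => Qt; congr (_%:E).
  pose m : Zn := \row_i (if (tnth t i : R) < 1 - v 0 i then 0 else -1).
  rewrite -(fper (point t + v) m); congr f; apply/rowP => i.
  rewrite !mxE tnth_mktuple /tau /wrap Qt; case: ifP => _; first by rewrite addr0.
  by rewrite mulrN1z.
apply: (@integral_cube_map R n tau _ _ _ (fun t => (f (point t))%:E)).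
- by move=> i; exact: measurable_wrap.
- by move=> i A mA; exact: wrap_preserves.
- by move=> i x; exact: wrap01.
- exact/measurable_EFinP.
Qed.

(** On the values of a periodic function, x |-> -x has the same effect as x
    |-> 1 - x in each coordinate. *)
Lemma integral_cube_reflect (f : Rn -> R) : rperiodic f ->
  measurable_fun Q (fun t => f (point t)) ->
  (\int[mu]_(t in Q) (f (- point t))%:E = \int[mu]_(t in Q) (f (point t))%:E)%E.
Proof.
move=> fper mf.
pose tau (i : 'I_n) : mR -> mR := flip.
transitivity (\int[mu]_(t in Q) (f (point (cube_map tau t)))%:E)%E.
  apply: eq_integral => t; rewrite inE => Qt; congr (_%:E).
  rewrite -(fper (- point t) (const_mx 1)); congr f; apply/rowP => i.
  by rewrite !mxE tnth_mktuple /tau /flip Qt addrC.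
apply: (@integral_cube_map R n tau _ _ _ (fun t => (f (point t))%:E)).
- by move=> i; exact: measurable_flip.
- by move=> i A mA; exact: flip_preserves.
- by move=> i x; exact: flip01.
- exact/measurable_EFinP.
Qed.

Lemma measurable_reflect (f : Rn -> R) : rperiodic f ->
  measurable_fun Q (fun t => f (point t)) ->
  measurable_fun Q (fun t => f (- point t)).
Proof.
move=> fper mf; pose tau (i : 'I_n) : mR -> mR := flip.
apply: (@eq_measurable_fun _ _ _ _ _ ((fun t => f (point t)) \o cube_map tau)).
  move=> t; rewrite inE => Qt /=.
  rewrite -(fper (- point t) (const_mx 1)); congr f; apply/rowP => i.
  by rewrite !mxE tnth_mktuple /tau /flip Qt addrC.
apply: measurable_comp_cube_map => //.
- by move=> i; exact: measurable_flip.
- by move=> i x; exact: flip01.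
Qed.

Lemma integrable_reflect (f : Rn -> R) : rperiodic f ->
  mu.-integrable Q (EFin \o (fun t => f (point t))) ->
  mu.-integrable Q (EFin \o (fun t => f (- point t))).
Proof.
have mQ := @measurable_cube R n.
move=> pf /integrableP[/measurable_EFinP mf fi]; apply/integrableP; split.
  by apply/measurable_EFinP; exact: measurable_reflect.
have := @integral_cube_reflect (fun xi => `|f xi|).
rewrite /= => ->//; first by move=> xi m; rewrite pf.
exact: measurableT_comp.
Qed.

Lemma cintegrable_reflect (F : Rn -> R[i]) : Defs.periodic F -> cintegrable F ->
  cintegrable (fun xi => F (- xi)).
Proof.
move=> pF [iR iI]; split.
  by apply: (integrable_reflect (f := fun xi => complex.Re (F xi))) => // xi m; rewrite pF.
by apply: (integrable_reflect (f := fun xi => complex.Im (F xi))) => // xi m; rewrite pF.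
Qed.

Lemma cint_reflect (F : Rn -> R[i]) : Defs.periodic F -> cmeasurable F ->
  cint (fun xi => F (- xi)) = cint F.
Proof.
move=> pF [mr mi]; rewrite /cint /Rintegral.
rewrite (@integral_cube_reflect (fun xi => complex.Re (F xi)))//.
  by rewrite (@integral_cube_reflect (fun xi => complex.Im (F xi)))// => xi m; rewrite pF.
by move=> xi m; rewrite pF.
Qed.

End translation_invariance.

Section characters.
Context {R : realType} {n : nat}.
Notation mR := (measurableTypeR R).
Notation mu := (@cube_measure R n).
Notation Q := (@cube R n).
Notation Zn := 'rV[int]_n.
Notation Rn := 'rV[R]_n.

Lemma dotpDl (m m' : Zn) (xi : Rn) : dotp (m + m') xi = dotp m xi + dotp m' xi.
Proof.
by rewrite /dotp -big_split; apply: eq_bigr => i _; rewrite mxE intrD mulrDl.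
Qed.

Lemma dotpNl (m : Zn) (xi : Rn) : dotp (- m) xi = - dotp m xi.
Proof.
by rewrite /dotp -sumrN; apply: eq_bigr => i _; rewrite mxE mulrNz mulNr.
Qed.

Lemma dotp0l (xi : Rn) : dotp 0 xi = 0.
Proof. by rewrite /dotp big1// => i _; rewrite mxE mul0r. Qed.

Lemma dotpDr (m : Zn) (xi xi' : Rn) : dotp m (xi + xi') = dotp m xi + dotp m xi'.
Proof.
by rewrite /dotp -big_split; apply: eq_bigr => i _; rewrite mxE mulrDr.
Qed.

Lemma dotpNr (m : Zn) (xi : Rn) : dotp m (- xi) = - dotp m xi.
Proof.
by rewrite /dotp -sumrN; apply: eq_bigr => i _; rewrite mxE mulrN.
Qed.

Lemma dotpZr (m : Zn) (c : R) (xi : Rn) : dotp m (c *: xi) = c * dotp m xi.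
Proof.
by rewrite /dotp mulr_sumr; apply: eq_bigr => i _; rewrite mxE mulrCA.
Qed.

Lemma dotp_int (m m' : Zn) : exists k : int, dotp m (map_mx intr m' : Rn) = k%:~R.
Proof.
exists (\sum_(i < n) m 0 i * m' 0 i); rewrite /dotp rmorph_sum/=.
by apply: eq_bigr => i _; rewrite mxE intrM.
Qed.

Lemma dotp_delta (m : Zn) (i : 'I_n) : dotp m (delta_mx 0 i : Rn) = (m 0 i)%:~R.
Proof.
rewrite /dotp (bigD1 i)//= mxE !eqxx mulr1 big1 ?addr0// => j /negbTE ji.
by rewrite mxE ji andbF mulr0.
Qed.

(** The phase makes the family closed under translation and differentiation,
    and the product of two members is the mean of two members. *)
Definition wave (m : Zn) (theta : R) (xi : Rn) : R :=
  cos (2 * pi * dotp m xi + theta).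

Lemma cosD2piz (x : R) (k : int) : cos (x + 2 * pi * k%:~R) = cos x.
Proof.
have H (y : R) (j : nat) : cos (y + 2 * pi * j%:R) = cos y.
  elim: j => [|j IH]; first by rewrite mulr0 addr0.
  by rewrite -(natr1 j) mulrDr mulr1 addrA mulr_natl cosD2pi -mulr_natl.
case: k => j; first exact: H.
by rewrite NegzE mulrNz mulrN -(H _ j.+1) subrK.
Qed.

Lemma wave_periodic m theta : rperiodic (wave m theta).
Proof.
move=> xi m'; rewrite /wave dotpDr; have [k ->] := dotp_int m m'.
by rewrite mulrDr addrAC cosD2piz.
Qed.

Lemma wave_shift m theta (v xi : Rn) :
  wave m theta (xi + v) = wave m (theta + 2 * pi * dotp m v) xi.
Proof. by rewrite /wave dotpDr mulrDr -addrA [_ + theta]addrC. Qed.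

Lemma wave_le1 m theta xi : `|wave m theta xi| <= 1.
Proof. by rewrite ler_norml cos_geN1 cos_le1. Qed.

Lemma measurable_dotp m : measurable_fun setT (fun t : n.-tuple mR => dotp m (point t)).
Proof.
rewrite /dotp; apply: measurable_sum => i.
apply: measurable_funM; first exact: measurable_cst.
under eq_fun do rewrite mxE.
exact: measurable_tnth.
Qed.

Lemma measurable_wave m theta : measurable_fun setT (fun t => wave m theta (point t)).
Proof.
rewrite /wave; apply: (@measurableT_comp _ _ _ _ _ _ (@cos R)).
  by apply: continuous_measurable_fun; exact: continuous_cos.
apply: measurable_funD; last exact: measurable_cst.
apply: measurable_funM; first exact: measurable_cst.
exact: measurable_dotp.
Qed.

Lemma waveM m m' theta theta' xi : wave m theta xi * wave m' theta' xi =
  (wave (m + m') (theta + theta') xi + wave (m - m') (theta - theta') xi) / 2.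
Proof.
rewrite /wave !dotpDl dotpNl.
have -> : 2 * pi * (dotp m xi + dotp m' xi) + (theta + theta') =
  (2 * pi * dotp m xi + theta) + (2 * pi * dotp m' xi + theta') by ring.
have -> : 2 * pi * (dotp m xi - dotp m' xi) + (theta - theta') =
  (2 * pi * dotp m xi + theta) - (2 * pi * dotp m' xi + theta') by ring.
by move: (_ + theta) (_ + theta') => x y; rewrite cosB cosD; field.
Qed.

Lemma characterE (m : Zn) (xi : Rn) :
  character m xi = wave m 0 xi +i* wave m (pi / 2) xi.
Proof.
rewrite /character expi_real cosN sinN /wave addr0 cosD cos_pihalf sin_pihalf.
by rewrite mulr0 mulr1 sub0r.
Qed.

Lemma normc_character (m : Zn) (xi : Rn) : normc (character m xi) = 1.
Proof. exact: normc_expi_real. Qed.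

Lemma characterD (m m' : Zn) (xi : Rn) :
  character (m + m') xi = character m xi * character m' xi.
Proof.
rewrite /character -expiD -rmorphD/=; congr (expi _%:C).
by rewrite dotpDl mulrDr opprD.
Qed.

Lemma character0 (xi : Rn) : character 0 xi = 1 :> R[i].
Proof. by rewrite /character dotp0l mulr0 oppr0 expi0. Qed.

Lemma characterNr (m : Zn) (xi : Rn) : character m (- xi) = character (- m) xi.
Proof. by rewrite /character dotpNr dotpNl. Qed.

Lemma conj_character (m : Zn) (xi : Rn) :
  ((character m xi)^*)%C = character (- m) xi.
Proof.
rewrite /character dotpNl mulrN opprK !expi_real/= cosN sinN opprK.
by [].
Qed.

Lemma character_periodic (m : Zn) : Defs.periodic (character m : Rn -> R[i]).
Proof.
by move=> xi m'; rewrite !characterE (wave_periodic m 0) (wave_periodic m (pi / 2)).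
Qed.

Lemma cmeasurable_character (m : Zn) : cmeasurable (character m : Rn -> R[i]).
Proof.
split; under eq_fun do rewrite characterE/=;
  apply: measurable_funTS; exact: measurable_wave.
Qed.

(** A shift by half a period in a coordinate where the frequency is nonzero
    changes the sign. *)
Lemma integral_wave (m : Zn) theta : m != 0 ->
  \int[mu]_(t in Q) wave m theta (point t) = 0.
Proof.
move=> /rV0Pn[i mi].
have mr0 : (m 0 i)%:~R != 0 :> R by rewrite intr_eq0.
have mr1 : 1 <= `|(m 0 i)%:~R : R|.
  by rewrite -intr_norm ler1z -gtz0_ge1 normr_gt0.
pose v : Rn := (2 * `|(m 0 i)%:~R|)^-1 *: delta_mx 0 i.
have v01 j : 0 <= v 0 j <= 1.
  rewrite !mxE; case: eqP => _; case: eqP => _; rewrite ?mulr0 ?lexx ?ler01//= mulr1.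
  rewrite invr_ge0 mulr_ge0//= invf_le1 ?mulr_gt0 ?normr_gt0//.
  by rewrite (le_trans mr1)// ler_peMl// ler1n.
have := @integral_cube_shift R n (wave m theta) v (@wave_periodic m theta)
  (measurable_funTS (measurable_wave m theta)) v01.
have -> : (fun t => wave m theta (point t + v)) = (fun t => -1 * wave m theta (point t)).
  apply/funext => t; rewrite mulN1r wave_shift /v dotpZr dotp_delta /wave.
  have [m0|m0] := ltP 0 ((m 0 i)%:~R : R).
    rewrite gtr0_norm// (_ : 2 * pi * ((2 * _)^-1 * _) = pi); last by field.
    by rewrite addrA cosDpi.
  rewrite ler0_norm// (_ : 2 * pi * ((2 * _)^-1 * _) = - pi); last by field.
  by rewrite addrA -[in RHS](subrK pi (2 * pi * _ + theta)) cosDpi opprK.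
rewrite RintegralZl; last 2 first.
- exact: measurable_cube.
- apply: (@cube_integrable_bounded _ _ _ 1) => [|t _]; last exact: wave_le1.
  apply: measurable_funTS; exact: measurable_wave.
by rewrite mulN1r; move: (\int[mu]_(t in Q) _) => I h; lra.
Qed.

Lemma Rintegral_cube_cst (c : R) : \int[mu]_(t in Q) c = c.
Proof.
have e : fine (mu Q) = 1 by rewrite cube_measure_cube.
rewrite Rintegral_cst; last exact: measurable_cube.
by rewrite -[RHS]mulr1; congr (_ * _).
Qed.

Lemma cint_character (m : Zn) : cint (character m : Rn -> R[i]) = (m == 0)%:R.
Proof.
have [->|m0] := eqVneq m 0.
  rewrite (_ : character 0 = fun=> 1); last by apply/funext => xi; exact: character0.
  by apply/eqP; rewrite eq_complex /= !Rintegral_cube_cst !eqxx.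
rewrite /cint; under eq_Rintegral do rewrite characterE/=.
rewrite (integral_wave 0 m0); under eq_Rintegral do rewrite characterE/=.
by rewrite (integral_wave _ m0).
Qed.

Lemma cintegrable_character (m : Zn) : cintegrable (character m : Rn -> R[i]).
Proof.
apply: (@cintegrable_bounded _ _ _ 1); first exact: cmeasurable_character.
by move=> t _; rewrite normc_character.
Qed.

Lemma cintegrable_mul_character (F : Rn -> R[i]) (m : Zn) : cintegrable F ->
  cintegrable (fun xi => F xi * character m xi).
Proof.
move=> iF; apply: (@cintegrableM_bounded _ _ _ _ 1) => //.
  exact: cmeasurable_character.
by move=> t _; rewrite normc_character.
Qed.

End characters.

(** * Functions orthogonal to a multiplicative family *)

Section orthogonal_to_algebra.
Context d (T : measurableType d) (R : realType).
Variables (mu : {measure set T -> \bar R}) (u : T -> R) (A : set (T -> R)).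
Hypothesis iu : mu.-integrable setT (EFin \o u).
Hypothesis A1 : A (cst 1).
Hypothesis AM : forall a c, A a -> A c ->
  exists a1 a2, [/\ A a1, A a2 & forall x, a x * c x = (a1 x + a2 x) / 2].
Hypothesis Am : forall a, A a -> measurable_fun setT a.
Hypothesis Ab : forall a, A a -> forall x, `|a x| <= 1.
Hypothesis uA : forall a, A a -> \int[mu]_x (u x * a x) = 0.

Definition bounded_measurable (b : T -> R) :=
  measurable_fun setT b /\ exists C, forall x, `|b x| <= C.

Definition annihilated (b : T -> R) :=
  bounded_measurable b /\ forall a, A a -> \int[mu]_x (u x * (b x * a x)) = 0.

(** The set annihilated by u need not be closed under products. The
    multipliers of that set form an algebra containing A, closed under
    bounded pointwise limits. *)
Definition multiplier (c : T -> R) :=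
  bounded_measurable c /\ forall b, annihilated b -> annihilated (c \* b).

Lemma bounded_measurableM b c : bounded_measurable b -> bounded_measurable c ->
  bounded_measurable (b \* c).
Proof.
move=> [mb [B bB]] [mc [C cC]]; split; first exact: measurable_funM.
by exists (B * C) => x; rewrite normrM; apply: ler_pM.
Qed.

Lemma bounded_measurableD b c : bounded_measurable b -> bounded_measurable c ->
  bounded_measurable (b \+ c).
Proof.
move=> [mb [B bB]] [mc [C cC]]; split; first exact: measurable_funD.
by exists (B + C) => x; apply: le_trans (ler_normD _ _) _; exact: lerD.
Qed.

Lemma bounded_measurable_cst k : bounded_measurable (cst k).
Proof. by split; [exact: measurable_cst|exists `|k|]. Qed.

Lemma bounded_measurable_algebra a : A a -> bounded_measurable a.
Proof. by move=> Aa; split; [exact: Am|exists 1; exact: Ab]. Qed.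

Lemma integrable_mul_bounded b : bounded_measurable b ->
  mu.-integrable setT (EFin \o (fun x => u x * b x)).
Proof.
move=> [mb [B bB]].
have mu_ : measurable_fun setT u by apply/measurable_EFinP; exact: measurable_int iu.
apply: (@le_integrable _ _ _ mu setT measurableT _ (fun x => B%:E * (EFin \o u) x)%E).
- by apply/measurable_EFinP; exact: measurable_funM.
- move=> x _; rewrite /= lee_fin !normrM mulrC; apply: ler_wpM2r => //.
  by apply: le_trans (bB x) _; exact: ler_norm.
- exact: integrableZl.
Qed.

Lemma multiplier_algebra a : A a -> multiplier a.
Proof.
move=> Aa; split; first exact: bounded_measurable_algebra.
move=> b [mb b0]; split.
  by apply: bounded_measurableM => //; exact: bounded_measurable_algebra.
move=> c Ac; have [a1 [a2 [Aa1 Aa2 acE]]] := AM Aa Ac.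
transitivity (\int[mu]_x (2^-1 * (u x * (b x * a1 x)) + 2^-1 * (u x * (b x * a2 x)))).
  apply: eq_Rintegral => x _.
  rewrite -[(a \* b) x]/(a x * b x) mulrAC acE.
  by field.
have I e : A e -> mu.-integrable setT (EFin \o (fun x => u x * (b x * e x))).
  move=> Ae; apply: (@integrable_mul_bounded (b \* e)).
  by apply: bounded_measurableM => //; exact: bounded_measurable_algebra.
rewrite RintegralD//; last 2 first.
- exact: (integrableZl measurableT _ (I _ Aa1)).
- exact: (integrableZl measurableT _ (I _ Aa2)).
by rewrite !RintegralZl ?b0 ?mulr0 ?addr0//; exact: I.
Qed.

Lemma multiplier_cst k : multiplier (cst k).
Proof.
split; first exact: bounded_measurable_cst.
move=> b [mb b0]; split.
  by apply: bounded_measurableM => //; exact: bounded_measurable_cst.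
move=> a Aa.
transitivity (\int[mu]_x (k * (u x * (b x * a x)))).
  by apply: eq_Rintegral => x _ /=; ring.
rewrite RintegralZl ?b0 ?mulr0//.
apply: (@integrable_mul_bounded (b \* a)).
by apply: bounded_measurableM => //; exact: bounded_measurable_algebra.
Qed.

Lemma multiplierM c e : multiplier c -> multiplier e -> multiplier (c \* e).
Proof.
move=> [mc Mc] [me Me]; split; first exact: bounded_measurableM.
move=> b /Me /Mc; congr annihilated.
by apply/funext => x /=; rewrite mulrA.
Qed.

Lemma multiplierD c e : multiplier c -> multiplier e -> multiplier (c \+ e).
Proof.
move=> [mc Mc] [me Me]; split; first exact: bounded_measurableD.
move=> b Vb; have [mcb cb] := Mc b Vb; have [meb eb] := Me b Vb.
have -> : (c \+ e) \* b = (c \* b) \+ (e \* b).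
  by apply/funext => x /=; rewrite mulrDl.
split; first exact: bounded_measurableD.
move=> a Aa.
have I f : bounded_measurable f ->
    mu.-integrable setT (EFin \o (fun x => u x * (f x * a x))).
  move=> mf; apply: (@integrable_mul_bounded (f \* a)).
  by apply: bounded_measurableM => //; exact: bounded_measurable_algebra.
transitivity (\int[mu]_x (u x * ((c \* b) x * a x) + u x * ((e \* b) x * a x))).
  by apply: eq_Rintegral => x _ /=; ring.
by rewrite RintegralD ?cb ?eb ?addr0//; exact: I.
Qed.

Lemma multiplier_lim (ck : nat -> T -> R) c (C : R) : (forall k, multiplier (ck k)) ->
  (forall x, ck k x @[k --> \oo] --> c x) -> (forall k x, `|ck k x| <= C) ->
  multiplier c.
Proof.
move=> Mck ckc ckC.
have mc : measurable_fun setT c.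
  apply: (@measurable_fun_cvg _ _ _ setT ck) => // k.
  by have [[]] := Mck k.
have cC x : `|c x| <= C.
  have := cvg_norm (ckc x) => h.
  by apply: (cvgr_to_le (h _)); exact: nearW.
have bmc : bounded_measurable c by split => //; exists C.
split=> // b Vb; have [mb _] := Vb.
split; first exact: bounded_measurableM.
move=> a Aa.
have bma := bounded_measurable_algebra Aa.
have [B bB] := mb.2.
have iub := integrable_mul_bounded (bounded_measurableM mb bma).
have mub : measurable_fun setT (fun x => u x * (b x * a x)).
  by apply/measurable_EFinP; exact: measurable_int iub.
have [||||||_ h] := @Rintegral_dominated _ _ _ mu setT
  (fun k x => u x * ((ck k \* b) x * a x)) (fun x => u x * ((c \* b) x * a x))
  (fun x => C * `|u x * (b x * a x)|) => //.
- move=> k; rewrite (_ : (fun _ => _) = (fun x => ck k x * (u x * (b x * a x)))).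
    by apply: measurable_funM => //; have [[]] := Mck k.
  by apply/funext => x /=; ring.
- rewrite (_ : (fun _ => _) = (fun x => c x * (u x * (b x * a x)))).
    exact: measurable_funM.
  by apply/funext => x /=; ring.
- apply: nearW => x _.
  have e1 : (fun k => u x * ((ck k \* b) x * a x)) =
      (fun k => ck k x * (u x * (b x * a x))).
    by apply/funext => k /=; ring.
  have e2 : u x * ((c \* b) x * a x) = c x * (u x * (b x * a x)) by rewrite /=; ring.
  by rewrite e1 e2; apply: cvgMr_tmp; exact: ckc.
- exact: (integrableZl measurableT C (integrable_abse iub)).
- apply: nearW => x k _ /=.
  rewrite (_ : _ * _ = ck k x * (u x * (b x * a x))); last by ring.
  by rewrite normrM ler_wpM2r.
have h0 : (fun k => \int[mu]_x (u x * ((ck k \* b) x * a x))) = cst 0.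
  by apply/funext => k; have [_ /(_ b Vb)[_ ->]] := Mck k.
rewrite h0 in h; exact/esym/(cvg_unique _ (cvg_cst 0) h).
Qed.

Lemma multiplier_exp c : multiplier c -> multiplier (fun x => expR (c x)).
Proof.
move=> Mc; have [[mc [C cC]] _] := Mc.
have bound k (y : R) : `|y| <= C -> `|series (exp_coeff y) k| <= expR C.
  move=> yC; rewrite /series/=; apply: le_trans (ler_norm_sum _ _ _) _.
  apply: (@le_trans _ _ (series (exp_coeff C) k)).
    rewrite /series/= big_nat [leRHS]big_nat; apply: ler_sum => i _.
    rewrite /exp_coeff/= normrM normrX [X in _ * X <= _]ger0_norm ?invr_ge0//.
    by rewrite ler_wpM2r ?invr_ge0// lerXn2r// ?nnegrE// (le_trans _ yC).
  have C0 : 0 <= C by rewrite (le_trans _ yC).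
  apply: (nondecreasing_cvgn_le (u_ := series (exp_coeff C))).
    by apply: nondecreasing_series => i _ _; exact: exp_coeff_ge0.
  exact: is_cvg_series_exp_coeff.
apply: (@multiplier_lim (fun k x => series (exp_coeff (c x)) k) _ (expR C)).
- elim=> [|k IH].
    have -> : (fun x => series (exp_coeff (c x)) 0%N) = cst 0.
      by apply/funext => x; rewrite /series/= big_geq.
    exact: multiplier_cst.
  have -> : (fun x => series (exp_coeff (c x)) k.+1) =
      (fun x => series (exp_coeff (c x)) k) \+ (cst (k`!%:R^-1) \* (fun x => c x ^+ k)).
    by apply/funext => x; rewrite seriesSr /exp_coeff/= [_ / _]mulrC.
  apply: multiplierD => //; apply: multiplierM; first exact: multiplier_cst.
  elim: k {IH} => [|k IH].
    rewrite (_ : (fun x => _) = cst 1); first exact: multiplier_cst.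
    by apply/funext => x; rewrite expr0.
  rewrite (_ : (fun x => _) = c \* (fun x => c x ^+ k)); first exact: multiplierM.
  by apply/funext => x; rewrite exprS.
- by move=> x; exact: is_cvg_series_exp_coeff.
- by move=> k x; exact: bound.
Qed.

(** exp(-exp(-j(c - s))) tends to 1, 1/e or 0 according to the sign of c - s;
    the powers of this limit tend to the indicator of c > s. *)
Lemma multiplier_indic c s : multiplier c ->
  multiplier (\1_[set x | s < c x] : T -> R).
Proof.
move=> Mc.
pose L x : R := if s < c x then 1 else if s == c x then expR (-1) else 0.
have L01 x : 0 <= L x <= 1.
  rewrite /L; case: ifP => _; first by rewrite ler01 lexx.
  case: ifP => _; last by rewrite ler01 lexx.
  by rewrite expR_ge0 -[X in _ <= X]expR0 ler_expR lerN10.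
have ML : multiplier L.
  pose cj (j : nat) x := expR (- expR (- j%:R * (c x - s))).
  apply: (@multiplier_lim cj _ 1).
  - move=> j; apply: multiplier_exp.
    rewrite (_ : (fun x => _) = cst (-1) \* (fun x => expR (- j%:R * (c x - s)))); last first.
      by apply/funext => x /=; rewrite mulN1r.
    apply: multiplierM; first exact: multiplier_cst.
    apply: multiplier_exp.
    rewrite (_ : (fun x => _) = (cst (- j%:R) \* (c \+ cst (- s))))//.
    apply: multiplierM; first exact: multiplier_cst.
    by apply: multiplierD => //; exact: multiplier_cst.
  - move=> x; rewrite /L /cj; case: ltgtP => cs.
    + rewrite -[X in _ --> X]expR0 -[X in expR X]oppr0.
      apply: continuous_cvg; first exact: continuous_expR.
      apply: cvgN.
      have ds : 0 < c x - s by rewrite subr_gt0.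
      under eq_cvg do rewrite mulNr -mulrN expRM_natl.
      apply: cvg_expr; rewrite ger0_norm ?expR_ge0//.
      by rewrite -expR0 ltr_expR oppr_lt0.
    + apply/cvgr0Pnorm_lt => e e0.
      have ds : 0 < s - c x by rewrite subr_gt0.
      (* expR y >= y makes the outer exponential at most 1 / (j (s - c)) *)
      near=> j.
      have j0 : 0 < j%:R :> R by near: j; exists 1%N => // j /= j1; rewrite ltr0n.
      rewrite ger0_norm ?expR_ge0// expRN.
      apply: (@le_lt_trans _ _ (j%:R * (s - c x))^-1).
        rewrite lef_pV2 ?posrE ?expR_gt0 ?mulr_gt0//.
        apply: (@le_trans _ _ (expR (- j%:R * (c x - s)))).
          rewrite mulNr -mulrN opprB; apply: le_trans (expR_ge1Dx _).
          by rewrite lerDr.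
        by apply: le_trans (expR_ge1Dx _); rewrite lerDr.
      rewrite invf_plt ?posrE ?mulr_gt0// -ltr_pdivrMr//.
      near: j; exact: nbhs_infty_gtr.
    + rewrite cs subrr; under eq_cvg do rewrite mulr0 expR0.
      exact: cvg_cst.
  - move=> j x; rewrite ger0_norm ?expR_ge0// -expR0 ler_expR oppr_le0.
    exact: expR_ge0.
apply: (@multiplier_lim (fun k x => L x ^+ k) _ 1).
- elim=> [|k IH].
    rewrite (_ : (fun x => _) = cst 1); first exact: multiplier_cst.
    by apply/funext => x; rewrite expr0.
  rewrite (_ : (fun x => _) = L \* (fun x => L x ^+ k)); first exact: multiplierM.
  by apply/funext => x; rewrite exprS.
- move=> x; rewrite /indic; have [sc|sc] := boolP (s < c x).
    rewrite mem_set//= /L sc; under eq_cvg do rewrite expr1n.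
    exact: cvg_cst.
  rewrite memNset//=; last exact/negP.
  apply: cvg_expr; rewrite ger0_norm; last by case/andP: (L01 x).
  rewrite /L (negbTE sc); case: ifP => _; last exact: ltr01.
  by rewrite -[X in _ < X]expR0 ltr_expR oppr_lt0.
- move=> k x; have /andP[L0 L1] := L01 x.
  by rewrite ger0_norm ?exprn_ge0// exprn_ile1.
Unshelve. all: by end_near. Qed.

Definition superlevel_sets : set (set T) :=
  [set B | exists a s, A a /\ B = [set x | s < a x]].

Lemma multiplier_sigma_algebra : sigma_algebra setT
  [set B : set T | multiplier (\1_B : T -> R)].
Proof.
have MC (B : set T) : multiplier (\1_B : T -> R) -> multiplier (\1_(~` B) : T -> R).
  move=> MB; rewrite (_ : \1_ _ = cst 1 \+ (cst (-1) \* \1_B)); last first.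
    apply/funext => x; rewrite /= mulN1r !indicE in_setC.
    by case: (x \in B); rewrite ?subrr ?subr0.
  by apply: multiplierD; [|apply: multiplierM => //]; exact: multiplier_cst.
have MI (B C : set T) : multiplier (\1_B : T -> R) -> multiplier (\1_C : T -> R) ->
    multiplier (\1_(B `&` C) : T -> R).
  by move=> MB MC'; rewrite indicI; exact: multiplierM.
split.
- by rewrite /= indic0; exact: multiplier_cst.
- by move=> B /= MB; rewrite setTD; exact: MC.
- move=> F /= MF.
  have MU k : multiplier (\1_(\big[setU/set0]_(i < k) F i) : T -> R).
    elim: k => [|k IH]; first by rewrite big_ord0 indic0; exact: multiplier_cst.
    rewrite big_ord_recr/= -[X in \1_X]setCK setCU; apply: (MC).
    by apply: (MI); apply: (MC).
  apply: (@multiplier_lim _ _ 1 MU).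
  + move=> x; apply: cvg_near_cst.
    have [[i _ Fi]|nF] := pselect ((\bigcup_k F k) x).
      near=> k; rewrite !indicE !mem_set//; first by exists i.
      rewrite -bigcup_mkord; exists i => //=.
      near: k; exact: nbhs_infty_gt.
    apply: nearW => k; rewrite !indicE !memNset//.
    rewrite -bigcup_mkord => -[i _ Fi]; apply: nF; by exists i.
  + by move=> k x; rewrite indicE; case: (x \in _); rewrite ?normr1 ?normr0 ?ler01.
Unshelve. all: by end_near. Qed.

(** The sets whose indicators are multipliers form a sigma-algebra, which
    contains the superlevel sets. *)
Lemma integral_generated_set0 (B : set T) : (<<s superlevel_sets >>) B ->
  \int[mu]_x (u x * \1_B x) = 0.
Proof.
move=> sB.
have : multiplier (\1_B : T -> R).
  have := @smallest_sub _ (sigma_algebra setT) superlevel_sets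
    [set B : set T | multiplier (\1_B : T -> R)] multiplier_sigma_algebra.
  apply => // _ [a [s [Aa ->]]]; apply: multiplier_indic.
  exact: multiplier_algebra.
move=> [_ /(_ (cst 1))[]].
  split; first exact: bounded_measurable_cst.
  by move=> a Aa; under eq_Rintegral do rewrite /= mul1r; exact: uA.
move=> _ /(_ _ A1) h; rewrite -[RHS]h.
by apply: eq_Rintegral => x _; rewrite /= !mulr1.
Qed.

End orthogonal_to_algebra.

(** * Uniqueness of Fourier coefficients *)

Section recovering_the_coordinate.
Context {R : realType}.

Lemma measurable_fun_superlevel d (T : measurableType d) (f : T -> R) :
  (forall s, measurable [set x | s < f x]) -> measurable_fun setT f.
Proof.
move=> mf; apply: (measurability _ (RGenOInfty.measurableE R)).
move=> _ [_ [s ->] <-]; rewrite setTI.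
rewrite (_ : _ @^-1` _ = [set x | s < f x])//.
by apply/seteqP; split => x /=; rewrite in_itv/= andbT.
Qed.

Lemma measurable_acos_comp d (T : measurableType d) (c : T -> R) :
  (forall x, -1 <= c x <= 1) -> measurable_fun setT c ->
  measurable_fun setT (fun x => acos (c x)).
Proof.
move=> c1 mc; apply: measurable_fun_superlevel => s.
have [s0|s0] := ltP s 0.
  rewrite (_ : [set x | _] = setT)//; apply/seteqP; split => x //= _.
  by rewrite (lt_le_trans s0)// acos_ge0.
have [spi|spi] := leP pi s.
  rewrite (_ : [set x | _] = set0)//; apply/seteqP; split => x //=.
  by rewrite ltNge (le_trans _ spi)// acos_lepi.
rewrite (_ : [set x | _] = c @^-1` `]-oo, cos s[%classic).
  by rewrite -[X in measurable X]setTI; exact: mc.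
have key x : (s < acos (c x)) = (c x < cos s).
  rewrite -[in RHS](@acosK _ (c x)) ?in_itv//=.
  have cx : acos (c x) \in `[0, pi] by rewrite in_itv/= acos_ge0 ?acos_lepi.
  by rewrite ltr_cos// in_itv/= s0 ltW.
by apply/seteqP; split => x /=; rewrite in_itv/= key.
Qed.

(** The inverse on ]0, 1[ of x |-> (cos 2 pi x, sin 2 pi x). *)
Definition circle_coordinate (c s : R) : R :=
  if 0 < s then acos c / (2 * pi) else 1 - acos c / (2 * pi).

Lemma circle_coordinateE (x : R) : 0 < x < 1 ->
  circle_coordinate (cos (2 * pi * x)) (sin (2 * pi * x)) = x.
Proof.
move=> /andP[x0 x1]; have pi0 := pi_gt0 R.
have pipos : 0 < 2 * pi :> R by rewrite mulr_gt0.
rewrite /circle_coordinate; have [xh|xh] := ltP x 2^-1.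
  have h : 2 * pi * x < pi by nra.
  rewrite sin_gt0_pi; last by rewrite mulr_gt0.
    have hx : 2 * pi * x \in `[0, pi] by rewrite in_itv/= !ltW// mulr_gt0.
  by rewrite cosK// [_ * x]mulrC mulfK// gt_eqF.
have h : pi <= 2 * pi * x by nra.
have h2 : 2 * pi * x < 2 * pi by rewrite gtr_pMr.
have e : 2 * pi * x = - (2 * pi - 2 * pi * x) + pi *+ 2.
  by rewrite -mulr_natl; ring.
have -> : 0 < sin (2 * pi * x) = false.
  apply/negbTE; rewrite -leNgt -(subrK pi (2 * pi * x)) sinDpi oppr_le0.
  by apply: sin_ge0_pi; apply/andP; split; lra.
rewrite {1}e cosD2pi cosN cosK; last by rewrite in_itv/=; apply/andP; split; lra.
have p0 : 2 * pi != 0 :> R by rewrite gt_eqF.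
by rewrite mulrBl divff// [_ * x]mulrC mulfK//; ring.
Qed.

End recovering_the_coordinate.

Section fourier_uniqueness.
Context {R : realType} {n : nat}.
Notation mR := (measurableTypeR R).
Notation mu := (@cube_measure R n).
Notation Q := (@cube R n).
Notation Zn := 'rV[int]_n.
Notation Rn := 'rV[R]_n.

Definition open_cube : set (n.-tuple mR) :=
  [set t | forall i, `]0, 1[%classic (tnth t i : R)].

Lemma ae_open_cube : {ae mu, forall t, open_cube t}.
Proof.
have mo : measurable open_cube.
  have := @measurable_box R n (fun=> `]0, 1[%classic); apply => i.
  exact: measurable_itv.
exists (~` open_cube); split => //; first exact: measurableC.
rewrite probability_setC// (@cube_measure_box R n (fun=> `]0, 1[%classic)); last first.
  by move=> i; exact: measurable_itv.
rewrite big1 ?subee// => i _.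
rewrite (_ : _ `&` _ = `]0, 1[%classic).
  by rewrite lebesgue_measure_itv/= lte_fin ltr01 sube0.
apply/seteqP; split => x /=; rewrite !in_itv/=; first by case.
by move=> /andP[x0 x1]; rewrite x0 x1 !ltW.
Qed.

Definition wave_algebra : set (n.-tuple mR -> R) :=
  [set a | exists m theta, a = fun t => wave m theta (point t)].

(** Inside the open cube, each coordinate is a Borel function of two waves;
    on the faces, where 0 and 1 are identified, it is not determined by
    them. *)
Lemma wave_generated_set (E : set (n.-tuple mR)) : measurable E ->
  exists2 B, (<<s superlevel_sets wave_algebra >>) B &
    forall t, open_cube t -> E t = B t.
Proof.
move=> mE; pose T' := g_sigma_algebraType (superlevel_sets wave_algebra).
pose c i (t : T') : R := wave (delta_mx 0 i) 0 (point t).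
pose s i (t : T') : R := wave (delta_mx 0 i) (- (pi / 2)) (point t).
have mw m theta : measurable_fun setT (fun t : T' => wave m theta (point t)).
  apply: measurable_fun_superlevel => r; apply: sub_sigma_algebra.
  by exists (fun t => wave m theta (point t)), r; split => //; exists m, theta.
have tE i t : point t 0 i = tnth t i :> R by rewrite mxE.
have dE i (t : n.-tuple mR) : dotp (delta_mx 0 i) (point t) = tnth t i :> R.
  rewrite /dotp (bigD1 i)//= mxE !eqxx mul1r tE big1 ?addr0// => j /negbTE ji.
  by rewrite mxE ji andbF mul0r.
pose f (t : T') : n.-tuple mR := [tuple (circle_coordinate (c i t) (s i t) : mR) | i < n].
have mf : measurable_fun setT f.
  apply/measurable_fun_tnthP => i.
  rewrite (_ : _ \o _ = fun t => circle_coordinate (c i t) (s i t) : mR); last first.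
    by apply/funext => t /=; rewrite tnth_mktuple.
  have macos : measurable_fun setT (fun t : T' => acos (c i t) / (2 * pi)).
    apply: measurable_funM; last exact: measurable_cst.
    apply: measurable_acos_comp; last exact: mw.
    by move=> t; rewrite cos_geN1 cos_le1.
  rewrite /circle_coordinate; apply: measurable_fun_ifT => //.
    by apply: measurable_fun_ltr; [exact: measurable_cst|exact: mw].
  by apply: measurable_funB => //; exact: measurable_cst.
exists (f @^-1` E).
  by have := mf measurableT E mE; rewrite setTI.
move=> t Qt; rewrite /= (_ : f t = t)//; apply: eq_from_tnth => i.
rewrite tnth_mktuple /c /s /wave !dE addr0 cosBpihalf.
by apply: circle_coordinateE; have := Qt i; rewrite /= in_itv.
Qed.

(** Up to a null set every Borel set belongs to the sigma-algebra generated
    by the superlevel sets of waves, so u has integral 0 over it. *)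
Lemma wave_uniqueness (u : n.-tuple mR -> R) :
  mu.-integrable Q (EFin \o u) ->
  (forall m theta, \int[mu]_(t in Q) (u t * wave m theta (point t)) = 0) ->
  {ae mu, forall t, Q t -> u t = 0}.
Proof.
move=> iu u0; have mQ := @measurable_cube R n.
pose v := u \_ Q.
have vE t : Q t -> v t = u t by move=> Qt; rewrite /v patchE mem_set.
have iv : mu.-integrable setT (EFin \o v).
  have := iu; rewrite integrable_mkcond//; congr (integrable _ _ _).
  by apply/funext => t; rewrite /v /= !patchE; case: ifP.
have va a : wave_algebra a -> \int[mu]_x (v x * a x) = 0.
  move=> [m [theta ->]]; rewrite -[RHS](u0 m theta) [RHS]Rintegral_mkcond.
  apply: eq_Rintegral => t _; rewrite /v !patchE; case: ifP => //.
  by rewrite mul0r.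
have gen0 B : (<<s superlevel_sets wave_algebra >>) B -> \int[mu]_x (v x * \1_B x) = 0.
  apply: (integral_generated_set0 iv) => //.
  - exists 0, 0; apply/funext => t; rewrite /wave dotp0l mulr0 addr0 cos0//.
  - move=> _ _ [m [theta ->]] [m' [theta' ->]].
    exists (fun t => wave (m + m') (theta + theta') (point t)).
    exists (fun t => wave (m - m') (theta - theta') (point t)).
    split; [by do 2 eexists|by do 2 eexists|].
    by move=> t; exact: waveM.
  - by move=> _ [m [theta ->]]; exact: measurable_wave.
  - by move=> _ [m [theta ->]] t; exact: wave_le1.
have mv : measurable_fun setT v by apply/measurable_EFinP; exact: measurable_int iv.
have E0 E : measurable E -> (\int[mu]_(x in E) (EFin \o v) x = 0)%E.
  move=> mE; have [B sB EB] := wave_generated_set mE.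
  have mB : measurable B.
    move: B sB {EB}; apply: smallest_sub; first exact: sigma_algebra_measurable.
    move=> _ [_ [r [[m [theta ->]] ->]]].
    rewrite (_ : mkset _ = (fun t => wave m theta (point t)) @^-1` `]r, +oo[%classic).
      by rewrite -[X in measurable X]setTI; apply: measurable_wave.
    by apply/seteqP; split => t /=; rewrite in_itv/= andbT.
  transitivity (\int[mu]_x (v x * \1_B x)%:E)%E.
    rewrite integral_mkcond; apply: ae_eq_integral => //.
    - apply/(measurable_restrictT _ mE); apply: measurable_funTS.
      exact/measurable_EFinP.
    - by apply/measurable_EFinP; apply: measurable_funM.
    - apply: filterS ae_open_cube => t ot _; rewrite patchE indicE.
      have -> : (t \in E) = (t \in B) by apply/idP/idP; rewrite !inE (EB t ot).
      by case: ifP => _; rewrite ?mulr1 ?mulr0.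
  have ivB : mu.-integrable setT (EFin \o (fun x => v x * \1_B x)).
    apply: (@integrable_mul_bounded _ _ _ mu v iv (\1_B)); split.
      exact: measurable_indic.
    by exists 1 => x; rewrite indicE; case: (x \in B); rewrite ?normr1 ?normr0.
  rewrite -[LHS]fineK; last exact: integrable_fin_num ivB.
  by congr _%:E; exact: gen0.
have := @integral_ae_eq _ _ _ mu setT measurableT (cst 0%E) (EFin \o v) iv
  (measurable_cst _).
case.
  by move=> E _ mE; rewrite E0// integral0.
move=> N [mN N0 sub]; exists N; split => //.
by move=> t /= h; apply: sub => /= h2; apply: h => Qt; have [] := h2 I; rewrite vE.
Qed.

Lemma wave_characterE (m : Zn) theta (xi : Rn) : (wave m theta xi)%:C =
  2^-1 * (expi theta%:C * character (- m) xi + expi (- theta)%:C * character m xi).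
Proof.
rewrite /character -!expiD -!rmorphD/= dotpNl !mulrN opprK.
have -> : - theta - 2 * pi * dotp m xi = - (theta + 2 * pi * dotp m xi) by ring.
rewrite !expi_real cosN sinN /wave addrC.
move: (cos _) (sin _) => x y; apply: (@mulfI _ 2) => //.
rewrite mulrA mulfV// mul1r; apply/eqP; rewrite eq_complex /=.
by apply/andP; split; apply/eqP; ring.
Qed.

(** A wave is a combination of two characters, so the real and the imaginary
    part of F are orthogonal to all waves. *)
Lemma fourier_uniqueness (F : Rn -> R[i]) : cintegrable F ->
  (forall m, cint (fun xi => F xi * character m xi) = 0) ->
  ae_cube (fun xi => F xi = 0).
Proof.
move=> iF F0; have [iR iI] := iF.
have FW m theta : cint (fun xi => F xi * (wave m theta xi)%:C) = 0.
  transitivity (cint (fun xi => (2^-1 * expi theta%:C) * (F xi * character (- m) xi) +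
     (2^-1 * expi (- theta)%:C) * (F xi * character m xi))).
    by congr cint; apply/funext => xi; rewrite wave_characterE; ring.
  have iC k := cintegrable_mul_character k iF.
  by rewrite cintD ?cintZ ?F0 ?mulr0 ?addr0//; exact: cintegrableZ.
have R0 : {ae mu, forall t, Q t -> complex.Re (F (point t)) = 0}.
  apply: (wave_uniqueness iR) => m theta.
  have /(congr1 (@complex.Re R)) /= h := FW m theta; rewrite -[RHS]h.
  by apply: eq_Rintegral => t _; rewrite cReM/= mulr0 subr0.
have I0 : {ae mu, forall t, Q t -> complex.Im (F (point t)) = 0}.
  apply: (wave_uniqueness iI) => m theta.
  have /(congr1 (@complex.Im R)) /= h := FW m theta; rewrite -[RHS]h.
  by apply: eq_Rintegral => t _; rewrite cImM/= mulr0 add0r.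
rewrite /ae_cube; apply: filterS2 R0 I0 => t r0 i0 Qt.
by apply/eqP; rewrite eq_complex /= r0// i0// !eqxx.
Qed.

End fourier_uniqueness.

(** * Series of functions and square-summable coefficients *)

Section complex_series.
Context {R : realType}.

Lemma ccvg_unique (u : nat -> R[i]) (l l' : R[i]) : ccvg u l -> ccvg u l' -> l = l'.
Proof.
move=> /cvg_ReImP[rl il] /cvg_ReImP[rl' il'].
by apply/eqP; rewrite eq_complex (cvg_unique _ rl rl') ?(cvg_unique _ il il') ?eqxx.
Qed.

Lemma abs_series_cvg (z : nat -> R[i]) (C : R) :
  (forall K, \sum_(k < K) normc (z k) <= C) ->
  exists l, ccvg (fun K => \sum_(k < K) z k) l.
Proof.
move=> zC.
have H (w : nat -> R) : (forall k, `|w k| <= normc (z k)) ->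
    exists l : R, \sum_(k < K) w k @[K --> \oo] --> l.
  move=> wz; have : cvgn (series w).
    apply: normed_cvg; apply: nondecreasing_is_cvgn.
      by apply: nondecreasing_series => k _ _; rewrite normr_ge0.
    exists C => _ [K _ <-]; apply: (@le_trans _ _ (\sum_(k < K) `|w k|)).
      by rewrite -(big_mkord xpredT (fun k => `|w k|)).
    by apply: le_trans (zC K); exact: ler_sum.
  move=> /cvg_ex[l wl]; exists l; move: wl; apply: cvg_trans.
  by apply: near_eq_cvg; apply: nearW => K; rewrite /series/= big_mkord.
have [a ra] := H (fun k => complex.Re (z k)) (fun k => ler_Re_normc _).
have [b ib] := H (fun k => complex.Im (z k)) (fun k => ler_Im_normc _).
exists (a +i* b); apply/cvg_ReImP; split => /=.
- by under eq_cvg do rewrite Re_sum.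
- by under eq_cvg do rewrite Im_sum.
Qed.

End complex_series.

Section limits_of_functions.
Context {R : realType} {n : nat}.
Notation mR := (measurableTypeR R).
Notation mu := (@cube_measure R n).
Notation Q := (@cube R n).
Notation Zn := 'rV[int]_n.
Notation Rn := 'rV[R]_n.
Let mQ : measurable Q. Proof. exact: measurable_cube. Qed.

(** A total, measurable choice of the pointwise limit. *)
Definition climsup (FF : nat -> Rn -> R[i]) (xi : Rn) : R[i] :=
  fine (limn_esup (fun k => (complex.Re (FF k xi))%:E)) +i*
  fine (limn_esup (fun k => (complex.Im (FF k xi))%:E)).

Lemma climsupE (FF : nat -> Rn -> R[i]) xi l : ccvg (FF ^~ xi) l ->
  climsup FF xi = l.
Proof.
move=> /cvg_ReImP[rl il]; rewrite /climsup.
have H (w : nat -> R) a : w k @[k --> \oo] --> a ->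
    fine (limn_esup (fun k => (w k)%:E)) = a.
  move=> wa; suff -> : limn_esup (fun k => (w k)%:E) = a%:E by [].
  by apply: (cvg_limn_einf_sup _).2; apply: cvg_EFin => //; exact: nearW.
by apply/eqP; rewrite eq_complex /= (H _ _ rl) (H _ _ il) !eqxx.
Qed.

Lemma cmeasurable_climsup (FF : nat -> Rn -> R[i]) :
  (forall k, cmeasurable (FF k)) -> cmeasurable (climsup FF).
Proof.
move=> mFF.
have H (w : nat -> n.-tuple mR -> R) : (forall k, measurable_fun Q (w k)) ->
    measurable_fun Q (fun t => fine (limn_esup (fun k => (w k t)%:E))).
  move=> mw; apply: (@measurableT_comp _ _ _ _ _ _ (@fine R)).
    exact: fine_measurable.
  apply: measurable_fun_limn_esup => k; exact/measurable_EFinP.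
by split; apply: H => k; have [] := mFF k.
Qed.

(** The sum of the norms is integrable, hence finite almost everywhere, and
    dominates the partial sums. *)
Lemma L1_series (H : nat -> Rn -> R[i]) (C : R) :
  (forall k, cintegrable (H k)) ->
  (forall K, \sum_(k < K) \int[mu]_(t in Q) normc (H k (point t)) <= C) ->
  let S := climsup (fun K xi => \sum_(k < K) H k xi) in
  [/\ cintegrable S,
      ae_cube (fun xi => ccvg (fun K => \sum_(k < K) H k xi) (S xi)) &
      forall B, cmeasurable B -> (forall xi, normc (B xi) <= 1) ->
        ccvg (fun K => \sum_(k < K) cint (fun xi => H k xi * B xi))
          (cint (fun xi => S xi * B xi))].
Proof.
move=> iH HC S.
have mH k : cmeasurable (H k) by exact: cintegrable_cmeasurable.
have mN k : measurable_fun Q (fun t => (normc (H k (point t)))%:E).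
  by apply/measurable_EFinP; exact: measurable_normc.
pose W t := (\sum_(k <oo) (normc (H k (point t)))%:E)%E.
have W0 t : (0 <= W t)%E by apply: nneseries_ge0 => k _ _; rewrite lee_fin normc_ge0.
have mW : measurable_fun Q W.
  by apply: ge0_emeasurable_sum => // k t _ _; rewrite lee_fin normc_ge0.
have iW : mu.-integrable Q W.
  apply/integrableP; split => //.
  under eq_integral do rewrite gee0_abs//.
  rewrite integral_nneseries//; last by move=> k t _; rewrite lee_fin normc_ge0.
  apply: (@le_lt_trans _ _ C%:E); last exact: ltry.
  apply: lime_le; first by apply: is_cvg_nneseries => k _ _; apply: integral_ge0 => t _; rewrite lee_fin normc_ge0.
  apply: nearW => K; rewrite big_mkord.
  apply: le_trans (_ : (\sum_(k < K) \int[mu]_(t in Q) normc (H k (point t)))%R%:E <= _)%E; last first.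
    by rewrite lee_fin.
  rewrite -sumEFin; apply: lee_sum => k _.
  by rewrite /Rintegral fineK//; exact: integrable_fin_num (cintegrable_normc (iH k)).
have Wfin := integrable_ae mQ iW.
have part t K : W t \is a fin_num -> \sum_(k < K) normc (H k (point t)) <= fine (W t).
  move=> Wt; rewrite -lee_fin fineK// -sumEFin -(big_mkord xpredT (fun k => (normc (H k (point t)))%:E)).
  by apply: nneseries_lim_ge => k _ _; rewrite lee_fin normc_ge0.
have cvgS : ae_cube (fun xi => ccvg (fun K => \sum_(k < K) H k xi) (S xi)).
  rewrite /ae_cube; apply: filterS Wfin => t Wt /Wt {}Wt.
  have [l zl] := @abs_series_cvg _ (fun k => H k (point t)) _ (fun K => part t K Wt).
  by rewrite /S (climsupE zl).
have mS : cmeasurable S.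
  by apply: cmeasurable_climsup => K; apply: cmeasurable_sum => k; exact: mH.
have ifW : mu.-integrable Q (EFin \o (fun t => fine (W t))).
  apply: (le_integrable mQ _ _ iW).
    by apply/measurable_EFinP; apply: (@measurableT_comp _ _ _ _ _ _ (@fine R)).
  move=> t _; rewrite /= [leRHS]gee0_abs//.
  rewrite ger0_norm ?fine_ge0//; have := W0 t; case: (W t) => //= _; exact: leey.
have bd : {ae mu, forall t K, Q t -> normc (\sum_(k < K) H k (point t)) <= fine (W t)}.
  apply: filterS Wfin => t Wt K /Wt {}Wt.
  by apply: le_trans (ler_normc_sum _ _ _) _; exact: part.
have [iS _] : cintegrable S /\ ccvg (fun K => cint (fun xi => \sum_(k < K) H k xi)) (cint S).
  apply: (cint_dominated (g := fun t => fine (W t))) => //.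
  by move=> K; apply: cmeasurable_sum => k; exact: mH.
split => // B mB B1.
have [_] : cintegrable (fun xi => S xi * B xi) /\
    ccvg (fun K => cint (fun xi => (\sum_(k < K) H k xi) * B xi)) (cint (fun xi => S xi * B xi)).
  apply: (cint_dominated (g := fun t => fine (W t))).
  - by move=> K; apply: cmeasurableM => //; apply: cmeasurable_sum => k; exact: mH.
  - exact: cmeasurableM.
  - move: cvgS; rewrite /ae_cube; apply: filterS => t St /St /cvg_normcP h.
    apply/cvg_normcP.
    apply: (@squeeze_cvgr _ _ _ _ (fun=> 0) (fun K => normc (\sum_(k < K) H k (point t) - S (point t)))) => //.
      apply: nearW => K; rewrite normc_ge0/= -mulrBl normcM -[leRHS]mulr1.
      by rewrite ler_wpM2l// normc_ge0.
    exact: cvg_cst.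
  - exact: ifW.
  - apply: filterS bd => t bt K /(bt K); apply: le_trans.
    by rewrite normcM -[leRHS]mulr1 ler_wpM2l ?normc_ge0.
apply: cvg_trans; apply: near_eq_cvg; apply: nearW => K /=.
rewrite -cint_sum; last first.
  move=> k; apply: (cintegrableM_bounded (C := 1)) => //.
by congr cint; apply/funext => xi; rewrite mulr_suml.
Qed.

End limits_of_functions.

Section L2_theory.
Context {R : realType} {n : nat}.
Notation mR := (measurableTypeR R).
Notation mu := (@cube_measure R n).
Notation Q := (@cube R n).
Notation Zn := 'rV[int]_n.
Notation Rn := 'rV[R]_n.
Let mQ : measurable Q. Proof. exact: measurable_cube. Qed.
Implicit Types (A : {fset Zn}) (g : Zn -> R[i]).

Definition trig_poly A g (xi : Rn) : R[i] := \sum_(m <- A) character m xi * g m.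

Lemma trig_poly_bound A g xi : normc (trig_poly A g xi) <= \sum_(m <- A) normc (g m).
Proof.
apply: le_trans (ler_normc_sum _ _ _) _; apply: ler_sum => m _.
by rewrite normcM normc_character mul1r.
Qed.

Lemma cmeasurable_trig_poly A g : cmeasurable (trig_poly A g).
Proof.
apply: cmeasurable_sum => m; apply: cmeasurableM; last exact: cmeasurable_cst.
exact: cmeasurable_character.
Qed.

Lemma cintegrable_trig_poly A g : cintegrable (trig_poly A g).
Proof.
apply: (cintegrable_bounded (C := \sum_(m <- A) normc (g m))).
  exact: cmeasurable_trig_poly.
by move=> t _; exact: trig_poly_bound.
Qed.

Lemma trig_poly_periodic A g : Defs.periodic (trig_poly A g).
Proof.
by move=> xi m; apply: eq_bigr => k _; rewrite (character_periodic k).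
Qed.

Lemma trig_polyB A A' g : exists2 g' : Zn -> R[i],
  forall m, g' m = if (m \in A) == (m \in A') then 0 else
                   if m \in A then g m else - g m &
  forall xi, trig_poly A g xi - trig_poly A' g xi = trig_poly (A `|` A')%fset g' xi.
Proof.
exists (fun m => if (m \in A) == (m \in A') then 0 else
  if m \in A then g m else - g m) => // xi.
rewrite /trig_poly.
pose r (B : {fset Zn}) m := if m \in B then g m else 0.
have E (B : {fset Zn}) : (B `<=` A `|` A')%fset ->
    \sum_(m <- B) character m xi * g m =
    \sum_(m <- (A `|` A')%fset) character m xi * r B m.
  move=> BA; rewrite -(big_fset_incl _ BA); last first.
    by move=> m _ mB; rewrite /r (negbTE mB) mulr0.
  by rewrite big_seq [RHS]big_seq; apply: eq_bigr => m mB; rewrite /r mB.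
rewrite (E A) ?fsubsetUl// (E A') ?fsubsetUr// -sumrB; apply: eq_bigr => m _.
rewrite -mulrBr; congr (_ * _); rewrite /r.
by case: (m \in A); case: (m \in A'); rewrite /= ?subrr ?subr0 ?sub0r.
Qed.

(** Bessel's identity, from the orthogonality of the characters. *)
Lemma integral_trig_poly_sqr A g :
  \int[mu]_(t in Q) (normc (trig_poly A g (point t)) ^+ 2) =
  \sum_(m <- A) normc (g m) ^+ 2.
Proof.
have sqrE (z : R[i]) : (normc z ^+ 2)%:C = z * (z^*)%C.
  case: z => a b /=; rewrite sqr_sqrtr ?addr_ge0 ?sqr_ge0//.
  by apply/eqP; rewrite eq_complex /=; apply/andP; split; apply/eqP; ring.
pose F m m' (xi : Rn) : R[i] := g m * (g m')^*%C * character (m - m') xi.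
have iF m m' : cintegrable (F m m').
  by apply: cintegrableZ; exact: cintegrable_character.
have : cint (fun xi => (normc (trig_poly A g xi) ^+ 2)%:C) =
    (\sum_(m <- A) normc (g m) ^+ 2)%:C.
  transitivity (cint (fun xi => \sum_(m <- A) \sum_(m' <- A) F m m' xi)).
    congr cint; apply/funext => xi; rewrite sqrE /trig_poly rmorph_sum/= mulr_suml.
    apply: eq_bigr => m _; rewrite mulr_sumr; apply: eq_bigr => m' _.
    by rewrite /F characterD -conj_character rmorphM/=; ring.
  rewrite cint_sum; last by move=> m; exact: cintegrable_sum.
  rewrite rmorph_sum/= big_seq [RHS]big_seq; apply: eq_bigr => m mA.
  rewrite cint_sum// (big_fsetD1 m)//= big1_seq ?addr0.
    by rewrite /F cintZ ?subrr ?cint_character ?eqxx ?mulr1 ?sqrE//; exact: cintegrable_character.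
  move=> m' /=; rewrite !inE => /andP[m'm _].
  rewrite /F cintZ ?cint_character; last exact: cintegrable_character.
  by rewrite subr_eq0 eq_sym (negbTE m'm) mulr0.
by move=> /(congr1 (@complex.Re R)).
Qed.

Lemma measurable_normc_sqr (F : Rn -> R[i]) : cmeasurable F ->
  measurable_fun Q (fun t => normc (F (point t)) ^+ 2).
Proof. by move=> mF; apply: measurable_funX; exact: measurable_normc. Qed.

Lemma ler_half_sqr (x e : R) : 0 < e -> x <= (e + x ^+ 2 / e) / 2.
Proof.
move=> e0; rewrite ler_pdivlMr// -subr_ge0.
have -> : e + x ^+ 2 / e - x * 2 = (x - e) ^+ 2 / e by field; rewrite gt_eqF.
by rewrite divr_ge0 ?sqr_ge0 ?ltW.
Qed.

(** The Cauchy-Schwarz inequality on the probability space of the cube, by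
    optimizing the arithmetic-geometric mean inequality. *)
Lemma integral_normc_le (F : Rn -> R[i]) (e : R) : 0 < e -> cmeasurable F ->
  (\int[mu]_(t in Q) (normc (F (point t)) ^+ 2)%:E <= (e ^+ 2)%:E)%E ->
  cintegrable F /\ \int[mu]_(t in Q) normc (F (point t)) <= e.
Proof.
move=> e0 mF Fe.
have i2 : mu.-integrable Q (EFin \o (fun t => normc (F (point t)) ^+ 2)).
  apply/integrableP; split; first by apply/measurable_EFinP; exact: measurable_normc_sqr.
  apply: le_lt_trans (ltry (e ^+ 2)).
  by under eq_integral => t _ do rewrite /= ger0_norm ?sqr_ge0//.
pose g t := 2^-1 * e + (2 * e)^-1 * normc (F (point t)) ^+ 2.
have ig1 : mu.-integrable Q (EFin \o (fun t : n.-tuple mR => 2^-1 * e)).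
  by apply: (cube_integrable_bounded (C := `|2^-1 * e|)).
have ig2 : mu.-integrable Q (EFin \o (fun t => (2 * e)^-1 * normc (F (point t)) ^+ 2)).
  exact: (integrableZl mQ _ i2).
have ig : mu.-integrable Q (EFin \o g) by exact: (integrableD mQ ig1 ig2).
have Fg t : normc (F (point t)) <= g t.
  apply: le_trans (ler_half_sqr _ e0) _; rewrite le_eqVlt; apply/orP; left.
  by apply/eqP; rewrite /g; field; rewrite gt_eqF.
have iF : cintegrable F by apply: (cintegrable_dom mF ig); apply: nearW => t _.
split=> //.
apply: (@le_trans _ _ (\int[mu]_(t in Q) g t)).
  by apply: le_Rintegral => //; exact: cintegrable_normc.
rewrite /g RintegralD// Rintegral_cube_cst RintegralZl//.
have Fe' : \int[mu]_(t in Q) (normc (F (point t)) ^+ 2) <= e ^+ 2.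
  by rewrite -lee_fin /Rintegral fineK//; exact: integrable_fin_num i2.
apply: (@le_trans _ _ (2^-1 * e + (2 * e)^-1 * e ^+ 2)).
  by rewrite lerD2l ler_wpM2l// invr_ge0 mulr_ge0// ltW.
by rewrite le_eqVlt; apply/orP; left; apply/eqP; field; rewrite gt_eqF.
Qed.

Lemma ereal_integral_trig_poly_sqr A g :
  (\int[mu]_(t in Q) (normc (trig_poly A g (point t)) ^+ 2)%:E =
   (\sum_(m <- A) normc (g m) ^+ 2)%:E)%E.
Proof.
rewrite -integral_trig_poly_sqr /Rintegral fineK//.
apply: (@integrable_fin_num _ _ _ mu Q mQ (EFin \o (fun t => normc (trig_poly A g (point t)) ^+ 2))).
apply: (cube_integrable_bounded (C := (\sum_(m <- A) normc (g m)) ^+ 2)).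
  by apply: measurable_normc_sqr; exact: cmeasurable_trig_poly.
move=> t _; rewrite ger0_norm ?sqr_ge0// lerXn2r ?nnegrE ?normc_ge0//.
  by apply: sumr_ge0 => m _; exact: normc_ge0.
exact: trig_poly_bound.
Qed.

Lemma dft_L2_approx g G (e : R) : is_dft_L2 g G -> 0 < e ->
  exists A0, forall A, {subset A0 <= A} ->
    cintegrable (fun xi => G xi - trig_poly A g xi) /\
    \int[mu]_(t in Q) normc (G (point t) - trig_poly A g (point t)) <= e.
Proof.
move=> [mG _ G0] e0; have FF := @totally_proper Zn.
move/fine_cvgP : G0 => [Gfin /cvgr0Pnorm_le G0].
have e20 : 0 < e ^+ 2 by rewrite exprn_gt0.
have [A0 _ hA0] := filterI Gfin (G0 _ e20).
exists A0 => A /fsubsetP /hA0 [Afin].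
rewrite /= ger0_norm; last by apply: fine_ge0; apply: integral_ge0 => t _; rewrite lee_fin sqr_ge0.
move=> Ae; apply: (integral_normc_le (F := fun xi => G xi - trig_poly A g xi)) => //.
  by apply: cmeasurableB => //; exact: cmeasurable_trig_poly.
by rewrite -lee_fin fineK in Ae.
Qed.

Lemma dft_L2_cintegrable g G : is_dft_L2 g G -> cintegrable G.
Proof.
move=> gG; have [A0 /(_ A0 (fun=> id))[iD _]] := dft_L2_approx gG ltr01.
rewrite (_ : G = fun xi => (G xi - trig_poly A0 g xi) + trig_poly A0 g xi).
  by apply: cintegrableD => //; exact: cintegrable_trig_poly.
by apply/funext => xi; rewrite subrK.
Qed.

(** By Bessel's identity the approximating polynomials have norm at most M
    in L^2, hence in L^1. *)
Lemma dft_L2_norm1 g G (M : R) : is_dft_L2 g G -> 0 <= M ->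
  sums_le (fun m => normc (g m) ^+ 2) (M ^+ 2) ->
  \int[mu]_(t in Q) normc (G (point t)) <= M.
Proof.
move=> gG M0 gM; apply/ler_addgt0Pr => e e0.
have e2 : 0 < e / 2 by rewrite divr_gt0.
have [A0 /(_ A0 (fun=> id))[iD De]] := dft_L2_approx gG e2.
have Me : 0 < M + e / 2 by rewrite ltr_wpDl.
have [iP Pe] : cintegrable (trig_poly A0 g) /\
    \int[mu]_(t in Q) normc (trig_poly A0 g (point t)) <= M + e / 2.
  apply: integral_normc_le => //; first exact: cmeasurable_trig_poly.
  rewrite ereal_integral_trig_poly_sqr lee_fin; apply: le_trans (gM A0) _.
  by rewrite lerXn2r ?nnegrE// ?lerDl ltW.
have iG := dft_L2_cintegrable gG.
apply: (@le_trans _ _ (\int[mu]_(t in Q) (normc (G (point t) - trig_poly A0 g (point t)) +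
    normc (trig_poly A0 g (point t))))).
  apply: le_Rintegral => //.
  - exact: cintegrable_normc.
  - exact: (integrableD mQ (cintegrable_normc iD) (cintegrable_normc iP)).
  - by move=> t _; apply: le_trans (le_normcD _ _); rewrite subrK.
rewrite RintegralD//; last 2 first.
- exact: (cintegrable_normc iD).
- exact: (cintegrable_normc iP).
apply: le_trans (lerD De Pe) _.
by rewrite addrCA -splitr.
Qed.

(** The polynomials over the finite sets that contain m all have the
    coefficient g m, and they approach G in L^1. *)
Lemma dft_L2_coefficient g G m : is_dft_L2 g G ->
  cint (fun xi => G xi * character (- m) xi) = g m.
Proof.
move=> gG; have iG := dft_L2_cintegrable gG.
apply/eqP; rewrite -subr_eq0; apply/eqP/eq0_normc/eqP.
rewrite eq_le normc_ge0 andbT; apply/ler_addgt0Pr => e e0; rewrite add0r.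
have e2 : 0 < e / 2 by rewrite divr_gt0.
have [A0 hA0] := dft_L2_approx gG e2.
pose A := (m |` A0)%fset.
have [iD De] : cintegrable (fun xi => G xi - trig_poly A g xi) /\
    \int[mu]_(t in Q) normc (G (point t) - trig_poly A g (point t)) <= e / 2.
  by apply: hA0 => k kA; rewrite !inE kA orbT.
have iP := cintegrable_trig_poly A g.
have cP : cint (fun xi => trig_poly A g xi * character (- m) xi) = g m.
  transitivity (cint (fun xi => \sum_(k <- A) g k * character (k - m) xi)).
    congr cint; apply/funext => xi; rewrite mulr_suml; apply: eq_bigr => k _.
    by rewrite characterD; ring.
  rewrite cint_sum; last by move=> k; apply: cintegrableZ; exact: cintegrable_character.
  rewrite (big_fsetD1 m)/=; last by rewrite !inE eqxx.
  rewrite cintZ ?cint_character ?subrr ?eqxx ?mulr1; last exact: cintegrable_character.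
  rewrite big1_seq ?addr0// => k /=; rewrite !inE => /andP[km _].
  rewrite cintZ ?cint_character; last exact: cintegrable_character.
  by rewrite subr_eq0 (negbTE km) mulr0.
rewrite -{1}cP -cintB; [|exact: cintegrable_mul_character..].
rewrite (_ : (fun xi => _) = (fun xi => (G xi - trig_poly A g xi) * character (- m) xi)); last first.
  by apply/funext => xi; rewrite mulrBl.
apply: le_trans (normc_cint_le (cintegrable_mul_character _ iD)) _.
under eq_Rintegral do rewrite normcM normc_character mulr1.
by rewrite -ler_pdivlMl// mulrC.
Qed.

End L2_theory.

(** * The Riesz-Fischer theorem *)

Section riesz_fischer.
Context {R : realType} {n : nat}.
Notation mR := (measurableTypeR R).
Notation mu := (@cube_measure R n).
Notation Q := (@cube R n).
Notation Zn := 'rV[int]_n.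
Notation Rn := 'rV[R]_n.
Let mQ : measurable Q. Proof. exact: measurable_cube. Qed.
Implicit Types (A B : {fset Zn}) (g : Zn -> R[i]).

Lemma limn_einf_le (u : nat -> \bar R) c : (forall k, (u k <= c)%E) ->
  (limn_einf u <= c)%E.
Proof.
move=> uc; rewrite limn_einf_lim; apply: lime_le; first exact: is_cvg_einfs.
apply: nearW => k; apply: le_trans (uc k); apply: ereal_inf_lbound.
by exists k => /=.
Qed.

(** A frequency in exactly one of A and A' lies outside B or outside A'. *)
Lemma trig_polyB_norm A A' B g (e e' : R) : {subset B <= A} ->
  sums_le (fun m => if m \in B then 0 else normc (g m) ^+ 2) e ->
  sums_le (fun m => if m \in A' then 0 else normc (g m) ^+ 2) e' ->
  (\int[mu]_(t in Q)
     (normc (trig_poly A' g (point t) - trig_poly A g (point t)) ^+ 2)%:E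
   <= (e + e')%:E)%E.
Proof.
move=> BA Be A'e'; have [g' g'E dE] := trig_polyB A' A g.
under eq_integral do rewrite dE.
rewrite ereal_integral_trig_poly_sqr lee_fin.
apply: le_trans (sums_leD Be A'e' _); apply: ler_sum => m _.
rewrite g'E; have [mA'|mA'] := boolP (m \in A'); have [mA|mA] := boolP (m \in A).
- by rewrite eqxx normc0 expr0n/= addr0; case: ifP => // _; rewrite sqr_ge0.
- by rewrite /= addr0 (negbTE (contra (BA m) mA)).
- by rewrite /= normcN lerDr; case: ifP => // _; rewrite sqr_ge0.
- by rewrite eqxx normc0 expr0n/= addr_ge0 ?sqr_ge0//; case: ifP => // _; rewrite sqr_ge0.
Qed.

(** Riesz-Fischer: polynomials whose distances decrease geometrically converge
    almost everywhere, and by Fatou's lemma the limit is also their limit in the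
    square mean. *)
Lemma riesz_fischer g (C : R) : sums_le (fun m => normc (g m) ^+ 2) C ->
  exists G, is_dft_L2 g G.
Proof.
move=> gC; have g2 m : 0 <= normc (g m) ^+ 2 by rewrite sqr_ge0.
(* with squared tails at most 4^-j, consecutive polynomials differ by at most
   2 * 2^-j in the square mean *)
pose e j : R := (2^-1 ^+ j) ^+ 2.
have e0 j : 0 < e j by rewrite !exprn_gt0.
have eS j i : (i <= j)%N -> e j <= e i.
  move=> ij; rewrite /e lerXn2r ?nnegrE ?exprn_ge0//.
  by apply: ler_wiXn2l => //; rewrite invf_le1// ler1n.
have /choice[A hA] := fun j => sums_le_tail g2 gC (e0 j).
pose P j := trig_poly (A j) g.
pose H j xi := P j.+1 xi - P j xi.
have iP j : cintegrable (P j) by exact: cintegrable_trig_poly.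
have mP j : cmeasurable (P j) by exact: cmeasurable_trig_poly.
have mH j : cmeasurable (H j) by exact: cmeasurableB.
have dH j : cintegrable (H j) /\ \int[mu]_(t in Q) normc (H j (point t)) <= 2 * 2^-1 ^+ j.
  have c0 : 0 < 2 * 2^-1 ^+ j :> R by rewrite mulr_gt0// exprn_gt0.
  apply: (integral_normc_le c0 (mH j)).
  apply: le_trans (trig_polyB_norm (fun m => id) (hA j) (hA j.+1)) _.
  rewrite lee_fin exprMn -/(e j).
  by have := eS _ _ (leqnSn j); have := e0 j; lra.
have HC K : \sum_(k < K) \int[mu]_(t in Q) normc (H k (point t)) <= 4.
  apply: (@le_trans _ _ (\sum_(k < K) 2 * 2^-1 ^+ k)).
    by apply: ler_sum => k _; exact: (dH k).2.
  rewrite -mulr_sumr; suff -> : \sum_(k < K) 2^-1 ^+ k = 2 * (1 - 2^-1 ^+ K) :> R.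
    by have : 0 <= 2^-1 ^+ K :> R; [exact: exprn_ge0 | lra].
  elim: K => [|K IH]; first by rewrite big_ord0 expr0; lra.
  by rewrite big_ord_recr/= IH exprS; lra.
have [_ cvgS _] := L1_series (fun k => (dH k).1) HC.
have HE xi K : \sum_(k < K) H k xi = P K xi - P 0%N xi.
  by elim: K => [|K IH]; rewrite ?big_ord0 ?subrr// big_ord_recr/= IH /H addrC addrA subrK.
pose G := climsup P.
have mG : cmeasurable G by exact: cmeasurable_climsup.
have cvgG : ae_cube (fun xi => ccvg (P ^~ xi) (G xi)).
  move: cvgS; rewrite /ae_cube; apply: filterS => t + Qt => /(_ Qt) /cvg_normcP h.
  set l := climsup _ _ in h.
  have Pl : ccvg (P ^~ (point t)) (l + P 0%N (point t)).
    apply/cvg_normcP; apply: cvg_trans h; apply: near_eq_cvg; apply: nearW => K.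
    by rewrite HE; congr normc; ring.
  by rewrite /G (climsupE Pl).
exists G; split => //.
  move=> xi m; have Pp k : P k (xi + map_mx intr m) = P k xi by exact: trig_poly_periodic.
  rewrite /G /climsup.
  by congr (fine (limn_esup _) +i* fine (limn_esup _)); apply/funext => k;
    rewrite Pp.
have GA i B : {subset A i <= B} ->
    (\int[mu]_(t in Q) (normc (G (point t) - trig_poly B g (point t)) ^+ 2)%:E
     <= (2 * e i)%:E)%E.
  move=> AB.
  have mD k : measurable_fun Q (fun t => (normc (P (k + i)%N (point t) - trig_poly B g (point t)) ^+ 2)%:E).
    apply/measurable_EFinP; apply: (measurable_normc_sqr (F := fun xi => P (k + i)%N xi - trig_poly B g xi)).
    by apply: cmeasurableB => //; exact: cmeasurable_trig_poly.
  have D0 k t : Q t -> (0 <= (normc (P (k + i)%N (point t) - trig_poly B g (point t)) ^+ 2)%:E)%E.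
    by move=> _; rewrite lee_fin sqr_ge0.
  have mDG : measurable_fun Q (fun t => (normc (G (point t) - trig_poly B g (point t)) ^+ 2)%:E).
    apply/measurable_EFinP; apply: (measurable_normc_sqr (F := fun xi => G xi - trig_poly B g xi)).
    by apply: cmeasurableB => //; exact: cmeasurable_trig_poly.
  have := fatou mu mQ mD D0.
  rewrite (@ae_eq_integral _ _ _ mu Q (fun t => (normc (G (point t) - trig_poly B g (point t)) ^+ 2)%:E)
    (fun t => limn_einf (fun k => (normc (P (k + i)%N (point t) - trig_poly B g (point t)) ^+ 2)%:E)))//.
  - move=> h; apply: le_trans h _; apply: limn_einf_le => k.
    apply: le_trans (trig_polyB_norm AB (hA i) (hA (k + i)%N)) _.
    by rewrite lee_fin; have := eS _ _ (leq_addl k i); lra.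
  - set f := fun k t => (normc (P (k + i)%N (point t) - trig_poly B g (point t)) ^+ 2)%:E.
    rewrite (_ : (fun t => _) = (fun t => - limn_esup (fun k => - f k t))%E).
      apply: measurableT_comp => //; apply: measurable_fun_limn_esup => k.
      by apply: (@measurableT_comp _ _ _ _ _ _ (@oppe R) _ (f k)); [exact: measurable_realfun.oppe_measurable|exact: mD].
    apply/funext => t; rewrite -limn_einfN; congr limn_einf.
    by apply/funext => k; rewrite [RHS]oppeK.
  - move: cvgG; rewrite /ae_cube; apply: filterS => t + Qt => /(_ Qt) /cvg_normcP h.
    apply: (cvg_limn_einf_sup _).1.
    apply: cvg_EFin; first exact: nearW.
    have h' : normc (P (k + i)%N (point t) - trig_poly B g (point t)) @[k --> \oo] --> normc (G (point t) - trig_poly B g (point t)).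
      apply/subr_cvg0/norm_cvg0P.
      apply: (@squeeze_cvgr _ _ _ _ (fun=> 0) (fun k => normc (P (k + i)%N (point t) - G (point t)))).
      + apply: nearW => k; rewrite normr_ge0/=.
        have tri (a b : R[i]) : normc a - normc b <= normc (a - b).
          by rewrite lerBlDr; apply: le_trans (le_normcD _ _); rewrite subrK.
        rewrite ler_norml lerNl opprB; apply/andP; split.
          apply: le_trans (tri _ _) _; rewrite normcB le_eqVlt; apply/orP; left.
          by apply/eqP; congr normc; ring.
        apply: le_trans (tri _ _) _; rewrite le_eqVlt; apply/orP; left.
        by apply/eqP; congr normc; ring.
      + exact: cvg_cst.
      + by rewrite -(cvg_shiftn i) in h.
    exact: (cvgM h' h').
have FF := @totally_proper Zn.
apply/fine_cvgP; split.
  apply: filterS (totally_superset (A 0%N)) => B AB.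
  by apply/fin_numPlt; rewrite (le_lt_trans (GA _ _ AB)) ?ltry// (lt_le_trans _ (integral_ge0 _ _))// => t _; rewrite lee_fin sqr_ge0.
apply/cvgr0Pnorm_le => d d0.
have [i ide] : exists i, 2 * e i <= d.
  have := @cvg_geometric R 2 4^-1 _.
  rewrite gtr0_norm ?invr_gt0// invf_lt1// ltr1n => /(_ isT) /cvgr0Pnorm_le /(_ _ d0).
  move=> [i _ /(_ i (leqnn i))] /= h; exists i; apply: le_trans h.
  rewrite ger0_norm ?mulr_ge0 ?exprn_ge0 ?invr_ge0//.
  by rewrite /e -exprM mulnC exprM (_ : 2^-1 ^+ 2 = 4^-1 :> R)//; lra.
apply: filterS (totally_superset (A i)) => B AB /=.
have I0 : (0 <= \int[mu]_(t in Q) (normc (G (point t) - trig_poly B g (point t)) ^+ 2)%:E)%E.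
  by apply: integral_ge0 => t _; rewrite lee_fin sqr_ge0.
rewrite ger0_norm; last exact: fine_ge0.
apply: le_trans ide; have := GA _ _ AB; move: I0; rewrite -/(trig_poly B g _).
by case: (integral _ _ _).
Qed.

(** An entry is at most B, so its square is at most B^(2 - s) times its
    power of exponent s. *)
Lemma lp_norm_sums_le_sqr (s B : R) g : 1 <= s -> s <= 2 -> 0 <= B ->
  (lp_norm s%:E g <= B%:E)%E -> sums_le (fun m => normc (g m) ^+ 2) (B ^+ 2).
Proof.
move=> s1 s2 B0 gB; have s0 : 0 < s by rewrite (lt_le_trans ltr01).
have [B0'|/eqP Bn0] := eqVneq B 0.
  rewrite B0' in gB *; rewrite (lp_norm0P s0 gB) => A.
  by rewrite big1 ?expr0n// => m _; rewrite normc0 expr0n.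
have B2 : B ^+ 2 = B `^ (2 - s) * B `^ s.
  rewrite -powRD; last by apply/implyP => _; exact/eqP.
  by rewrite subrK powR_mulrn.
rewrite B2; apply: (le_sums_le (w' := fun m => B `^ (2 - s) * normc (g m) `^ s)); last first.
  by apply: sums_leZ; [exact: powR_ge0|exact/lp_norm_leP].
move=> m; have [->|g0] := eqVneq (normc (g m)) 0.
  by rewrite expr0n/= mulr_ge0 ?powR_ge0.
rewrite -powR_mulrn ?normc_ge0// -{1}(subrK s 2) powRD ?g0 ?implybT//.
rewrite ler_wpM2r ?powR_ge0// ge0_ler_powR ?nnegrE ?normc_ge0 ?subr_ge0//.
exact: lp_norm_coord gB.
Qed.

End riesz_fischer.

(** * Absolutely convergent Fourier series *)

Section absolutely_convergent_fourier_series.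
Context {R : realType} {n : nat}.
Notation mR := (measurableTypeR R).
Notation mu := (@cube_measure R n).
Notation Q := (@cube R n).
Notation Zn := 'rV[int]_n.
Notation Rn := 'rV[R]_n.
Let mQ : measurable Q. Proof. exact: measurable_cube. Qed.
Implicit Types (A B : {fset Zn}) (f : Zn -> R[i]) (sigma : Rn -> R[i]).

Lemma abs_sums_le_bounded_mul f (F C : R) (u : Zn -> R[i]) : 0 <= C ->
  (forall m, normc (u m) <= C) -> abs_sums_le f F ->
  abs_sums_le (fun m => u m * f m) (C * F).
Proof.
move=> C0 uC fF; apply: le_sums_le (sums_leZ C0 fF) => m.
by rewrite normcM ler_wpM2r// normc_ge0.
Qed.

(** Finite sets which exhaust an absolutely summable family at a definite rate
    replace the net of finite sets by a sequence, to which the theorems on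
    measurability and dominated convergence apply. *)
Lemma exhausting_sequence f (F : R) : abs_sums_le f F ->
  exists A : nat -> {fset Zn}, forall N,
    sums_le (fun m => if m \in A N then 0 else normc (f m)) N.+1%:R^-1.
Proof.
move=> fF; have f0 m : 0 <= normc (f m) by exact: normc_ge0.
have N0 N : 0 < N.+1%:R^-1 :> R by rewrite invr_gt0.
by have /choice[A AE] := fun N => sums_le_tail f0 fF (N0 N); exists A.
Qed.

Lemma cvg_harmonic_bound (u : nat -> R) (C : R) : 0 <= C ->
  (forall N, 0 <= u N <= C * N.+1%:R^-1) -> u N @[N --> \oo] --> 0.
Proof.
move=> C0 uC; apply: (@squeeze_cvgr _ _ _ _ (fun=> 0) (fun N => C * N.+1%:R^-1)).
- exact: nearW.
- exact: cvg_cst.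
- rewrite -[X in _ --> X](mulr0 C); apply: cvgMr; exact: (@cvg_harmonic R).
Qed.

Section exhausted.
Context f (F : R) (fF : abs_sums_le f F) (A : nat -> {fset Zn}).
Hypothesis tailA : forall N,
  sums_le (fun m => if m \in A N then 0 else normc (f m)) N.+1%:R^-1.

Lemma abs_sums_le_dft xi : abs_sums_le (fun m => character m xi * f m) F.
Proof.
by rewrite -[F]mul1r; apply: abs_sums_le_bounded_mul => // m; rewrite normc_character.
Qed.

Lemma trig_poly_dft xi : ccvg (fun N => trig_poly (A N) f xi) (dft f xi).
Proof.
apply/cvg_normcP; apply: (@cvg_harmonic_bound _ 1) => // N.
rewrite normc_ge0 mul1r normcB; apply: (csum_tail_le (abs_sums_le_dft xi)).
by apply: le_sums_le (tailA N) => m; case: ifP => // _; rewrite normcM normc_character mul1r.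
Qed.

Lemma cint_trig_poly_dft sigma : cintegrable sigma ->
  cintegrable (fun xi => sigma xi * dft f xi) /\
  ccvg (fun N => cint (fun xi => sigma xi * trig_poly (A N) f xi))
    (cint (fun xi => sigma xi * dft f xi)).
Proof.
move=> isg; have msg := cintegrable_cmeasurable isg.
have mdft : cmeasurable (dft f).
  rewrite (_ : dft f = climsup (fun N => trig_poly (A N) f)).
    by apply: cmeasurable_climsup => N; exact: cmeasurable_trig_poly.
  by apply/funext => xi; rewrite (climsupE (@trig_poly_dft xi)).
apply: (cint_dominated (g := fun t => F * normc (sigma (point t)))).
- by move=> N; apply: cmeasurableM => //; exact: cmeasurable_trig_poly.
- exact: cmeasurableM.
- rewrite /ae_cube; apply: nearW => t _; have /cvg_normcP h := @trig_poly_dft (point t).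
  apply/cvg_normcP; rewrite -(mulr0 (normc (sigma (point t)))).
  under eq_fun do rewrite -mulrBr normcM.
  exact: cvgMr.
- exact: (integrableZl mQ _ (cintegrable_normc isg)).
- apply: nearW => t N _; rewrite normcM mulrC ler_wpM2r ?normc_ge0//.
  by apply: le_trans (trig_poly_bound _ _ _) (fF _).
Qed.

End exhausted.

Lemma cmeasurable_dft f (F : R) : abs_sums_le f F -> cmeasurable (dft f).
Proof.
move=> fF; have [A tailA] := exhausting_sequence fF.
have [i1 _] := cint_trig_poly_dft fF tailA (cintegrable_character 0).
move/cintegrable_cmeasurable: i1; congr cmeasurable.
by apply/funext => xi; rewrite character0 mul1r.
Qed.

Lemma normc_dft_le f (F : R) xi : abs_sums_le f F -> normc (dft f xi) <= F.
Proof. by move=> fF; apply: normc_csum_le (abs_sums_le_dft fF xi). Qed.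

(** An expansion of the Fourier coefficients of sigma can be integrated against
    an absolutely convergent Fourier series: the truncation of f to finite sets
    converges uniformly in the number of terms of the expansion, so the two
    limits can be exchanged. *)
Lemma coefficient_expansion_l1 sigma f (F C : R) (c : nat -> R[i])
    (g : nat -> Zn -> R[i]) (b : nat -> R) : cintegrable sigma ->
  abs_sums_le f F ->
  (forall m, ccvg (fun K => \sum_(k < K) c k * g k m)
                  (cint (fun xi => sigma xi * character m xi))) ->
  (forall k m, normc (g k m) <= b k) ->
  (forall K, \sum_(k < K) normc (c k) * b k <= C) ->
  ccvg (fun K => \sum_(k < K) c k * csum (fun m => g k m * f m))
    (cint (fun xi => sigma xi * dft f xi)).
Proof.
move=> isg fF cg gb cb; have [A tailA] := exhausting_sequence fF.
have b0 k : 0 <= b k by apply: le_trans (gb k 0); exact: normc_ge0.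
have [_ /cvg_normcP lim1] := cint_trig_poly_dft fF tailA isg.
have C0 : 0 <= C by have := cb 0%N; rewrite big_ord0.
pose a N := cint (fun xi => sigma xi * trig_poly (A N) f xi).
have lim2 N : ccvg (fun K => \sum_(k < K) c k * \sum_(m <- A N) g k m * f m) (a N).
  have -> : a N = \sum_(m <- A N) cint (fun xi => sigma xi * character m xi) * f m.
    transitivity (cint (fun xi => \sum_(m <- A N) f m * (sigma xi * character m xi))).
      congr cint; apply/funext => xi; rewrite mulr_sumr; apply: eq_bigr => m _.
      by ring.
    rewrite cint_sum; last by move=> m; apply: cintegrableZ; exact: cintegrable_mul_character.
    by apply: eq_bigr => m _; rewrite cintZ 1?mulrC//; exact: cintegrable_mul_character.
  rewrite (_ : (fun K => _) = (fun K => \sum_(m <- A N) (\sum_(k < K) c k * g k m) * f m)).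
    have H m : ccvg (fun K => (\sum_(k < K) c k * g k m) * f m)
        (cint (fun xi => sigma xi * character m xi) * f m).
      have /cvg_normcP h := cg m; apply/cvg_normcP; rewrite -(mul0r (normc (f m))).
      under eq_fun do rewrite -mulrBl normcM.
      exact: cvgMl.
    apply/cvg_ReImP; rewrite Re_sum Im_sum; split.
      under eq_fun do rewrite Re_sum.
      by apply: cvg_sumr => m; have /cvg_ReImP[] := H m.
    under eq_fun do rewrite Im_sum.
    by apply: cvg_sumr => m; have /cvg_ReImP[] := H m.
  apply/funext => K; under eq_bigr do rewrite mulr_sumr.
  rewrite exchange_big/=; apply: eq_bigr => m _; rewrite mulr_suml.
  by apply: eq_bigr => k _; rewrite mulrA.
have unif N K : normc ((\sum_(k < K) c k * csum (fun m => g k m * f m)) -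
    \sum_(k < K) c k * \sum_(m <- A N) g k m * f m) <= C * N.+1%:R^-1.
  rewrite -sumrB; apply: le_trans (ler_normc_sum _ _ _) _.
  apply: (@le_trans _ _ (\sum_(k < K) (normc (c k) * b k) * N.+1%:R^-1)).
    apply: ler_sum => k _; rewrite -mulrBr normcM -mulrA ler_wpM2l ?normc_ge0//.
    apply: (csum_tail_le (abs_sums_le_bounded_mul (b0 k) (gb k) fF)).
    apply: le_sums_le (sums_leZ (b0 k) (tailA N)) => m; case: ifP => _.
      by rewrite mulr0.
    by rewrite normcM ler_wpM2r ?normc_ge0.
  by rewrite -mulr_suml ler_wpM2r ?invr_ge0.
apply/cvg_normcP/cvgr0Pnorm_le => e e0; have e3 : 0 < e / 3 by rewrite divr_gt0.
have [N [h1 h2]] : exists N, C * N.+1%:R^-1 <= e / 3 /\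
    normc (a N - cint (fun xi => sigma xi * dft f xi)) <= e / 3.
  have h : (C * N.+1%:R^-1) @[N --> \oo] --> (0 : R).
    by rewrite -[X in _ --> X](mulr0 C); apply: cvgMr; exact: (@cvg_harmonic R).
  move/cvgr0Pnorm_le : h => /(_ _ e3) h; move/cvgr0Pnorm_le : lim1 => /(_ _ e3) h'.
  have [N [hN hN']] := filter_ex (filterI h h'); exists N; split.
    by apply: le_trans hN; exact: ler_norm.
  by move: hN'; rewrite ger0_norm ?normc_ge0.
have /cvg_normcP/cvgr0Pnorm_le/(_ _ e3) := lim2 N.
apply: filterS => K; rewrite !ger0_norm ?normc_ge0// => h3.
set x := (X in normc (X - _)); set z := cint _ in h2 *.
set y := (X in normc (X - a N)) in h3.
have -> : x - z = (x - y) + ((y - a N) + (a N - z)) by ring.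
have hu : normc (x - y) <= e / 3 by apply: le_trans (unif N K) h1.
apply: le_trans (le_normcD _ _) _.
have := le_normcD (y - a N) (a N - z); lra.
Qed.

(** This is [coefficient_expansion_l1] for a single term, the unit sequence
    at m. *)
Lemma dft_coefficient f (F : R) m : abs_sums_le f F ->
  cint (fun xi => dft f xi * character (- m) xi) = f m.
Proof.
move=> fF.
have := @coefficient_expansion_l1 (character (- m)) f F 1 (fun k => (k == 0%N)%:R)
  (fun k => unit_seq m) (fun=> 1) (cintegrable_character (- m)) fF.
set u := (X in _ -> _ -> _ -> ccvg X _) => /(_ _ _ _)h.
have ul : ccvg u (f m).
  apply: cvg_near_cst; exists 1%N => // -[//|K] _.
  rewrite /u big_ord_recl/= mul1r big1 ?addr0; last by move=> i _; rewrite mul0r.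
  rewrite (csum_finite_support (A := [fset m]%fset)); last first.
    by move=> k; rewrite !inE => km; rewrite /unit_seq (negbTE km) mul0r.
  by rewrite big_seq_fset1 /unit_seq eqxx mul1r.
apply: (ccvg_unique _ ul); under [X in cint X]eq_fun do rewrite mulrC.
apply: h.
- move=> k; apply: cvg_near_cst; exists 1%N => // -[//|K] _.
  rewrite big_ord_recl/= mul1r big1 ?addr0; last by move=> i _; rewrite mul0r.
  under [X in cint X]eq_fun do rewrite -characterD.
  by rewrite cint_character /unit_seq addrC subr_eq0.
- move=> _ k; rewrite /unit_seq; case: (k == m).
    by rewrite (_ : true%:R = 1) ?normc1.
  by rewrite (_ : false%:R = 0) ?normc0.
- case=> [|K]; first by rewrite big_ord0.
  rewrite big_ord_recl big1 ?addr0 ?mulr1.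
    by rewrite (_ : (_ == _)%:R = 1 :> R[i]) ?normc1.
  by move=> i _; rewrite (_ : (_ == _)%:R = 0 :> R[i]) ?normc0 ?mul0r.
Qed.

End absolutely_convergent_fourier_series.

(** * Continuous functions and finite differences *)

Section continuous_functions.
Context {R : realType} {n : nat}.
Notation mR := (measurableTypeR R).
Notation Zn := 'rV[int]_n.
Notation Rn := 'rV[R]_n.
Implicit Types (F : Rn -> R).

(** Rounding the coordinates makes F a function of countably many values. *)
Lemma measurable_continuous F : continuous F ->
  measurable_fun setT (fun t : n.-tuple mR => F (point t)).
Proof.
move=> cF.
pose q (k : nat) (t : n.-tuple mR) : Zn := \row_i Num.floor (k.+1%:R * (tnth t i : R)).
pose G (k : nat) (z : Zn) : R := F (\row_i ((z 0 i)%:~R / k.+1%:R)).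
have k0 (k : nat) : 0 < k.+1%:R :> R by [].
apply: (@measurable_fun_cvg _ _ _ setT (fun k t => G k (q k t))).
- move=> k _ Y mY; rewrite setTI.
  have -> : (fun t => G k (q k t)) @^-1` Y =
      \bigcup_(z : Zn) (if z \in G k @^-1` Y then [set t | q k t = z] else set0).
    apply/seteqP; split=> [t Yt|t [z _]].
      by exists (q k t) => //; rewrite mem_set.
    by case: ifPn => // /set_mem Yz /= qz; rewrite /preimage/= qz.
  apply: countable_bigcupT_measurable; first exact: countableP.
  move=> z; case: ifP => // _.
  have -> : [set t | q k t = z] = [set t : n.-tuple mR | forall i,
      `[(z 0 i)%:~R / k.+1%:R, (z 0 i + 1)%:~R / k.+1%:R[%classic (tnth t i)].
    apply/seteqP; split=> [t /= <- i|t tz].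
      rewrite in_itv/= mxE ler_pdivrMr// ltr_pdivlMr// mulrC.
      by rewrite floor_itv ?num_real.
    apply/rowP => i; rewrite mxE; apply: floor_def.
    by have := tz i; rewrite /= in_itv/= ler_pdivrMr// ltr_pdivlMr// mulrC.
  by apply: (measurable_box (A := fun i => `[(z 0 i)%:~R / k.+1%:R, (z 0 i + 1)%:~R / k.+1%:R[%classic)) => i.
- move=> t _; rewrite /G.
  suff h : (\row_i ((q k t 0 i)%:~R / k.+1%:R) : Rn) @[k --> \oo] --> point t.
    exact: (cvg_comp _ _ h (cF (point t))).
  apply/cvg_ballP => e e0.
  have := @cvg_harmonic R => /cvgr0Pnorm_lt/(_ _ e0); apply: filterS => k.
  rewrite /= ger0_norm ?invr_ge0// => ke; split => // i j; rewrite !mxE /ball/=.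
  have /andP[h1 h2] : (Num.floor (k.+1%:R * (tnth t j : R)))%:~R <= k.+1%:R * (tnth t j : R) <
      (Num.floor (k.+1%:R * (tnth t j : R)) + 1)%:~R by rewrite floor_itv ?num_real.
  apply: le_lt_trans ke.
  set u := k.+1%:R * (tnth t j : R) in h1 h2 *; set z := Num.floor u in h1 h2 *.
  have -> : (tnth t j : R) - z%:~R / k.+1%:R = (u - z%:~R) / k.+1%:R.
    by rewrite mulrBl /u mulrAC divff ?mul1r// gt_eqF.
  rewrite ger0_norm ?divr_ge0 ?subr_ge0// -[leRHS]mul1r ler_wpM2r ?invr_ge0//.
  by rewrite lerBlDl ltW//; move: h2; rewrite intrD.
Qed.

Lemma continuous_periodic_bounded F : continuous F -> rperiodic F ->
  exists2 M, 0 <= M & forall x, `|F x| <= M.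
Proof.
move=> cF pF.
have cQ : compact [set v : Rn | forall i : 'I_n, `[0 : R, 1 : R]%classic (v ord0 i)].
  by apply: (@rV_compact R n (fun=> `[0 : R, 1 : R]%classic)) => i; exact: segment_compact.
have := continuous_compact (continuous_subspaceT cF) cQ.
move=> /compact_bounded[M [Mreal hM]].
exists (`|M| + 1) => [|x]; first by rewrite addr_ge0.
pose m : Zn := \row_i (- Num.floor (x 0 i)).
rewrite -(pF x m); apply: (hM (`|M| + 1)).
  by rewrite ltr_pwDr// ler_norm.
exists (x + map_mx intr m) => // i /=; rewrite !mxE in_itv/=.
have /andP[h1 h2] : (Num.floor (x 0 i))%:~R <= x 0 i < (Num.floor (x 0 i) + 1)%:~R.
  by rewrite floor_itv ?num_real.
by rewrite rmorphN/= subr_ge0 h1/= lerBlDl addrC ltW//; move: h2; rewrite intrD addrC.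
Qed.

End continuous_functions.

Section finite_differences.
Context {R : realType} {n : nat}.
Notation Rn := 'rV[R]_n.
Notation Zn := 'rV[int]_n.
Implicit Types (F H : Rn -> R) (v w x : Rn).

(** Reduces directional derivatives to derivatives in one variable. *)
Lemma is_derive_line F x v (s d : R) :
  is_derive (s *: v + x) v F d <-> is_derive s 1 (fun h => F (h *: v + x)) d.
Proof.
have e : (fun h : R => h^-1 *: ((F \o shift (s *: v + x)) (h *: v) - F (s *: v + x))) =
    (fun h : R => h^-1 *: (((fun h => F (h *: v + x)) \o shift s) (h *: (1 : R)) - F (s *: v + x))).
  by apply/funext => h; congr (_ *: (F _ - _)); rewrite /= addrA -scalerDl [h%:A]mulr1.
split=> -[].
  by rewrite /derivable /derive e => h1 h2; split.
by rewrite /derivable /derive -e => h1 h2; split.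
Qed.

Lemma derive_translate F v w x :
  'D_v (fun x => F (x + w)) x = 'D_v F (x + w) /\
  (derivable F (x + w) v -> derivable (fun x => F (x + w)) x v).
Proof.
have e : (fun h : R => h^-1 *: (((fun x => F (x + w)) \o shift x) (h *: v) - F (x + w))) =
    (fun h : R => h^-1 *: ((F \o shift (x + w)) (h *: v) - F (x + w))).
  by apply/funext => h /=; rewrite addrA.
by rewrite /derivable /derive e.
Qed.

Lemma derive_rperiodic F v : rperiodic F -> rperiodic ('D_v F).
Proof.
move=> pF x m; rewrite -(derive_translate F v _ x).1.
by rewrite (_ : (fun x => F (x + _)) = F)//; apply/funext => y; exact: pF.
Qed.

Lemma continuous_translate F (v : Rn) : continuous F ->
  continuous (fun x : Rn => F (x + v)).
Proof.
move=> cF x; have c1 : {for x, continuous (fun x : Rn => x + v)}.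
  by apply: (@cvgD _ _ _ (nbhs x)); [exact: cvg_id|exact: cvg_cst].
have c2 := @continuous_comp _ _ _ (fun x : Rn => x + v) F x c1 (cF _).
exact: c2.
Qed.

Definition difference w F x := F (x + w) - F x.

Lemma foldr_derive_difference w F (vs : seq Rn) : smooth F ->
  foldr (fun v h => 'D_v h) (difference w F) vs =
  difference w (foldr (fun v h => 'D_v h) F vs).
Proof.
move=> sF; elim: vs => //= v vs ->.
apply/funext => x; rewrite /difference.
have dH y : derivable (foldr (fun v h => 'D_v h) F vs) y v by exact: (sF vs).2.
have [e d] := derive_translate (foldr (fun v h => 'D_v h) F vs) v w x.
by rewrite deriveB ?e//; exact: d.
Qed.

Lemma smooth_difference w F : smooth F -> smooth (difference w F).
Proof.
move=> sF vs; rewrite /= foldr_derive_difference//.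
have [cH dH] := sF vs; set H := foldr _ _ _ in cH dH *; split.
  move=> x; have c2 := @continuous_translate H w cH x.
  exact: (continuousB c2 (cH x)).
move=> x v; apply: derivableB; last exact: dH.
exact: (derive_translate H v w x).2.
Qed.

Lemma normr_difference_le F v (s M : R) : (forall x, derivable F x v) -> 0 <= s ->
  (forall x, `|'D_v F x| <= M) -> forall x, `|difference (s *: v) F x| <= s * M.
Proof.
move=> dF s0 FM x.
pose f h := F (h *: v + x); pose df h := 'D_v F (h *: v + x).
have fE (h : R) : is_derive h 1 f (df h) by apply/is_derive_line; exact: DeriveDef.
have [c _ e] : exists2 c, c \in `[0, s] & f s - f 0 = df c * (s - 0).
  apply: (MVT_segment s0) => //; apply: derivable_within_continuous => h _.
  exact: ex_derive.
have -> : difference (s *: v) F x = df c * s.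
  have -> : df c * s = f s - f 0 by rewrite e subr0.
  by rewrite /difference /f scale0r add0r [x + _]addrC.
by rewrite normrM (ger0_norm s0) mulrC; apply: ler_wpM2l => //; exact: FM.
Qed.

End finite_differences.

(** * Decay of the Fourier coefficients of smooth functions *)

Section inverse_square_weights.
Context {R : realType} {n : nat}.
Notation Zn := 'rV[int]_n.

Lemma ler_sum_uniq_sub (T : eqType) (s s' : seq T) (w : T -> R) :
  (forall x, 0 <= w x) -> uniq s -> uniq s' -> {subset s <= s'} ->
  \sum_(x <- s) w x <= \sum_(x <- s') w x.
Proof.
move=> w0 us us' ss'; rewrite (perm_big [seq x <- s' | x \in s])/=.
  by rewrite big_filter [leRHS](bigID (mem s))/= lerDl sumr_ge0.
apply: uniq_perm; rewrite ?filter_uniq// => x.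
by rewrite mem_filter andb_idr//; exact: ss'.
Qed.

(** A telescoping replacement for the inverse square. *)
Definition weight (z : int) : R := 2 / (`|z|.+1%:R * `|z|.+2%:R).

Lemma weight_ge0 z : 0 <= weight z.
Proof. by rewrite divr_ge0// mulr_ge0. Qed.

Lemma sums_le_weight : sums_le weight 4.
Proof.
have S N : \sum_(k < N) weight k = 2 * (1 - N.+1%:R^-1).
  elim: N => [|N IH]; first by rewrite big_ord0 invr1 subrr mulr0.
  rewrite big_ord_recr/= IH /weight absz_nat.
  have : N.+1%:R != 0 :> R by [].
  rewrite -[N.+2%:R]natr1; set x : R := N.+1%:R => x0; field.
  by rewrite nat1r natr1 !pnatr_eq0.
have S2 N : \sum_(k < N) weight k <= 2.
  by rewrite S -subr_ge0 mulrBr mulr1 opprB addrC subrK mulr_ge0.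
move=> B; have [N BN] : exists N, forall z, z \in B -> (`|z| < N)%N.
  exists (\max_(z <- B) `|z|).+1 => z zB.
  by rewrite ltnS; exact: (leq_bigmax_seq (F := absz) z).
pose s := map Posz (iota 0 N) ++ map Negz (iota 0 N).
apply: (@le_trans _ _ (\sum_(z <- s) weight z)).
  apply: ler_sum_uniq_sub; [exact: weight_ge0|exact: fset_uniq|..].
  - rewrite cat_uniq !map_inj_uniq ?iota_uniq/= ?andbT//; [|by move=> ? ? []..].
    by apply/hasPn => _ /mapP[k _ ->]; apply/negP => /mapP[].
  - move=> z zB; have zN := BN _ zB.
    rewrite mem_cat; case: z zN {zB} => k kN.
      by rewrite map_f// mem_iota.
    by rewrite orbC map_f// mem_iota/= add0n ltnW.
rewrite big_cat !big_map/= (_ : iota 0 N = index_iota 0 N); last by rewrite /index_iota subn0.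
rewrite !big_mkord.
rewrite (_ : 4 = 2 + 2 :> R); last by ring.
apply: lerD; first exact: S2.
apply: le_trans (S2 N.+1); rewrite big_ord_recl/= -[leLHS]add0r lerD ?weight_ge0//.
Qed.

(** A finite set of frequencies is contained in a box, and over a box the
    sum of the products is the product of the sums. *)
Lemma sums_le_weight_prod :
  sums_le (fun m : Zn => \prod_(i < n) weight (m 0 i)) (4 ^+ n).
Proof.
have w0 (m : Zn) : 0 <= \prod_(i < n) weight (m 0 i).
  by apply: prodr_ge0 => i _; exact: weight_ge0.
move=> A; pose B := [fset x | x in flatten [seq [seq (m : Zn) 0 i | i <- enum 'I_n] | m <- A]]%fset.
pose g (f : {ffun 'I_n -> B}) : Zn := \row_i val (f i).
have gI : injective g.
  by move=> f f' /rowP gf; apply/ffunP => i; apply: val_inj; have := gf i; rewrite !mxE.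
apply: (@le_trans _ _ (\sum_(m <- [seq g f | f <- enum {: {ffun 'I_n -> B}}])
    \prod_(i < n) weight (m 0 i))).
  apply: ler_sum_uniq_sub => //; first by rewrite map_inj_uniq ?enum_uniq.
  move=> m mA; have mB i : m 0 i \in B.
    rewrite inE/=; apply/flattenP; exists [seq m 0 i | i <- enum 'I_n].
      by apply/mapP; exists m.
    by rewrite map_f// mem_enum.
  apply/mapP; exists [ffun i => [` mB i]%fset]; first by rewrite mem_enum.
  by apply/rowP => i; rewrite !mxE ffunE.
rewrite big_map big_enum/=.
under eq_bigr do under eq_bigr do rewrite mxE.
rewrite -(bigA_distr_bigA (fun (i : 'I_n) (z : B) => weight (val z))).
rewrite (eq_bigr (fun=> \sum_(z <- B) weight z)); last by move=> i _; rewrite big_seq_fsetE.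
rewrite prodr_const card_ord lerXn2r ?nnegrE//.
  by apply: sumr_ge0 => z _; exact: weight_ge0.
exact: sums_le_weight.
Qed.

End inverse_square_weights.

Section fourier_decay.
Context {R : realType} {n : nat}.
Notation mR := (measurableTypeR R).
Notation mu := (@cube_measure R n).
Notation Q := (@cube R n).
Notation Zn := 'rV[int]_n.
Notation Rn := 'rV[R]_n.
Let mQ : measurable Q. Proof. exact: measurable_cube. Qed.
Implicit Types (F : Rn -> R) (m : Zn).

Definition wave_coefficient F m theta : R :=
  \int[mu]_(t in Q) (F (point t) * wave m theta (point t)).

Lemma measurable_mul_wave F m theta : continuous F ->
  measurable_fun Q (fun t => F (point t) * wave m theta (point t)).
Proof.
move=> cF; apply: measurable_funTS; apply: measurable_funM.
  exact: measurable_continuous.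
exact: measurable_wave.
Qed.

Lemma integrable_mul_wave F m theta : continuous F -> rperiodic F ->
  mu.-integrable Q (EFin \o (fun t => F (point t) * wave m theta (point t))).
Proof.
move=> cF pF; have [M M0 FM] := continuous_periodic_bounded cF pF.
apply: (cube_integrable_bounded (C := M)); first exact: measurable_mul_wave.
by move=> t _; rewrite normrM -[M]mulr1 ler_pM// wave_le1.
Qed.

Lemma wave_coefficient_le F m theta (M : R) : continuous F -> rperiodic F ->
  (forall x, `|F x| <= M) -> `|wave_coefficient F m theta| <= M.
Proof.
move=> cF pF FM.
apply: le_trans (le_normr_Rintegral mQ (integrable_mul_wave _ _ cF pF)) _.
rewrite -[leRHS](@Rintegral_cube_cst R n); apply: le_Rintegral => //.
- exact: (integrable_norm (integrable_mul_wave _ _ cF pF)).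
- by apply: (cube_integrable_bounded (C := `|M|)).
- by move=> t _; rewrite normrM -[M]mulr1 ler_pM// wave_le1.
Qed.

Definition half_period m (i : 'I_n) : R := (2 * `|(m 0 i)%:~R|)^-1.

(** A translation by half a period in one coordinate changes the sign of the
    wave. *)
Lemma wave_coefficient_difference F m theta i : continuous F -> rperiodic F ->
  m 0 i != 0 ->
  wave_coefficient (difference (half_period m i *: delta_mx 0 i) F) m theta =
  - 2 * wave_coefficient F m theta.
Proof.
move=> cF pF mi0; set v := _ *: _.
have a0 : 0 < `|(m 0 i)%:~R : R| by rewrite normr_gt0 intr_eq0.
have waveN x : wave m theta (x + v) = - wave m theta x.
  rewrite wave_shift dotpZr dotp_delta /half_period /wave.
  have [mp|mn] := ltP 0 ((m 0 i)%:~R : R).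
    rewrite gtr0_norm// (_ : _ + _ = 2 * pi * dotp m x + theta + pi) ?cosDpi//.
    by field; rewrite gt_eqF.
  rewrite ler0_norm// (_ : _ + _ = 2 * pi * dotp m x + theta - pi).
    by rewrite cosB cospi sinpi mulr0 addr0 mulrN1.
  by field; rewrite intr_eq0.
have pFw : rperiodic (fun x => F x * wave m theta x).
  by move=> x k; rewrite pF wave_periodic.
have v01 j : 0 <= v 0 j <= 1.
  rewrite !mxE eqxx/=; case: eqP => _; rewrite ?mulr0 ?lexx ?ler01// mulr1.
  rewrite invr_ge0 mulr_ge0//= invf_le1 ?mulr_gt0//.
  have : 1 <= `|(m 0 i)%:~R : R|.
    by rewrite -intr_norm (ler_int _ 1) -gtz0_ge1 normr_gt0.
  lra.
have cT : continuous (fun x : Rn => F (x + v)) by exact: continuous_translate.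
have pT : rperiodic (fun x : Rn => F (x + v)).
  by move=> x k; rewrite addrAC pF.
have iT := integrable_mul_wave m theta cT pT.
have := integral_cube_shift pFw (measurable_mul_wave m theta cF) v01.
rewrite -/(wave_coefficient F m theta).
under eq_Rintegral do rewrite waveN mulrN -mulN1r.
rewrite RintegralZl// /wave_coefficient => e.
under eq_Rintegral do rewrite mulrBl.
by rewrite RintegralB//; [rewrite -e; ring|exact: integrable_mul_wave].
Qed.

Lemma difference_rperiodic F (v : Rn) : rperiodic F -> rperiodic (difference v F).
Proof. by move=> pF x k; rewrite /difference pF addrAC pF. Qed.

(** The difference of [wave_coefficient_difference] is at most half a period
    times a derivative, so every derivative in the list gains one factor of
    its frequency. *)
Lemma wave_coefficient_derivatives_le (L : seq 'I_n) F m theta (M : R) :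
  smooth F -> rperiodic F -> {in L, forall i, m 0 i != 0} ->
  (forall x, `|foldr (fun v h => 'D_v h) F [seq delta_mx 0 i | i <- L] x| <= M) ->
  `|wave_coefficient F m theta| <= (\prod_(i <- L) (half_period m i / 2)) * M.
Proof.
elim: L F M => [|i L IH] F M sF pF mL FM.
  by rewrite big_nil mul1r; apply: wave_coefficient_le => //; exact: (sF [::]).1.
have mi0 : m 0 i != 0 by apply: mL; rewrite mem_head.
have h0 : 0 <= half_period m i by rewrite invr_ge0 mulr_ge0.
have cF : continuous F := (sF [::]).1.
have := wave_coefficient_difference theta cF pF mi0; set v := _ *: _ => oE.
have -> : `|wave_coefficient F m theta| = `|wave_coefficient (difference v F) m theta| / 2.
  by rewrite oE normrM normrN normr_nat mulrC mulKf.
rewrite big_cons (_ : _ * _ * M =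
  (\prod_(j <- L) (half_period m j / 2)) * (half_period m i * M) / 2); last by ring.
rewrite ler_pM2r ?invr_gt0//; apply: IH.
- exact: smooth_difference.
- exact: difference_rperiodic.
- by move=> k kL; apply: mL; rewrite inE kL orbT.
- move=> x; rewrite foldr_derive_difference//; apply: normr_difference_le => //.
  by move=> y; exact: (sF _).2.
Qed.

Lemma half_period_weight m i : m 0 i != 0 ->
  (half_period m i / 2) * (half_period m i / 2) <= weight (m 0 i).
Proof.
move=> mi0; rewrite /half_period /weight.
have -> : `|(m 0 i)%:~R| = `|m 0 i|%:R :> R by rewrite -intr_norm -abszE.
have : (0 < `|m 0%R i|)%N by rewrite absz_gt0.
case: `|m 0%R i|%N => // k _.
rewrite -[k.+3%:R]natr1 -[k.+2%:R]natr1.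
have : 1 <= k.+1%:R :> R by rewrite ler1n.
set x : R := k.+1%:R => x1; have x0 : 0 < x by lra.
rewrite -subr_ge0 (_ : _ - _ = (32 * (x * x) - (x + 1) * (x + 1 + 1)) /
  (16 * (x * x) * ((x + 1) * (x + 1 + 1)))).
  by apply: divr_ge0; [nra|rewrite !mulr_ge0 ?addr_ge0// ltW].
by field; repeat (apply/andP; split); rewrite gt_eqF//; lra.
Qed.

(** Each coordinate in which the frequency is nonzero is listed twice, which
    gains the square of this frequency. The constant is a sum of bounds of
    derivatives over the finitely many sets of such coordinates. *)
Lemma wave_coefficient_decay F : smooth F -> rperiodic F -> exists2 C : R, 0 <= C &
  forall m theta, `|wave_coefficient F m theta| <= C * \prod_(i < n) weight (m 0 i).
Proof.
move=> sF pF.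
pose L (S : {set 'I_n}) := enum S ++ enum S.
pose D (S : {set 'I_n}) := foldr (fun v h => 'D_v h) F [seq delta_mx 0 i | i <- L S].
have pD (vs : seq Rn) : rperiodic (foldr (fun v h => 'D_v h) F vs).
  by elim: vs => //= v vs; exact: derive_rperiodic.
have /choice[M hM] (S : {set 'I_n}) : exists M : R, 0 <= M /\ forall x, `|D S x| <= M.
  by have [M M0 DM] := continuous_periodic_bounded (sF _).1 (pD [seq delta_mx 0 i | i <- L S]); exists M.
exists (\sum_S M S) => [|m theta]; first by apply: sumr_ge0 => S _; exact: (hM S).1.
pose S := [set i | m 0 i != 0]%SET.
have mS : {in L S, forall i, m 0 i != 0}.
  by move=> i; rewrite mem_cat orbb mem_enum inE.
apply: le_trans (wave_coefficient_derivatives_le theta sF pF mS (hM S).2) _.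
rewrite mulrC; apply: ler_pM.
- exact: (hM S).1.
- by apply: prodr_ge0 => i _; rewrite divr_ge0// invr_ge0 mulr_ge0.
- by rewrite (bigD1 S)//= lerDl sumr_ge0// => T _; exact: (hM T).1.
rewrite big_cat/= -big_split/= big_enum big_mkcond/=; apply: ler_prod => i _.
case: ifPn => [|]; rewrite inE.
  by move=> mi0; rewrite half_period_weight// mulr_ge0// divr_ge0// invr_ge0 mulr_ge0.
rewrite negbK => /eqP ->; rewrite ler01/= /weight absz0 mul1r divff//.
Qed.

End fourier_decay.

(** * Test functions *)

Section test_functions.
Context {R : realType} {n : nat}.
Notation mR := (measurableTypeR R).
Notation mu := (@cube_measure R n).
Notation Q := (@cube R n).
Notation Zn := 'rV[int]_n.
Notation Rn := 'rV[R]_n.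
Let mQ : measurable Q. Proof. exact: measurable_cube. Qed.
Implicit Types (psi : Rn -> R[i]) (m : Zn) (g : Zn -> R[i]).

Lemma test_function_rperiodic psi : test_function psi ->
  rperiodic (fun xi => complex.Re (psi xi)) /\
  rperiodic (fun xi => complex.Im (psi xi)).
Proof. by move=> [_ _ pp]; split=> xi m; rewrite pp. Qed.

Lemma cmeasurable_test_function psi : test_function psi -> cmeasurable psi.
Proof.
move=> [sr si _]; split; apply: measurable_funTS.
  exact: measurable_continuous (sr [::]).1.
exact: measurable_continuous (si [::]).1.
Qed.

Lemma cintegrable_test_function psi : test_function psi -> cintegrable psi.
Proof.
move=> tp; have [pr pi] := test_function_rperiodic tp.
have [mr mi] := cmeasurable_test_function tp; case: tp => sr si _.
have [M _ rM] := continuous_periodic_bounded (sr [::]).1 pr.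
have [M' _ iM] := continuous_periodic_bounded (si [::]).1 pi.
split.
  by apply: (cube_integrable_bounded (C := M) mr) => t _; exact: rM.
by apply: (cube_integrable_bounded (C := M') mi) => t _; exact: iM.
Qed.

Definition fourier_coefficient psi m := cint (fun xi => psi xi * character (- m) xi).

(** The real and the imaginary part of a coefficient are combinations of
    wave coefficients of the real and the imaginary part of the function,
    which decay by [wave_coefficient_decay]. *)
Lemma test_function_coefficients psi : test_function psi ->
  exists C, abs_sums_le (fourier_coefficient psi) C.
Proof.
move=> tp; have [pr pi] := test_function_rperiodic tp; case: (tp) => sr si _.
have [Cr Cr0 hr] := wave_coefficient_decay sr pr.
have [Ci Ci0 hi] := wave_coefficient_decay si pi.
pose w m : R := \prod_(i < n) weight (m 0 i).
exists (2 * (Cr + Ci) * 4 ^+ n).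
apply: (le_sums_le (w' := fun m => 2 * (Cr + Ci) * w m)); last first.
  by apply: sums_leZ; [rewrite mulr_ge0// addr_ge0|exact: sums_le_weight_prod].
move=> m; have wN : w (- m) = w m.
  by apply: eq_bigr => i _; rewrite mxE /weight abszN.
have cr := (sr [::]).1; have ci := (si [::]).1.
have iw theta : mu.-integrable Q (EFin \o (fun t => complex.Re (psi (point t)) * wave (- m) theta (point t))).
  exact: integrable_mul_wave cr pr.
have iw' theta : mu.-integrable Q (EFin \o (fun t => complex.Im (psi (point t)) * wave (- m) theta (point t))).
  exact: integrable_mul_wave ci pi.
have {hr}hr theta := hr (- m) theta; have {hi}hi theta := hi (- m) theta.
apply: le_trans (ler_normc_ReIm _) _; rewrite /fourier_coefficient /cint/=.
under eq_Rintegral do rewrite cReM characterE/=.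
under [in X in _ + X]eq_Rintegral do rewrite cImM characterE/=.
rewrite RintegralB// RintegralD//.
have := hr 0; have := hr (trigo.pi / 2); have := hi 0; have := hi (trigo.pi / 2).
rewrite -/(w (- m)) wN /wave_coefficient.
set a := \int[mu]_(t in Q) _; set b := \int[mu]_(t in Q) _.
set c := \int[mu]_(t in Q) _; set d := \int[mu]_(t in Q) _ => h1 h2 h3 h4.
have := ler_normB d a; have := ler_normD c b; lra.
Qed.

(** Both sides are integrable and have the same Fourier coefficients. *)
Lemma test_function_dft psi : test_function psi ->
  ae_cube (fun xi => dft (fourier_coefficient psi) xi = psi xi).
Proof.
move=> tp; have [C cC] := test_function_coefficients tp.
have ip := cintegrable_test_function tp.
have id : cintegrable (dft (fourier_coefficient psi)).
  apply: (cintegrable_bounded (C := C)); first exact: cmeasurable_dft cC.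
  by move=> t _; exact: normc_dft_le.
have iB : cintegrable (fun xi => dft (fourier_coefficient psi) xi - psi xi).
  have iN := cintegrableZ (-1) ip.
  rewrite (_ : (fun xi => _) = (fun xi => dft (fourier_coefficient psi) xi + -1 * psi xi)).
    exact: cintegrableD.
  by apply/funext => xi; rewrite mulN1r.
have := fourier_uniqueness iB; rewrite /ae_cube => h.
apply: filterS (h _) => [t + Qt|m].
  by move=> /(_ Qt)/eqP; rewrite subr_eq0 => /eqP.
under [X in cint X]eq_fun do rewrite mulrBl.
rewrite cintB; [|exact: cintegrable_mul_character..].
have := dft_coefficient (- m) cC; rewrite opprK => ->.
by rewrite /fourier_coefficient opprK subrr.
Qed.

Lemma dft_dist_reflect g psi : test_function psi ->
  dft_dist g (psi \o -%R) = csum (fun m => g m * fourier_coefficient psi m).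
Proof.
move=> tp; congr csum; apply/funext => m; congr (_ * _).
have [_ _ pp] := tp.
rewrite -[RHS]cint_reflect.
- congr cint; apply/funext => xi /=.
  by rewrite characterNr opprK mulrC.
- by move=> xi k; rewrite pp character_periodic.
- by apply: cmeasurableM; [exact: cmeasurable_test_function|exact: cmeasurable_character].
Qed.

Lemma is_derive_wave m theta (v x : Rn) :
  is_derive x v (wave m theta) (2 * pi * dotp m v * wave m (theta + pi / 2) x).
Proof.
have -> : x = 0 *: v + x by rewrite scale0r add0r.
apply/is_derive_line.
pose A := 2 * pi * dotp m x + theta; pose B := 2 * pi * dotp m v.
have GE h : (B \*: (@id R) + cst A) h = B * h + A by [].
have -> : (fun h : R => wave m theta (h *: v + x)) = @cos R \o (B \*: (@id R) + cst A).
  apply/funext => h; rewrite [RHS]/= GE /wave dotpDr dotpZr; congr cos.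
  by rewrite /A /B; ring.
have -> : 2 * pi * dotp m v * wave m (theta + pi / 2) (0 *: v + x) =
    - sin ((B \*: (@id R) + cst A) 0) * (B *: 1 + 0).
  rewrite GE scale0r add0r /wave addrA cosD cos_pihalf sin_pihalf mulr0 add0r -/A.
  rewrite (_ : B%:A + 0 = B); last by rewrite addr0; exact: mulr1.
  by rewrite mulr0 add0r /B; ring.
apply: is_derive1_comp.
Qed.

Lemma continuous_wave m theta : continuous (wave m theta : Rn -> R).
Proof.
move=> x; rewrite /wave.
apply: (@continuous_comp _ _ _ (fun xi : Rn => 2 * pi * dotp m xi + theta) (@cos R) x); last first.
  exact: continuous_cos.
apply: (@cvgD _ _ _ (nbhs x)); last exact: cvg_cst.
apply: (@cvgMr _ _ (nbhs x)); apply: cvg_sumr => i.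
by apply: (@cvgMr _ _ (nbhs x)); exact: coord_continuous.
Qed.

(** Up to a constant factor, the derivative of a wave is the wave with
    another phase. *)
Lemma smooth_wave m theta : smooth (wave m theta : Rn -> R).
Proof.
move=> vs.
have [c [theta' ->]] : exists c theta', foldr (fun v h => 'D_v h) (wave m theta : Rn -> R) vs =
    (fun x => c * wave m theta' x).
  elim: vs => [|v vs [c [theta' IH]]] /=.
    by exists 1, theta; apply/funext => x; rewrite mul1r.
  exists (c * (2 * pi * dotp m v)), (theta' + pi / 2); rewrite IH; apply/funext => x.
  have d := is_derive_wave m theta' v x.
  transitivity (c *: 'D_v (wave m theta') x); first by apply: deriveZ; case: d.
  by case: d => _ ->; exact: mulrA.
split=> [x|x v].
  by apply: (@cvgMr _ _ (nbhs x)); exact: continuous_wave.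
by apply: derivableZ; have [] := is_derive_wave m theta' v x.
Qed.

Lemma test_function_character m : test_function (character m : Rn -> R[i]).
Proof.
split; last exact: character_periodic.
  rewrite (_ : (fun xi => _) = wave m 0); first exact: smooth_wave.
  by apply/funext => xi; rewrite characterE.
rewrite (_ : (fun xi => _) = wave m (pi / 2)); first exact: smooth_wave.
by apply/funext => xi; rewrite characterE.
Qed.

Lemma dft_dist_character g m : dft_dist g (character m \o -%R) = g m.
Proof.
rewrite dft_dist_reflect; last exact: test_function_character.
have cE k : fourier_coefficient (character m) k = (k == m)%:R.
  rewrite /fourier_coefficient; under [X in cint X]eq_fun do rewrite -characterD.
  by rewrite cint_character subr_eq0 eq_sym.
rewrite (csum_finite_support (A := [fset m]%fset)) => [|k].
  by rewrite big_seq_fset1 cE eqxx mulr1.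
by rewrite inE => km; rewrite cE (negbTE km) mulr0.
Qed.

End test_functions.

(** * The two sides as kernel expansions *)

Section kernels.
Context {R : realType} {n : nat}.
Notation mR := (measurableTypeR R).
Notation mu := (@cube_measure R n).
Notation Q := (@cube R n).
Notation Zn := 'rV[int]_n.
Notation Rn := 'rV[R]_n.
Let mQ : measurable Q. Proof. exact: measurable_cube. Qed.
Implicit Types (a phi : Zn -> Rn -> R[i]) (g h : nat -> Zn -> R[i]).

Lemma fio_unit_seq a phi m n' : fio a phi (unit_seq m) n' =
  cint (fun xi => expi (phi n' xi) * a n' xi * character m xi).
Proof.
congr cint; apply/funext => xi; congr (_ * _).
rewrite /dft (csum_finite_support (A := [fset m]%fset)) => [|k].
  by rewrite big_seq_fset1 /unit_seq eqxx mulr1.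
by rewrite inE => km; rewrite /unit_seq (negbTE km) mulr0.
Qed.

Definition coefficient_expansion (sigma : Zn -> Rn -> R[i]) g h :=
  forall n' m, ccvg (fun K => \sum_(k < K) h k n' * g k m)
    (cint (fun xi => sigma n' xi * character m xi)).

Lemma summable_norms_coord (r p1 p2 : R) g h n' : 0 < r -> r <= 1 -> 1 <= p2 ->
  summable_norms r p1 p2 g h ->
  exists (A : nat -> R) (C : R),
    [/\ forall k, 0 <= A k,
        forall k, (lp_norm (hoelder_conjugate p1%:E) (g k) <= (A k)%:E)%E &
        forall K, \sum_(k < K) normc (h k n') * A k <= C].
Proof.
move=> r0 r1 p21 /(summable_norms_bounds r0 r1)[A [B [C [hA hB hC]]]].
exists A, C; split=> [k|k|K]; first exact: (hA k).1.
  by rewrite (hA k).2.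
apply: le_trans (hC K); apply: ler_sum => k _; rewrite mulrC ler_wpM2l ?(hA k).1//.
apply: (@lp_norm_coord _ _ p2%:E); last by rewrite (hB k).2.
by rewrite lte_fin (lt_le_trans ltr01).
Qed.

(** The values of the operator on the unit sequences are the Fourier
    coefficients of e^{i phi} a, and by [coefficient_expansion_l1] they
    determine the operator on l^1. *)
Lemma r_nuclear_iff_expansion (r p1 p2 : R) a phi :
  0 < r -> r <= 1 -> 1 <= p1 -> 1 <= p2 ->
  (forall n', cintegrable (fun xi => expi (phi n' xi) * a n' xi)) ->
  r_nuclear (lp_norm p1%:E) (lp_norm p2%:E) r (in_lp 1%:E) (fio a phi) <->
  exists g h, summable_norms r p1 p2 g h /\
    coefficient_expansion (fun n' xi => expi (phi n' xi) * a n' xi) g h.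
Proof.
move=> r0 r1 p11 p21 isg; split.
  move=> /(r_nuclear_kernel r0 p11 p21)[|g [h [gh K]]].
    by move=> m; apply: le_lt_trans (lp_norm_unit_seq m ltr01) _; rewrite ltry.
  exists g, h; split; first exact: gh.
  by move=> n' m; rewrite -fio_unit_seq; exact: K.
move=> [g [h [gh K]]]; apply: (expansion_r_nuclear r0 r1 p11 p21 gh) => f n' fl.
have [F F0 fF] := lp_norm_fin_num fl.
have {}fF : abs_sums_le f F by apply/l1_norm_leP; rewrite fF.
have [A [C [A0 gA hC]]] := summable_norms_coord n' r0 r1 p21 gh.
have gb k m : normc (g k m) <= A k.
  exact: lp_norm_coord (hoelder_conjugate_gt0 p11) (gA k).
exact: (@coefficient_expansion_l1 _ _ _ _ _ _ (h ^~ n') _ _ (isg n') fF (K n') gb hC).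
Qed.

(** The norm of the transform of g_k in L^1 is at most the norm of g_k in
    the sequence space, so the series converges in L^1 and its coefficients
    can be computed term by term. *)
Lemma L2_expansion (r p1 p2 : R) g h (G : nat -> Rn -> R[i]) n' :
  0 < r -> r <= 1 -> 1 <= p1 -> 1 <= p2 ->
  (hoelder_conjugate p1%:E <= 2%:E)%E -> summable_norms r p1 p2 g h ->
  (forall k, is_dft_L2 (g k) (G k)) ->
  exists S, [/\ cintegrable S,
    ae_cube (fun xi => ccvg (fun K => \sum_(k < K) h k n' * G k (- xi)) (S xi)) &
    forall m, ccvg (fun K => \sum_(k < K) h k n' * g k m)
      (cint (fun xi => S xi * character m xi))].
Proof.
move=> r0 r1 p11 p21 q2 gh gG.
have [A [C [A0 gA hC]]] := summable_norms_coord n' r0 r1 p21 gh.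
have pG k : Defs.periodic (G k) by have [] := gG k.
have iG k := dft_L2_cintegrable (gG k).
have iGr k : cintegrable (fun xi => G k (- xi)) by exact: cintegrable_reflect.
have nG k : \int[mu]_(t in Q) normc (G k (- point t)) <= A k.
  rewrite /Rintegral (@integral_cube_reflect _ _ (fun xi => normc (G k xi))).
  - apply: (dft_L2_norm1 (gG k) (A0 k)).
    move: q2 (gA k); have [[_ ->]//|[p1' -> s1 _]] := hoelder_conjugate_cases p11.
    rewrite lee_fin => s2; apply: lp_norm_sums_le_sqr => //; exact: ltW.
  - by move=> xi m; rewrite pG.
  - by apply: measurable_normc; exact: cintegrable_cmeasurable.
pose H k xi := h k n' * G k (- xi).
have iH k : cintegrable (H k) by exact: cintegrableZ.
have HC K : \sum_(k < K) \int[mu]_(t in Q) normc (H k (point t)) <= C.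
  apply: le_trans (hC K); apply: ler_sum => k _.
  under eq_Rintegral do rewrite normcM.
  rewrite RintegralZl//; last exact: (cintegrable_normc (iGr k)).
  by rewrite ler_wpM2l ?normc_ge0.
have [iS cS coefS] := L1_series iH HC; exists (climsup (fun K xi => \sum_(k < K) H k xi)).
split => // m.
have mc := @cmeasurable_character R n m.
have b1 xi : normc (character m xi : R[i]) <= 1 by rewrite normc_character.
have := coefS _ mc b1; congr ccvg; apply/funext => K; apply: eq_bigr => k _.
transitivity (h k n' * cint (fun xi => G k (- xi) * character m xi)).
  rewrite -cintZ; last exact: cintegrable_mul_character.
  by congr cint; apply/funext => xi; rewrite mulrA.
congr (_ * _); rewrite -(dft_L2_coefficient m (gG k)) -[RHS]cint_reflect.
- by congr cint; apply/funext => xi; rewrite characterNr opprK.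
- by move=> xi z; rewrite pG character_periodic.
- by apply: cmeasurableM; [exact: cintegrable_cmeasurable|exact: cmeasurable_character].
Qed.

(** In one direction the decomposition is integrated against characters. In
    the other direction the symbol and the sum of the series have the same
    Fourier coefficients: for exponents at most 2 they are integrable
    functions, and uniqueness applies; otherwise a test function is the sum
    of its Fourier series, and [coefficient_expansion_l1] applies to its
    coefficients. *)
Lemma decomposition_iff_expansion (r p1 p2 : R) a phi :
  0 < r -> r <= 1 -> 1 <= p1 -> 1 <= p2 ->
  (forall n', cintegrable (fun xi => expi (phi n' xi) * a n' xi)) ->
  symbol_decomposition r p1 p2 a phi <->
  exists g h, summable_norms r p1 p2 g h /\
    coefficient_expansion (fun n' xi => expi (phi n' xi) * a n' xi) g h.
Proof.
move=> r0 r1 p11 p21 isg; pose sigma n' xi := expi (phi n' xi) * a n' xi.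
suff : symbol_decomposition r p1 p2 a phi <->
  exists g h, summable_norms r p1 p2 g h /\ coefficient_expansion sigma g h by [].
have msg n' : cmeasurable (sigma n') by exact: cintegrable_cmeasurable (isg n').
have [q2|q2] := boolP (hoelder_conjugate p1%:E <= 2%:E)%E; split.
- move=> [g [h [gq hp ghs [S]]]]; rewrite /is_fourier_series q2 => -[G gG cS] aS.
  have gh : summable_norms r p1 p2 g h by split.
  exists g, h; split => // n' m.
  have [S' [iS' cS' coefS']] := L2_expansion n' r0 r1 p11 p21 q2 gh gG.
  rewrite (_ : cint _ = cint (fun xi => S' xi * character m xi))//.
  apply: cint_ae_eq.
  + by apply: cmeasurableM => //; exact: cmeasurable_character.
  + apply: cmeasurableM; last exact: cmeasurable_character.
    exact: cintegrable_cmeasurable.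
  + move: (cS n') cS' (aS n'); rewrite /ae_cube; apply: filterS3 => t h1 h2 h3 Qt.
    by rewrite /sigma (h3 Qt) expiKN (ccvg_unique (h1 Qt) (h2 Qt)).
- move=> [g [h [gh coefs]]]; have [gq hp ghs] := gh.
  have /choice[G gG] k : exists G, is_dft_L2 (g k) G.
    have := gq k; rewrite /in_lp/= => /lp_norm_fin_num[M M0 gM].
    apply: (riesz_fischer (C := M ^+ 2)); move: q2 gM.
    have [[_ ->]//|[_ -> s1 _]] := hoelder_conjugate_cases p11.
    by rewrite lee_fin => s2 gM; apply: (lp_norm_sums_le_sqr (ltW s1) s2 M0); rewrite gM.
  exists g, h; split => //; exists sigma.
    rewrite /is_fourier_series q2; exists G => // n'.
    have [S [iS cS coefS]] := L2_expansion n' r0 r1 p11 p21 q2 gh gG.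
    have iD : cintegrable (fun xi => sigma n' xi - S xi).
      exact: cintegrableB (isg n') iS.
    have := fourier_uniqueness iD; rewrite /ae_cube => D0.
    move: cS; rewrite /ae_cube => cS'.
    apply: filterS2 (D0 _) cS' => [t h1 h2 Qt|m].
      by move/eqP: (h1 Qt); rewrite subr_eq0 => /eqP ->; exact: h2.
    under [X in cint X]eq_fun do rewrite mulrBl.
    have i1 := cintegrable_mul_character m (isg n' : cintegrable (sigma n')).
    have i2 := cintegrable_mul_character m iS.
    rewrite (cintB i1 i2).
    by apply/eqP; rewrite subr_eq0; apply/eqP; exact: ccvg_unique (coefs n' m) (coefS m).
  by move=> n'; rewrite /ae_cube; apply: nearW => t _; rewrite /sigma expiNK.
- move=> [g [h [gq hp ghs [S]]]]; rewrite /is_fourier_series (negbTE q2) => cS aS.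
  exists g, h; split; first by split.
  move=> n' m; have [iS tS] := cS n'.
  have := tS _ (test_function_character m).
  under [X in ccvg X]eq_fun do under eq_bigr do rewrite dft_dist_character.
  rewrite (_ : cint _ = cint (fun xi => sigma n' xi * character m xi))//.
  apply: cint_ae_eq.
  + apply: cmeasurableM; last exact: cmeasurable_character.
    exact: cintegrable_cmeasurable.
  + by apply: cmeasurableM => //; exact: cmeasurable_character.
  + move: (aS n'); rewrite /ae_cube; apply: filterS => t h3 Qt.
    by rewrite /sigma (h3 Qt) expiKN.
- move=> [g [h [gh coefs]]]; have [gq hp ghs] := gh.
  exists g, h; split => //; exists sigma.
    rewrite /is_fourier_series (negbTE q2) => n'; split; first exact: isg.
    move=> psi tp; have [C cC] := test_function_coefficients tp.
    under [X in ccvg X]eq_fun do under eq_bigr do rewrite dft_dist_reflect//.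
    rewrite (_ : cint _ = cint (fun xi => sigma n' xi * dft (fourier_coefficient psi) xi)).
      have [A [C' [A0 gA hC]]] := summable_norms_coord n' r0 r1 p21 gh.
      have gb k m : normc (g k m) <= A k.
        exact: lp_norm_coord (hoelder_conjugate_gt0 p11) (gA k).
      exact: (@coefficient_expansion_l1 _ _ _ _ _ _ (h ^~ n') _ _ (isg n') cC (coefs n') gb hC).
    apply: cint_ae_eq.
    + by apply: cmeasurableM => //; exact: cmeasurable_test_function.
    + by apply: cmeasurableM => //; exact: cmeasurable_dft cC.
    + move: (test_function_dft tp); rewrite /ae_cube; apply: filterS => t h3 Qt.
      by rewrite h3.
  by move=> n'; rewrite /ae_cube; apply: nearW => t _; rewrite /sigma expiNK.
Qed.

End kernels.

Theorem theorem3p2 (R : realType) (n : nat) (r p1 p2 : R)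
    (a phi : 'rV[int]_n -> 'rV[R]_n -> R[i]) :
  0 < r -> r <= 1 -> 1 <= p1 -> 1 <= p2 ->
  (forall n', cmeasurable (phi n')) ->
  (forall n', cmeasurable (a n')) ->
  (forall n', cintegrable (fun xi => expi (phi n' xi) * a n' xi)) ->
  r_nuclear (lp_norm p1%:E) (lp_norm p2%:E) r (in_lp 1%:E) (fio a phi) <->
  symbol_decomposition r p1 p2 a phi.
Proof.
move=> r0 r1 p11 p21 _ _ isg.
have nuclear := r_nuclear_iff_expansion r0 r1 p11 p21 isg.
have decomposition := decomposition_iff_expansion r0 r1 p11 p21 isg.
by split=> [/nuclear/decomposition|/decomposition/nuclear].
Qed.
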